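(* Let $N\ge 2$, $1<p\le q<\infty$, $0<\delta<1$, $\Omega=B_R(x_0)\subset\mathbb{R}^N$, and let $f,g,h,a$ satisfy the standing assumptions listed in the context. Let $u\in C^1(\overline\Omega)$ be a weak solution of $$-\operatorname{div}\big(|\nabla u|^{p-2}\nabla u+a(x)|\nabla u|^{q-2}\nabla u\big)=\frac{g(x)}{u^\delta}+h(x)f(u)\ \text{ in }\Omega,\qquad u>0\ \text{ in }\Omega,\qquad u=0\ \text{ on }\partial\Omega,$$ and let $Z_u=\{x\in\Omega:Du(x)=0\}$. Then $\Omega\setminus Z_u$ is connected, i.e. $\Omega\setminus Z_u$ does not contain any connected component $\mathcal{C}$ such that $\overline{\mathcal{C}}\subset\Omega$.
   Context: $B_R(x_0)=\{x\in\mathbb{R}^N:|x-x_0|<R\}$, $d(x)=\operatorname{dist}(x,\partial\Omega)$, and $p^*=Np/(N-p)$ for $p<N$. A weak solution $u$ satisfies $u>0$ in $\Omega$, $u=0$ on $\partial\Omega$ and $\int_\Omega(|\nabla u|^{p-2}\nabla u+a|\nabla u|^{q-2}\nabla u)\cdot\nabla\varphi\,dx=\int_\Omega(g u^{-\delta}+hf(u))\varphi\,dx$ for all $\varphi\in C_c^\infty(\Omega)$. ''Radially decreasing'' (resp. increasing) means: depending only on $|x-x_0|$ and decreasing (resp. increasing) in $|x-x_0|$. Standing assumptions. For some $\beta_0\ge 0$ with $\beta_0+\delta<1$: $(C_g)$ there are non-negative constants $C_1,C_2$ and $\rho>0$ such that $g\in L^\infty_{loc}(\Omega)$ satisfies $C_1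 d(x)^{-\beta_0}\le g(x)\le C_2 d(x)^{-\beta_0}$ for $x\in\overline\Omega$ with $d(x)<\rho$; $(C_{fh})$ $h(x)f(t)\ge 0$ for all $(x,t)\in\overline\Omega\times\mathbb{R}^+$, $f(0)=0$, and there are nonzero constants $C_3,C_4$ with $h(x)\le C_3$ and $f(t)\le C_4(1+t)^r$, where $p-1<r\le p^*-1$ if $p<N$ and $p-1<r<\infty$ otherwise; $(C_a)$ $0\le a\in W^{1,\infty}(\Omega)\cap C(\overline\Omega)$. Moreover, for some $c>0$: $f:\mathbb{R}\to\mathbb{R}$ is $C^1$ and nondecreasing; $g\in C^1(\overline\Omega)$ is radially decreasing with $g\ge c$; $h\in C^1(\overline\Omega)$ is radially decreasing with $h\ge c$; $a\in C^1(\overline\Omega)$ is radially increasing and nonnegative. *)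

(* Defs.v *)
From HB Require Import structures.
From mathcomp Require Import all_boot all_order all_algebra.
From mathcomp Require Import all_classical all_reals all_analysis.
Set Implicit Arguments.
Unset Strict Implicit.
Unset Printing Implicit Defensive.
Import Order.TTheory GRing.Theory Num.Theory.
Import numFieldNormedType.Exports.
Local Open Scope classical_set_scope.
Local Open Scope ring_scope.

(* The library norm on ['rV[R]_N] is the sup norm; it induces the usual
   topology and differentiability, but lengths must be Euclidean. *)
Definition dotv (R : realType) (N : nat) (x y : 'rV[R]_N) : R :=
  \sum_(i < N) x 0 i * y 0 i.

Definition enorm (R : realType) (N : nat) (x : 'rV[R]_N) : R :=
  Num.sqrt (dotv x x).

Definition eball (R : realType) (N : nat) (x0 : 'rV[R]_N) (r : R) :
  set 'rV[R]_N := [set x | enorm (x - x0) < r].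

Definition bdry (R : realType) (N : nat) (Om : set 'rV[R]_N) : set 'rV[R]_N :=
  closure Om `\` interior Om.

Definition bdist (R : realType) (N : nat) (Om : set 'rV[R]_N) (x : 'rV[R]_N) :
  R := inf [set enorm (x - y) | y in bdry Om].

(* [R^N] carries the sigma-algebra generated by the coordinates (that is, the
   Borel sets) and Lebesgue measure as the iterated product measure. *)
Definition rV_coord (R : realType) (n : nat) (i : 'I_n) (x : 'rV[R]_n) :
  measurableTypeR R := x 0 i.

Fact rV_display : measure_display.
Proof. exact: default_measure_display. Qed.

Section rV_lebesgue_measure.
Variable R : realType.

Section measurable_rV.
Variable n : nat.

Let rV0 : g_sigma_preimage (@rV_coord R n) set0.
Proof. exact: sigma_algebra0. Qed.

Let rVC A : g_sigma_preimage (@rV_coord R n) A ->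
  g_sigma_preimage (@rV_coord R n) (~` A).
Proof. exact: sigma_algebraC. Qed.

Let rV_bigcup (F : (set 'rV[R]_n)^nat) :
  (forall i, g_sigma_preimage (@rV_coord R n) (F i)) ->
  g_sigma_preimage (@rV_coord R n) (\bigcup_i F i).
Proof. exact: sigma_algebra_bigcup. Qed.

HB.instance Definition _ := @isMeasurable.Build rV_display
  'rV[R]_n (g_sigma_preimage (@rV_coord R n)) rV0 rVC rV_bigcup.

Lemma measurable_rV_coord (i : 'I_n) : measurable_fun setT (@rV_coord R n i).
Proof.
move=> _ Y mY; rewrite setTI; apply: sub_sigma_algebra => /=.
rewrite -bigcup_seq/=; exists i => /=; first by rewrite mem_index_enum.
by exists Y => //; rewrite setTI.
Qed.

Lemma measurable_fun_rVP d (T : measurableType d) (f : T -> 'rV[R]_n) :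
  (forall i, measurable_fun setT (@rV_coord R n i \o f)) ->
  measurable_fun setT f.
Proof.
move=> mf _ Y mY; rewrite setTI.
pose F : set (set 'rV[R]_n) := [set A | measurable (f @^-1` A)].
suff : F Y by [].
apply: mY; split.
- split => /=.
  + by rewrite /F/= preimage_set0.
  + by move=> A FA; rewrite /F/= setTD preimage_setC; exact: measurableC.
  + by move=> G FG; rewrite /F/= preimage_bigcup; exact: bigcupT_measurable.
- rewrite -bigcup_seq => A [i _ [B mB <-]].
  by rewrite /F/= setTI -[X in measurable X]setTI; exact: mf.
Qed.

End measurable_rV.

Definition rV_cons (n : nat) (z : measurableTypeR R * 'rV[R]_n) :
  'rV[R]_n.+1 := \row_j (if unlift ord0 j is Some k then z.2 0 k else z.1).

Definition rV_uncons (n : nat) (v : 'rV[R]_n.+1) :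
  measurableTypeR R * 'rV[R]_n := (v 0 ord0, \row_k v 0 (lift ord0 k)).

Lemma rV_consK n : cancel (@rV_cons n) (@rV_uncons n).
Proof.
move=> [x y]; rewrite /rV_uncons /rV_cons mxE unlift_none; congr pair.
by apply/rowP => k; rewrite !mxE liftK.
Qed.

Lemma rV_unconsK n : cancel (@rV_uncons n) (@rV_cons n).
Proof.
by move=> v; apply/rowP => j; rewrite mxE; case: unliftP => [k|] ->; rewrite /= ?mxE.
Qed.

Lemma measurable_rV_cons n : measurable_fun setT (@rV_cons n).
Proof.
apply: measurable_fun_rVP => j.
have [k ->|->] := unliftP ord0 j.
- rewrite (_ : _ \o _ = @rV_coord R n k \o snd); last first.
    by apply/funext => z; rewrite /rV_coord /rV_cons /= mxE liftK.
  by apply: measurableT_comp; [exact: measurable_rV_coord|exact: measurable_snd].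
- rewrite (_ : _ \o _ = fst); first exact: measurable_fst.
  by apply/funext => z; rewrite /rV_coord /rV_cons /= mxE unlift_none.
Qed.

Lemma measurable_rV_uncons n : measurable_fun setT (@rV_uncons n).
Proof.
apply/measurable_fun_pairP; split; first exact: (measurable_rV_coord ord0).
apply: measurable_fun_rVP => k.
rewrite (_ : _ \o _ = @rV_coord R n.+1 (lift ord0 k)).
  exact: measurable_rV_coord.
by apply/funext => v; rewrite /rV_coord /= mxE.
Qed.

Section rV_cons_measure.
Variables (n : nat) (m : {sigma_finite_measure set 'rV[R]_n -> \bar R}).

Definition rV_cons_measure :=
  pushforward ((@lebesgue_measure R) \x m)%E (@rV_cons n).

Let mpre A : measurable A -> measurable (@rV_cons n @^-1` A).
Proof. by move=> mA; rewrite -[X in measurable X]setTI; exact: measurable_rV_cons. Qed.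

Let rV_cons_measure0 : rV_cons_measure set0 = 0%E.
Proof. by rewrite /rV_cons_measure /pushforward preimage_set0 measure0. Qed.

Let rV_cons_measure_ge0 A : (0 <= rV_cons_measure A)%E.
Proof. by rewrite /rV_cons_measure /pushforward; exact: measure_ge0. Qed.

Let rV_cons_measure_sigma_additive : semi_sigma_additive rV_cons_measure.
Proof.
move=> F mF tF mUF; rewrite /rV_cons_measure /pushforward preimage_bigcup.
apply: measure_semi_sigma_additive.
- by move=> k; exact: mpre.
- apply/trivIsetP => /= i j _ _ ij; rewrite -preimage_setI.
  by move/trivIsetP : tF => /(_ _ _ _ _ ij) ->//; rewrite preimage_set0.
- by rewrite -preimage_bigcup; exact: mpre.
Qed.

HB.instance Definition _ := isMeasure.Build _ _ _ rV_cons_measure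
  rV_cons_measure0 rV_cons_measure_ge0 rV_cons_measure_sigma_additive.

Let rV_cons_measure_sigma_finite : sigma_finite setT rV_cons_measure.
Proof.
have /sigma_finiteP[F [TF ndF Foo]] := sigma_finiteT (@lebesgue_measure R).
have /sigma_finiteP[G [TG ndG Goo]] := sigma_finiteT m.
exists (fun k => @rV_uncons n @^-1` (F k `*` G k)).
  rewrite -preimage_bigcup (_ : \bigcup_k _ = setT) ?preimage_setT//.
  rewrite -subTset => -[x y] _.
  have [i _ Fix] : (\bigcup_i F i) x by rewrite -TF.
  have [j _ Gjy] : (\bigcup_i G i) y by rewrite -TG.
  exists (maxn i j) => //; split => /=.
  - by move: x Fix; exact/subsetPset/ndF/leq_maxl.
  - by move: y Gjy; exact/subsetPset/ndG/leq_maxr.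
move=> k; have [mF Fk] := Foo k; have [mG Gk] := Goo k; split.
  rewrite -[X in measurable X]setTI.
  by apply: measurable_rV_uncons => //; exact: measurableX.
rewrite /rV_cons_measure /pushforward -comp_preimage.
rewrite (_ : _ \o _ = id); last by apply/funext => z; exact: rV_consK.
by rewrite preimage_id product_measure1E// lte_mul_pinfty// ge0_fin_numE.
Qed.

HB.instance Definition _ := Measure_isSigmaFinite.Build _ _ _ rV_cons_measure
  rV_cons_measure_sigma_finite.

End rV_cons_measure.

Fixpoint lebesgue_rV (n : nat) : {sigma_finite_measure set 'rV[R]_n -> \bar R} :=
  match n with
  | 0 => \d_(0 : 'rV[R]_0)
  | n'.+1 => rV_cons_measure (lebesgue_rV n')
  end.

End rV_lebesgue_measure.

Section calculus.
Variables (R : realType) (N : nat).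
Implicit Types (Om K : set 'rV[R]_N) (u a f g phi : 'rV[R]_N -> R).

Definition partial (i : 'I_N) u (x : 'rV[R]_N) : R := 'D_(delta_mx 0 i) u x.

Definition grad u (x : 'rV[R]_N) : 'rV[R]_N := \row_i partial i u x.

Definition C1_closure Om u : Prop :=
  [/\ {within closure Om, continuous u},
      forall x, Om x -> differentiable u x &
      exists2 G : 'rV[R]_N -> 'rV[R]_N,
        {within closure Om, continuous G} & forall x, Om x -> G x = grad u x].

Fixpoint Ck (k : nat) u : Prop :=
  match k with
  | 0 => continuous u
  | k'.+1 => (forall x, differentiable u x) /\ (forall i, Ck k' (partial i u))
  end.

Definition test_fun Om phi : Prop :=
  (forall k, Ck k phi) /\
  exists K, [/\ compact K, K `<=` Om & forall x, ~ K x -> phi x = 0].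

Definition Linfty Om g : Prop :=
  measurable_fun Om g /\
  exists M : R, {ae lebesgue_rV R N, forall x, Om x -> `|g x| <= M}.

Definition Linfty_loc Om g : Prop :=
  forall K, compact K -> K `<=` Om -> Linfty K g.

Definition weak_partial Om (i : 'I_N) a b : Prop :=
  forall phi, test_fun Om phi ->
    \int[lebesgue_rV R N]_(x in Om) (a x * partial i phi x) =
    - \int[lebesgue_rV R N]_(x in Om) (b x * phi x).

Definition W1infty Om a : Prop :=
  Linfty Om a /\ forall i, exists2 b, Linfty Om b & weak_partial Om i a b.

End calculus.

Section problem.
Variables (R : realType) (N : nat).
Implicit Types (Om : set 'rV[R]_N) (a g h u : 'rV[R]_N -> R).

Definition radially_decreasing (x0 : 'rV[R]_N) (r : R) g : Prop :=
  exists2 G : R -> R,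
    {in `[0, r] &, {homo G : s t / s <= t >-> t <= s}} &
    forall x, closure (eball x0 r) x -> g x = G (enorm (x - x0)).

Definition radially_increasing (x0 : 'rV[R]_N) (r : R) g : Prop :=
  exists2 G : R -> R,
    {in `[0, r] &, {homo G : s t / s <= t}} &
    forall x, closure (eball x0 r) x -> g x = G (enorm (x - x0)).

(* [d(x)^{-beta0}] is the extended-real inverse of [d(x)^{beta0}]: it is [+oo]
   on the boundary when [beta0 > 0], whereas [0 `^ (- beta0)] is [0]. *)
Definition cond_g Om (beta0 : R) g : Prop :=
  Linfty_loc Om g /\
  exists C1 C2 rho : R, [/\ 0 <= C1, 0 <= C2, 0 < rho &
    forall x, closure Om x -> bdist Om x < rho ->
      (C1%:E / (bdist Om x `^ beta0)%:E <= (g x)%:E <=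
       C2%:E / (bdist Om x `^ beta0)%:E)%E].

Definition cond_fh Om (p : R) (f : R -> R) h : Prop :=
  [/\ forall x t, closure Om x -> 0 <= t -> 0 <= h x * f t,
      f 0 = 0 &
      exists C3 C4 r : R,
        [/\ C3 != 0 /\ C4 != 0,
            forall x, closure Om x -> h x <= C3,
            forall t, 0 <= t -> f t <= C4 * (1 + t) `^ r,
            p - 1 < r &
            p < N%:R -> r <= N%:R * p / (N%:R - p) - 1]].

Definition cond_a Om a : Prop :=
  [/\ forall x, closure Om x -> 0 <= a x, W1infty Om a &
      {within closure Om, continuous a}].

(* At points where [grad u x = 0] this is [0], also for exponents below [2]. *)
Definition flux (p q : R) a u (x : 'rV[R]_N) : 'rV[R]_N :=
  enorm (grad u x) `^ (p - 2) *: grad u x +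
  (a x * enorm (grad u x) `^ (q - 2)) *: grad u x.

Definition weak_solution Om (p q delta : R) (f : R -> R) g h a u : Prop :=
  [/\ forall x, Om x -> 0 < u x,
      forall x, bdry Om x -> u x = 0 &
      forall phi, test_fun Om phi ->
        \int[lebesgue_rV R N]_(x in Om) dotv (flux p q a u x) (grad phi x) =
        \int[lebesgue_rV R N]_(x in Om)
          ((g x * u x `^ (- delta) + h x * f (u x)) * phi x)].

Definition crit_set Om u : set 'rV[R]_N := [set x | Om x /\ grad u x = 0].

End problem.

(* Main.v *)
From HB Require Import structures.
Require Import Defs.
From mathcomp Require Import all_boot all_order all_algebra.
From mathcomp Require Import all_classical all_reals all_analysis.
From mathcomp Require Import measurable_realfun ring lra zify.
Set Implicit Arguments.
Unset Strict Implicit.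
Unset Printing Implicit Defensive.
Import Order.TTheory GRing.Theory Num.Theory.
Import numFieldNormedType.Exports.
Local Open Scope classical_set_scope.
Local Open Scope ring_scope.

(** The equation degenerates at the critical points of [u], and the theorem says
    that these cannot separate the ball. The idea is to integrate the equation
    over a hypothetical piece [B] of the noncritical set whose closure is inside
    the ball. Since the gradient, hence the flux, vanishes on the boundary of [B],
    the integral over [B] of the source [F = g u^(-delta) + h f(u)] should be 0,
    whereas [F] is bounded below by a positive constant.

    The boundary of [B] has no regularity, so this must be done with approximate
    indicators of [B]: functions that are 1 where the gradient exceeds a multiple
    of a small [k] and 0 where it is smaller than another. Their gradients are of
    order [|D^2 u| / k] on the layer where [|Du|] is of order [k], and there the
    flux is of order [k^(p-1)]. By Cauchy-Schwarz the error tends to 0, like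
    [k^((p-1)/2)], as soon as the integral of [|Du|^(p-2) |D^2 u|^2] over the layer
    is [O(k)]. The latter is an energy estimate ([energy_estimate]): differentiate
    the equation in a direction [v] and test with the derivative of [u] along [v],
    truncated at the level [k]. As [u] is only [C^1], derivatives of the equation
    are difference quotients whose step is chosen after [k].

    The coefficient [a] depends on the position, which adds to the right-hand side
    a multiple of the integral of [|Du|^(2q-p)] over the set where the derivative
    along [v] is [O(k)]. For a given [v] this set may be large, but each nonzero
    gradient is nearly orthogonal to few directions only. Averaging over a grid of
    directions produces, near each basis vector, a direction for which the term is
    [O(k)] ([good_direction]); the derivatives of [u] along [N] such directions
    still control its gradient ([near_basis_coercive]). This gives
    [no_interior_piece].

    It remains to see that a disconnection of the noncritical set produces such a
    piece. By comparison with a small paraboloid, [u] grows at least linearly away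
    from the boundary ([hopf_growth]), hence it has no critical point near the
    boundary ([noncritical_near_boundary]). As [N >= 2], the noncritical annulus
    that is obtained is connected ([connected_annulus]), and of two relatively
    clopen parts of the noncritical set one misses it. Finally, if the noncritical
    set is connected, it is its only component, and its closure meets the boundary
    of the ball because it contains the annulus. *)

(** * Euclidean length, sup norm and continuity *)

Section euclid.
Variables (R : realType) (N : nat).
Implicit Types x y z : 'rV[R]_N.

Lemma dotvC x y : dotv x y = dotv y x.
Proof. by apply: eq_bigr => i _; rewrite mulrC. Qed.

Lemma dotvDl x y z : dotv (x + y) z = dotv x z + dotv y z.
Proof. by rewrite -big_split; apply: eq_bigr => i _; rewrite mxE mulrDl. Qed.

Lemma dotvZl k x y : dotv (k *: x) y = k * dotv x y.
Proof. by rewrite /dotv big_distrr /=; apply: eq_bigr => i _; rewrite mxE mulrA. Qed.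

Lemma dotvNl x y : dotv (- x) y = - dotv x y.
Proof. by rewrite -scaleN1r dotvZl mulN1r. Qed.

Lemma dotvBl x y z : dotv (x - y) z = dotv x z - dotv y z.
Proof. by rewrite dotvDl dotvNl. Qed.

Lemma dotvDr x y z : dotv z (x + y) = dotv z x + dotv z y.
Proof. by rewrite !(dotvC z) dotvDl. Qed.

Lemma dotvBr x y z : dotv z (x - y) = dotv z x - dotv z y.
Proof. by rewrite !(dotvC z) dotvBl. Qed.

Lemma dotvZr k x y : dotv x (k *: y) = k * dotv x y.
Proof. by rewrite !(dotvC x) dotvZl. Qed.

Lemma dotv_ge0 x : 0 <= dotv x x.
Proof. by apply: sumr_ge0 => i _; rewrite -expr2 sqr_ge0. Qed.

Lemma enorm_ge0 x : 0 <= enorm x.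
Proof. exact: sqrtr_ge0. Qed.

Lemma sqr_enorm x : enorm x ^+ 2 = dotv x x.
Proof. by rewrite sqr_sqrtr// dotv_ge0. Qed.

Lemma le_coord_norm x i : `|x 0 i| <= `|x|.
Proof.
by rewrite [leRHS]/Num.norm /= mx_normrE; apply: (le_bigmax _ _ (0, i)).
Qed.

Lemma norm_le_coord x (M : R) : 0 <= M -> (forall i, `|x 0 i| <= M) -> `|x| <= M.
Proof.
move=> M0 xM; rewrite [leLHS]/Num.norm /= mx_normrE.
by apply/bigmax_leP; split => // -[a b] _ /=; rewrite ord1.
Qed.

Lemma norm_lt_coord x (M : R) : 0 < M -> (forall i, `|x 0 i| < M) -> `|x| < M.
Proof.
move=> M0 xM; rewrite [ltLHS]/Num.norm /= mx_normrE.
by apply/bigmax_ltP; split => // -[a b] _ /=; rewrite ord1.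
Qed.

Lemma norm_le_enorm x : `|x| <= enorm x.
Proof.
apply: norm_le_coord; first exact: enorm_ge0.
move=> i; rewrite -sqrtr_sqr; apply: ler_wsqrtr.
rewrite /dotv (bigD1 i)//= expr2 lerDl sumr_ge0// => j _.
by rewrite -expr2 sqr_ge0.
Qed.

Lemma enorm_le_norm x : enorm x <= N%:R * `|x|.
Proof.
rewrite -[leRHS]ger0_norm ?mulr_ge0// -sqrtr_sqr; apply: ler_wsqrtr.
rewrite /dotv (@le_trans _ _ (\sum_(i < N) `|x| ^+ 2))//.
  apply: ler_sum => i _; rewrite -expr2.
  by rewrite -real_normK ?num_real// lerXn2r ?nnegrE// le_coord_norm.
rewrite sumr_const card_ord exprMn -[leLHS]mulr_natl ler_wpM2r ?sqr_ge0//.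
by rewrite -natrX ler_nat; case: (N) => // n; rewrite leq_pmulr.
Qed.

Lemma dotv_sqr_le x y : dotv x y ^+ 2 <= dotv x x * dotv y y.
Proof.
have [y0|y0] := eqVneq (dotv y y) 0.
  have -> : y = 0.
    apply/eqP; rewrite -normr_eq0 eq_le normr_ge0 andbT.
    by rewrite (le_trans (norm_le_enorm y))// /enorm y0 sqrtr0.
  by rewrite -(scale0r 0) !dotvZr mul0r expr2 !mul0r mulr0.
have yy : 0 < dotv y y by rewrite lt_def y0 dotv_ge0.
have := dotv_ge0 (dotv y y *: x - dotv x y *: y).
rewrite !(dotvBl, dotvBr, dotvZl, dotvZr) (dotvC y x).
set a := dotv x x; set b := dotv x y; set d := dotv y y in yy *.
rewrite (_ : _ - _ = d * (a * d - b ^+ 2)); last by ring.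
by rewrite pmulr_rge0// subr_ge0.
Qed.

Lemma dotv_le x y : dotv x y <= enorm x * enorm y.
Proof.
apply: (le_trans (ler_norm _)); rewrite -sqrtr_sqr -sqrtrM ?dotv_ge0//.
by rewrite ler_wsqrtr// dotv_sqr_le.
Qed.

Lemma enormN x : enorm (- x) = enorm x.
Proof. by rewrite /enorm dotvNl dotvC dotvNl opprK. Qed.

Lemma dotv_norm_le x y : `|dotv x y| <= enorm x * enorm y.
Proof. by rewrite ler_norml dotv_le andbT lerNl -dotvNl -(enormN x) dotv_le. Qed.

Lemma enormZ k x : enorm (k *: x) = `|k| * enorm x.
Proof.
by rewrite /enorm dotvZl dotvZr mulrA -expr2 sqrtrM ?sqr_ge0// sqrtr_sqr.
Qed.

Lemma enorm0 : enorm (0 : 'rV[R]_N) = 0.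
Proof. by rewrite -(scale0r 0) enormZ normr0 mul0r. Qed.

Lemma enorm_eq0 x : (enorm x == 0) = (x == 0).
Proof.
apply/idP/idP => [/eqP x0|/eqP->]; last by rewrite enorm0.
by rewrite -normr_eq0 eq_le normr_ge0 andbT -x0 norm_le_enorm.
Qed.

Lemma enorm_gt0 x : (0 < enorm x) = (x != 0).
Proof. by rewrite lt_def enorm_eq0 enorm_ge0 andbT. Qed.

Lemma ler_enormD x y : enorm (x + y) <= enorm x + enorm y.
Proof.
rewrite -(@ler_pXn2r _ 2)// ?nnegrE ?addr_ge0 ?enorm_ge0//.
rewrite sqrrD !sqr_enorm !(dotvDl, dotvDr) (dotvC y x).
by have := dotv_le x y; lra.
Qed.

Lemma ler_enormB x y : enorm (x - y) <= enorm x + enorm y.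
Proof. by rewrite -(enormN y) ler_enormD. Qed.

Lemma enorm_dist x y : `|enorm x - enorm y| <= N%:R * `|x - y|.
Proof.
apply: (le_trans _ (enorm_le_norm _)); rewrite ler_norml.
have h (a b : 'rV[R]_N) : enorm a <= enorm (a - b) + enorm b.
  by have := ler_enormD (a - b) b; rewrite subrK.
have := h x y; have := h y x; rewrite -(enormN (y - x)) opprB; lra.
Qed.

Lemma dotv_delta i y : dotv (delta_mx 0 i) y = y 0 i.
Proof.
rewrite /dotv (bigD1 i)//= big1 ?addr0 => [|j ji]; first by rewrite mxE !eqxx mul1r.
by rewrite mxE eqxx (negbTE ji) mul0r.
Qed.

End euclid.

Section continuity.
Variable R : realType.
Implicit Types e d : R.

Lemma continuousP_eps (V W : normedModType R) (f : V -> W) (x : V) :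
  {for x, continuous f} <->
  (forall e : R, 0 < e -> exists2 d : R, 0 < d & forall y, `|x - y| < d -> `|f x - f y| < e).
Proof.
split=> [/cvgrPdist_lt h e e0|h].
  have := h e e0; rewrite near_simpl => /nbhs_ballP[d /= d0 hd].
  by exists d => // y xy; apply: hd; rewrite -ball_normE.
apply/cvgrPdist_lt => e e0; have [d d0 hd] := h e e0.
by apply/nbhs_ballP; exists d => //= y; rewrite -ball_normE; exact: hd.
Qed.

Lemma withinP_eps (V W : normedModType R) (K : set V) (f : V -> W) :
  {within K, continuous f} <->
  (forall x, K x -> forall e : R, 0 < e -> exists2 d : R, 0 < d &
     forall y, K y -> `|x - y| < d -> `|f x - f y| < e).
Proof.
split=> [/subspace_continuousP h x Kx e e0|h]; last first.
  apply/subspace_continuousP => x Kx; apply/cvgrPdist_lt => e e0.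
  have [d d0 hd] := h x Kx e e0.
  rewrite near_withinE; apply/nbhs_ballP; exists d => //= y.
  by rewrite -ball_normE => xy Ky; exact: hd.
- have /cvgrPdist_lt /(_ e e0) := h x Kx.
  rewrite near_withinE => /nbhs_ballP[d /= d0 hd].
  by exists d => // y Ky xy; apply: hd => //; rewrite -ball_normE.
Qed.

(** Heine's theorem, for functions that are continuous on a compact set. *)
Lemma within_unif_continuous (V W : normedModType R) (K : set V) (f : V -> W) :
  compact K -> {within K, continuous f} -> forall e : R, 0 < e -> exists2 d : R, 0 < d &
    forall x y, K x -> K y -> `|x - y| < d -> `|f x - f y| < e.
Proof.
move=> /compact_near_coveringP cK /withinP_eps cf e e0.
pose P (d : R) x := K x -> forall y, K y -> `|x - y| < d -> `|f x - f y| < e.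
have : \forall d \near 0^'+, K `<=` P d.
  apply: cK => x Kx; have [d d0 hd] := cf x Kx _ (divr_gt0 e0 (ltr0Sn _ 1)).
  exists (ball x (d / 2), [set t | t < d / 2]) => /=.
    split; first by apply: nbhsx_ballx; rewrite divr_gt0.
    by near=> t => /=; near: t; apply: nbhs_right_lt; rewrite divr_gt0.
  move=> [x' t] /= []; rewrite -ball_normE /= => xx' td Kx' y Ky x'y.
  have h1 : `|f x - f x'| < e / 2 by apply: hd => //; lra.
  have h2 : `|f x - f y| < e / 2.
    apply: hd => //; have := ler_distD x' x y; lra.
  by have := ler_distD (f x) (f x') (f y); rewrite (distrC (f x') (f x)); lra.
move=> KP; have [d [/= d0 hd]] := filter_ex (filterI (nbhs_right_gt 0) KP).
exists d => // x y Kx; exact: (hd x Kx Kx).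
Unshelve. all: end_near. Qed.
Lemma continuous_addr_rV (N : nat) (v : 'rV[R]_N) :
  continuous (fun x : 'rV[R]_N => x + v : 'rV[R]_N).
Proof.
move=> x; apply/continuousP_eps => e e0; exists e => // y.
by rewrite opprD addrACA subrr addr0.
Qed.

Lemma continuous_sum_at (V : normedModType R) (I : Type) (r : seq I) (f : I -> V -> R) x :
  (forall i, {for x, continuous (f i)}) -> {for x, continuous (fun y => \sum_(i <- r) f i y)}.
Proof.
move=> cf; rewrite -fct_sumE; elim: r => [|i r IHr].
  by rewrite big_nil; exact: cst_continuous.
by rewrite big_cons; apply: (@continuousD _ _ _ (f i)).
Qed.

Lemma continuous_coord_at (V : normedModType R) (N : nat) (f : V -> 'rV[R]_N) i x :
  {for x, continuous f} -> {for x, continuous (fun y => f y 0 i)}.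
Proof. by move=> cf; apply: (@continuous_comp _ _ _ f (fun w => w 0 i)) => //; exact: coord_continuous. Qed.

Lemma continuous_powR_at (V : normedModType R) (f : V -> R) (s : R) x :
  0 < f x -> {for x, continuous f} -> {for x, continuous (fun y => f y `^ s)}.
Proof.
move=> fx cf; apply: (@continuous_comp _ _ _ f (fun t => t `^ s)) => //.
apply: differentiable_continuous; apply/derivable1_diffP.
by have [] := is_derive1_powR s fx.
Qed.

Lemma continuous_at_within (V W : normedModType R) (K : set V) (f : V -> W) :
  (forall x, K x -> {for x, continuous f}) -> {within K, continuous f}.
Proof. by move=> cf; apply: continuous_in_subspaceT => x /set_mem; exact: cf. Qed.

End continuity.

(** * Integrals of compactly supported continuous functions *)

Section measure.
Variable R : realType.

Lemma ballP_coord n (x y : 'rV[R]_n) (r : R) : 0 < r ->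
  ball x r y <-> forall i, `|x 0 i - y 0 i| < r.
Proof.
move=> r0; rewrite -ball_normE /=; split=> [h i|h].
  by apply: le_lt_trans h; have := le_coord_norm (x - y) i; rewrite !mxE.
by apply: norm_lt_coord => // i; rewrite !mxE.
Qed.

Lemma measurable_ball_rV n (x : 'rV[R]_n) (r : R) : 0 < r -> measurable (ball x r).
Proof.
move=> r0.
rewrite (_ : ball x r = \bigcap_(i in [set: 'I_n])
    (@rV_coord R n i @^-1` (ball (x 0 i) r))).
  apply: fin_bigcap_measurable => // i _; rewrite -[X in measurable X]setTI.
  by apply: measurable_rV_coord => //; exact: measurable_ball.
apply/seteqP; split => y; first by move/ballP_coord => /(_ r0) h i _; exact: h.
by move=> h; apply/ballP_coord => // i; exact: h.
Qed.

(** An open set is the union of the countably many cubes with a rational centre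
    and a side [2 / (k + 1)] that it contains. *)
Lemma open_measurable_rV n (U : set 'rV[R]_n) : open U -> measurable U.
Proof.
move=> oU.
pose c (q : 'rV[rat]_n) : 'rV[R]_n := map_mx ratr q.
pose F (qk : 'rV[rat]_n * nat) := if pselect (ball (c qk.1) qk.2.+1%:R^-1 `<=` U)
  is left _ then ball (c qk.1) qk.2.+1%:R^-1 else set0.
rewrite (_ : U = \bigcup_qk F qk).
  apply: countable_bigcupT_measurable; first exact: countableP.
  move=> qk; rewrite /F; case: pselect => _ //.
  by apply: measurable_ball_rV; rewrite invr_gt0.
apply/seteqP; split => [x Ux|x [qk _]]; last by rewrite /F; case: pselect => // h; exact: h.
have /nbhs_ballP[e /= e0 he] := open_nbhs_nbhs (conj oU Ux).
have [k ke] : exists k, k.+1%:R^-1 < e / 2.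
  have := @near_infty_natSinv_lt R (PosNum (divr_gt0 e0 (ltr0Sn _ 1))).
  by case=> k _ /(_ k (leqnn k)) /= ?; exists k.
have k0 : 0 < k.+1%:R^-1 :> R by rewrite invr_gt0.
have /choice[q hq] (i : 'I_n) : exists q : rat, `|ratr q - x 0 i| < k.+1%:R^-1.
  have /rat_in_itvoo[q] : x 0 i - k.+1%:R^-1 < x 0 i + k.+1%:R^-1.
    by move: (k.+1%:R^-1) k0 => r r0; lra.
  by rewrite in_itv /= => /andP[q1 q2]; exists q; rewrite ltr_norml; move: (k.+1%:R^-1) k0 q1 q2 => r; lra.
exists (\row_i q i, k) => //; rewrite /F; case: pselect => [_|[]] /=.
  by apply/ballP_coord => // i; rewrite !mxE.
move=> y; rewrite -ball_normE /= => cy; apply: he; rewrite -ball_normE /=.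
have cx : `|c (\row_i q i) - x| < k.+1%:R^-1.
  by apply: norm_lt_coord => // i; rewrite !mxE.
have := ler_distD (c (\row_i q i)) x y; rewrite (distrC x (c _)).
by move: (k.+1%:R^-1) cx cy ke => r; lra.
Qed.

Lemma continuous_measurable_rV n (f : 'rV[R]_n -> R) :
  continuous f -> measurable_fun setT f.
Proof.
move=> /continuousP cf; apply: (measurability _ (RGenOpens.measurableE R)).
move=> _ [_ [a [b ->]] <-]; rewrite setTI; apply: open_measurable_rV.
exact/cf/interval_open.
Qed.

Lemma lebesgue_rV_ball n (x : 'rV[R]_n) (r : R) : 0 < r ->
  lebesgue_rV R n (ball x r) = ((2 * r) ^+ n)%:E.
Proof.
move=> r0; elim: n x => [|n IH] x.
  rewrite /= diracE mem_set ?expr0//; by apply/ballP_coord => // -[m i]; have := i.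
rewrite /= /rV_cons_measure /pushforward.
rewrite (_ : _ @^-1` _ = ball (x 0 ord0) r `*` ball (\row_k x 0 (lift ord0 k)) r).
  rewrite product_measure1E/=; [|exact: measurable_ball|exact: measurable_ball_rV].
  rewrite IH lebesgue_measure_ball 1?ltW//.
  by rewrite exprS EFinM mulr_natl.
apply/seteqP; split=> -[t y] /=.
  move=> /ballP_coord-/(_ r0) h; split.
    by have := h ord0; rewrite mxE unlift_none.
  apply/ballP_coord => // i.
  by have := h (lift ord0 i); rewrite !mxE liftK.
move=> [ht /ballP_coord-/(_ r0) hy]; apply/ballP_coord => // i.
rewrite mxE; case: unliftP => [k|] -> //=.
by have := hy k; rewrite mxE.
Qed.

Let mu1 := @lebesgue_measure R.

Lemma measurable_addr (c : R) : measurable_fun setT (fun x : measurableTypeR R => x + c : measurableTypeR R).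
Proof. exact: measurable_funD. Qed.

Lemma lebesgue_measure_shift (c : R) (A : set (measurableTypeR R)) : measurable A ->
  mu1 [set x | A (x + c)] = mu1 A.
Proof.
move=> mA; apply/esym.
apply: (@lebesgue_measure_unique R
  (measure_function_pushforward__canonical__measure_function_Measure
    mu1 (measurable_addr c))) => // _ [[a b] _ <-].
rewrite /= /pushforward.
rewrite (_ : _ @^-1` _ = `](a - c), (b - c)]%classic); last first.
  by apply/seteqP; split=> x /=; rewrite !in_itv/=; lra.
rewrite !lebesgue_measure_itv /= !lte_fin ltrD2r; case: ifP => // _.
by rewrite -!EFinB; congr (_%:E); ring.
Qed.

Lemma ge0_integral_lebesgue_shift (c : R) (f : measurableTypeR R -> \bar R) :
  measurable_fun setT f -> (forall x, 0 <= f x)%E ->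
  (\int[mu1]_x f (x + c)%R = \int[mu1]_x f x)%E.
Proof.
move=> mf f0.
have := @ge0_integral_pushforward _ _ _ _ R _ (measurable_addr c) mu1 setT f
  measurableT mf (fun x _ => f0 x).
rewrite preimage_setT /= => <-; apply: eq_measure_integral; first exact: measurable_addr.
by move=> mf' A mA _; exact: lebesgue_measure_shift.
Qed.

Lemma measurable_shift_rV n (v : 'rV[R]_n) :
  measurable_fun setT (fun x : 'rV[R]_n => x + v : 'rV[R]_n).
Proof.
apply: measurable_fun_rVP => i.
rewrite (_ : _ \o _ = fun x => rV_coord i x + v 0 i); last first.
  by apply/funext => x; rewrite /rV_coord /= mxE.
by apply: measurable_funD => //; exact: measurable_rV_coord.
Qed.

Lemma rV_consD n (x : R) (y : 'rV[R]_n) (v : 'rV[R]_n.+1) :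
  rV_cons (x, y) + v = rV_cons (x + v 0 ord0, y + \row_k v 0 (lift ord0 k)).
Proof.
apply/rowP => j; rewrite !mxE; case: unliftP => [k|] -> /=; last by [].
by rewrite !mxE.
Qed.

(** Induction on the dimension: the slices are translated by the tail of [v], and
    the integral over the first coordinate is translation invariant. *)
Lemma lebesgue_rV_shift n (v : 'rV[R]_n) (A : set 'rV[R]_n) : measurable A ->
  lebesgue_rV R n [set x | A (x + v)] = lebesgue_rV R n A.
Proof.
elim: n v A => [|n IH] v A mA.
  by congr (lebesgue_rV R 0 _); apply/funext => x; rewrite /mkset (thinmx0 v) addr0.
rewrite /= /rV_cons_measure /pushforward /product_measure1.
set B := rV_cons (n:=n) @^-1` A.
have mB : measurable B.
  by rewrite -[X in measurable X]setTI; exact: measurable_rV_cons.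
pose v' := \row_k v 0 (lift ord0 k).
pose g x := lebesgue_rV R n (xsection B x).
transitivity (\int[mu1]_x g (x + v 0 ord0)%R)%E.
  apply: eq_integral => x _; rewrite /= /g -(IH v' (xsection B (x + v 0 ord0))); last exact: measurable_xsection.
  congr (lebesgue_rV R n _); apply/seteqP.
  by split=> y; rewrite /xsection /= !inE /B /= rV_consD.
apply: ge0_integral_lebesgue_shift; last by move=> x; exact: measure_ge0.
exact: measurable_fun_xsection.
Qed.
End measure.

Section Cc.
Variables (R : realType) (n : nat).
Implicit Types (f g : 'rV[R]_n -> R) (x y v : 'rV[R]_n).
Local Notation mu := (lebesgue_rV R n).

Definition Cc f := continuous f /\ exists M : R, forall x, M < `|x| -> f x = 0.

(** All the integrals of the proof are brought to integrals over the whole space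
    of functions in [Cc], for which integrability is automatic. *)
Definition intg f : R := \int[mu]_x f x.

Lemma CcP f : Cc f -> exists M : R, [/\ 0 < M, forall x, M <= `|x| -> f x = 0 &
  exists2 B : R, 0 < B & forall x, `|f x| <= B].
Proof.
move=> [cf [M fM]].
have M0 : 0 < `|M| + 1 by rewrite ltr_wpDl.
exists (`|M| + 1); split => // [x Mx|].
  by apply: fM; have := ler_norm M; lra.
have cK : compact (closed_ball (0 : 'rV[R]_n) (`|M| + 1)).
  apply: bounded_closed_compact; last exact: closed_ball_closed.
  exists (`|M| + 1); split; first exact: num_real.
  move=> B MB x; rewrite closed_ballE// /closed_ball_ /= sub0r normrN => xM.
  by apply: le_trans xM _; exact: ltW.
have := @compact_bounded _ _ _ (continuous_compact (continuous_subspaceT cf) cK).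
move=> /pinfty_ex_gt0[B B0 fB]; exists B => // x.
have [xM|xM] := ltP (`|M| + 1) `|x|.
  by rewrite fM ?normr0 ?ltW//; have := ler_norm M; lra.
by apply: fB; exists x => //; rewrite closed_ballE// /closed_ball_ /= sub0r normrN.
Qed.

Lemma integrable_indic_ball x (r : R) : 0 < r ->
  mu.-integrable setT (EFin \o \1_(ball x r)).
Proof.
move=> r0; have mb := measurable_ball_rV x r0.
apply/integrableP; split; first exact/measurable_EFinP.
rewrite (eq_integral (fun y => (\1_(ball x r) y)%:E)); last first.
  by move=> t _; rewrite /= ger0_norm.
by rewrite integral_indic// setIT [ltLHS](lebesgue_rV_ball x r0) ltry.
Qed.

Lemma bounded_integrable f (M B : R) : 0 < M -> measurable_fun setT f ->
  (forall x, M <= `|x| -> f x = 0) -> (forall x, `|f x| <= B) ->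
  mu.-integrable setT (EFin \o f).
Proof.
move=> M0 mf f0 fB.
have iB := integrableZl measurableT B (integrable_indic_ball 0 M0).
apply: le_integrable iB => //; first exact/measurable_EFinP.
move=> x _ /=; rewrite lee_fin indicE; have [xb|xb] := boolP (x \in _).
  by rewrite mulr1 (le_trans (fB x))// ler_norm.
rewrite f0 ?normr0//; move: xb; rewrite notin_setE -ball_normE /= sub0r normrN.
by move/negP; rewrite -leNgt.
Qed.

Lemma Cc_integrable f : Cc f -> mu.-integrable setT (EFin \o f).
Proof.
move=> cf; have [M [M0 fM [B B0 fB]]] := CcP cf.
exact: (bounded_integrable M0 (continuous_measurable_rV cf.1) fM fB).
Qed.

Lemma intgD f g : Cc f -> Cc g -> intg (fun x => f x + g x) = intg f + intg g.
Proof. by move=> cf cg; rewrite /intg RintegralD//; exact: Cc_integrable. Qed.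

Lemma intgB f g : Cc f -> Cc g -> intg (fun x => f x - g x) = intg f - intg g.
Proof. by move=> cf cg; rewrite /intg RintegralB//; exact: Cc_integrable. Qed.

Lemma intgZ k f : Cc f -> intg (fun x => k * f x) = k * intg f.
Proof. by move=> cf; rewrite /intg RintegralZl//; exact: Cc_integrable. Qed.

Lemma le_intg f g : Cc f -> Cc g -> (forall x, f x <= g x) -> intg f <= intg g.
Proof. by move=> cf cg fg; apply: le_Rintegral => //; exact: Cc_integrable. Qed.

Lemma intg_ge0 f : (forall x, 0 <= f x) -> 0 <= intg f.
Proof. by move=> f0; apply: Rintegral_ge0. Qed.

Lemma intg_indic_ball x (r : R) : 0 < r -> intg \1_(ball x r) = (2 * r) ^+ n.
Proof.
move=> r0; rewrite /intg /Rintegral integral_indic//; last exact: measurable_ball_rV.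
by rewrite setIT [X in fine X](lebesgue_rV_ball x r0).
Qed.

Lemma le_intg_ball f x (r c : R) : Cc f -> 0 < r -> (forall y, 0 <= f y) ->
  (forall y, `|x - y| < r -> c <= f y) -> c * (2 * r) ^+ n <= intg f.
Proof.
move=> cf r0 f0 fc; rewrite -(intg_indic_ball x r0) /intg -RintegralZl//; last first.
  exact: integrable_indic_ball.
apply: le_Rintegral => //.
- by have := integrableZl measurableT c (integrable_indic_ball x r0).
- exact: Cc_integrable.
move=> y _; rewrite indicE; have [yb|yb] := boolP (y \in _).
  by rewrite mulr1; apply: fc; move: yb; rewrite inE -ball_normE.
by rewrite mulr0.
Qed.

Lemma intg_norm_le f (M B : R) : Cc f -> 0 < M -> (forall x, `|f x| <= B) ->
  (forall x, M <= `|x| -> f x = 0) -> `|intg f| <= B * (2 * M) ^+ n.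
Proof.
move=> cf M0 fB fM; rewrite /intg.
apply: (le_trans (le_normr_Rintegral measurableT (Cc_integrable cf))).
rewrite -(intg_indic_ball 0 M0) /intg -RintegralZl//; last first.
  exact: integrable_indic_ball.
apply: le_Rintegral => //.
- by have := integrable_abse (Cc_integrable cf).
- by have := integrableZl measurableT B (integrable_indic_ball 0 M0).
move=> y _; rewrite indicE; have [yb|yb] := boolP (y \in _); first by rewrite mulr1.
rewrite mulr0 fM ?normr0//; move: yb; rewrite notin_setE -ball_normE /= sub0r normrN.
by move/negP; rewrite -leNgt.
Qed.

Lemma Cc_shift v f : Cc f -> Cc (fun x => f (x + v)).
Proof.
move=> [cf [M fM]]; split.
  move=> x; apply: (@continuous_comp _ _ _ (fun x => x + v) f); last exact: cf.
  by apply: continuousD => //; exact: cst_continuous.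
exists (M + `|v|) => x xM; apply: fM.
by have := ler_normB (x + v) v; rewrite addrK; lra.
Qed.

Lemma intg_shift v f : Cc f -> intg (fun x => f (x + v)) = intg f.
Proof.
move=> cf; rewrite /intg /Rintegral; congr fine.
have mf : measurable_fun setT (EFin \o f).
  by apply/measurable_EFinP; exact: continuous_measurable_rV cf.1.
have := @integral_pushforward _ _ _ _ R _ (measurable_shift_rV v) mu setT _ mf.
rewrite preimage_setT => /(_ (Cc_integrable (Cc_shift v cf)) measurableT) <-.
apply: eq_measure_integral; first exact: measurable_shift_rV.
by move=> mf' A mA _; exact: lebesgue_rV_shift.
Qed.

Lemma CcD f g : Cc f -> Cc g -> Cc (fun x => f x + g x).
Proof.
move=> [cf [M fM]] [cg [M' gM]]; split; first by move=> x; apply: continuousD; [exact: cf|exact: cg].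
by exists (Num.max M M') => x; rewrite gt_max => /andP[? ?]; rewrite fM// gM// addr0.
Qed.

Lemma CcMl f g : continuous f -> Cc g -> Cc (fun x => f x * g x).
Proof.
move=> cf [cg [M gM]]; split; first by move=> x; apply: continuousM; [exact: cf|exact: cg].
by exists M => x /gM ->; rewrite mulr0.
Qed.

Lemma CcMr f g : Cc f -> continuous g -> Cc (fun x => f x * g x).
Proof.
move=> cf cg; rewrite (_ : (fun _ => _) = fun x => g x * f x); first exact: CcMl.
by apply/funext => x; rewrite mulrC.
Qed.

Lemma CcZ k f : Cc f -> Cc (fun x => k * f x).
Proof. by apply: CcMl => x; exact: cst_continuous. Qed.

Lemma CcB f g : Cc f -> Cc g -> Cc (fun x => f x - g x).
Proof.
move=> cf cg; rewrite (_ : (fun _ => _) = fun x => f x + (-1) * g x).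
  by apply: CcD => //; exact: CcZ.
by apply/funext => x; rewrite mulN1r.
Qed.

Lemma Cc0 : Cc (fun=> 0).
Proof. by split; [move=> x; exact: cst_continuous|exists 0]. Qed.

Lemma Cc_sum (I : Type) (r : seq I) (F : I -> 'rV[R]_n -> R) :
  (forall i, Cc (F i)) -> Cc (fun x => \sum_(i <- r) F i x).
Proof.
move=> cF; elim: r => [|i r IH].
  by rewrite (_ : (fun _ => _) = fun=> 0); [exact: Cc0|apply/funext => x; rewrite big_nil].
rewrite (_ : (fun _ => _) = fun x => F i x + \sum_(j <- r) F j x); first exact: CcD.
by apply/funext => x; rewrite big_cons.
Qed.

Lemma intg0 : intg (fun=> 0) = 0.
Proof. by rewrite /intg Rintegral_cst// mul0r. Qed.

Lemma intg_sum (I : Type) (r : seq I) (F : I -> 'rV[R]_n -> R) :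
  (forall i, Cc (F i)) -> intg (fun x => \sum_(i <- r) F i x) = \sum_(i <- r) intg (F i).
Proof.
move=> cF; elim: r => [|i r IH].
  rewrite big_nil -[RHS]intg0; congr intg; apply/funext => x; exact: big_nil.
rewrite big_cons -IH -intgD//; last exact: Cc_sum.
by congr intg; apply/funext => x; rewrite big_cons.
Qed.

(** Fubini's theorem for the kernels that convolution produces. *)
Lemma intg_fubini f g k : Cc f -> Cc g -> Cc k ->
  intg (fun x => f x * intg (fun y => g y * k (x - y))) =
  intg (fun y => g y * intg (fun x => f x * k (x - y))).
Proof.
move=> cf cg ck.
have [Mf [Mf0 fM [Bf Bf0 fB]]] := CcP cf.
have [Mg [Mg0 gM [Bg Bg0 gB]]] := CcP cg.
have [_ [_ _ [Bk Bk0 kB]]] := CcP ck.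
have mrv (h : 'rV[R]_n -> R) : Cc h -> measurable_fun setT h.
  by move=> ch; exact: continuous_measurable_rV ch.1.
pose F (z : 'rV[R]_n * 'rV[R]_n) : R := f z.1 * (g z.2 * k (z.1 - z.2)).
have mF : measurable_fun setT F.
  apply: measurable_funM; first by apply: measurableT_comp; [exact: mrv|exact: measurable_fst].
  apply: measurable_funM; first by apply: measurableT_comp; [exact: mrv|exact: measurable_snd].
  apply: (@measurableT_comp _ _ _ _ _ _ k _ (fun z : 'rV[R]_n * 'rV[R]_n => z.1 - z.2)).
    exact: mrv.
  apply: measurable_fun_rVP => i.
  rewrite (_ : _ \o _ = fun z => rV_coord i z.1 - rV_coord i z.2); last first.
    by apply/funext => z; rewrite /rV_coord /= !mxE.
  by apply: measurable_funB; apply: measurableT_comp;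
    (exact: measurable_rV_coord || exact: measurable_fst || exact: measurable_snd).
have mfg := measurableX (measurable_ball_rV (0 : 'rV[R]_n) Mf0) (measurable_ball_rV (0 : 'rV[R]_n) Mg0).
have iF : (mu \x mu)%E.-integrable setT (EFin \o F).
  have : (mu \x mu)%E.-integrable setT
      (fun z => (Bf * (Bg * Bk))%:E * (\1_(ball 0 Mf `*` ball 0 Mg) z)%:E)%E.
    apply: integrableZl => //; apply/integrableP; split; first exact/measurable_EFinP.
    rewrite (eq_integral (fun z : 'rV[R]_n * 'rV[R]_n => (\1_(ball 0 Mf `*` ball 0 Mg) z)%:E)); last first.
      by move=> t _; rewrite gee0_abs// lee_fin.
    rewrite integral_indic// setIT.
    rewrite [ltLHS]product_measure1E; [|exact: measurable_ball_rV|exact: measurable_ball_rV].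
    have e1 : mu (ball 0 Mf) = _ := lebesgue_rV_ball 0 Mf0.
    have e2 : mu (ball 0 Mg) = _ := lebesgue_rV_ball 0 Mg0.
    have := ltry ((2 * Mf) ^+ n * (2 * Mg) ^+ n).
    by rewrite EFinM -e1 -e2; apply.
  apply: le_integrable => //; first exact/measurable_EFinP.
  move=> [x y] _ /=; rewrite lee_fin indicE.
  have [xb|xb] := boolP ((x, y) \in _).
    rewrite mulr1 !normrM (ger0_norm (ltW Bf0)) (ger0_norm (ltW Bg0)) (ger0_norm (ltW Bk0)).
    by rewrite !ler_pM// mulr_ge0.
  have [xM|xM] := leP Mf `|x|; first by rewrite /F /= fM// mul0r normr0.
  have [yM|yM] := leP Mg `|y|; first by rewrite /F /= gM// mul0r mulr0 normr0.
  by move: xb; rewrite notin_setE -!ball_normE /= !sub0r !normrN xM yM => -[].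
have := Fubini iF => /=.
have inner x : (\int[mu]_y (F (x, y))%:E)%E = (f x * intg (fun y => g y * k (x - y)))%:E.
  rewrite -intgZ; last first.
    apply: CcMr => // y; apply: continuous_comp; last exact: ck.1.
    by apply: continuousB => //; exact: cst_continuous.
  rewrite /intg /Rintegral fineK//; apply: integrable_fin_num => //.
  apply: Cc_integrable; apply: CcZ; apply: CcMr => // y.
  apply: continuous_comp; last exact: ck.1.
  by apply: continuousB => //; exact: cst_continuous.
have inner' y : (\int[mu]_x (F (x, y))%:E)%E = (g y * intg (fun x => f x * k (x - y)))%:E.
  have cfk : Cc (fun x => f x * k (x - y)).
    apply: CcMr => // x; apply: continuous_comp; last exact: ck.1.
    by apply: continuousB => //; exact: cst_continuous.
  rewrite -intgZ//  /intg /Rintegral fineK; last first.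
    by apply: integrable_fin_num => //; apply: Cc_integrable; exact: CcZ.
  by apply: eq_integral => x _; rewrite /F /= mulrCA.
under eq_integral do rewrite inner.
under [in X in _ = X]eq_integral do rewrite inner'.
by rewrite /intg /Rintegral => ->.
Qed.
End Cc.

(** * Directional derivatives and integration by parts *)

Lemma is_derive_eqW (R : realType) (V : normedModType R) (f : V -> R) x v (l m : R) :
  is_derive x v f l -> l = m -> is_derive x v f m.
Proof. by move=> ? <-. Qed.

Section directional_derivatives.
Variables (R : realType) (n : nat).
Implicit Types (f g u : 'rV[R]_n -> R) (x y v : 'rV[R]_n).

(** This reduces directional derivatives to the calculus of one variable. *)
Lemma is_derive_lineP f x v (s l : R) :
  is_derive (x + s *: v) v f l <-> is_derive s 1 (fun t : R => f (x + t *: v)) l.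
Proof.
have E : (fun h : R => h^-1 *: ((f \o shift (x + s *: v)) (h *: v) - f (x + s *: v))) =
   (fun h : R => h^-1 *: (((fun t : R => f (x + t *: v)) \o shift s) (h *: (1 : R^o)) - f (x + s *: v))).
  apply/funext => h /=; congr (_ *: (f _ - _)).
  by rewrite addrCA -scalerDl; congr (_ + (_ + _) *: _); rewrite /GRing.scale /= mulr1.
split=> -[df dl]; split.
- by rewrite /derivable -E.
- by rewrite -dl /derive -E.
- by rewrite /derivable E.
- by rewrite -dl /derive E.
Qed.

Lemma is_derive_line0P f x v (l : R) :
  is_derive x v f l <-> is_derive (0 : R) 1 (fun t : R => f (x + t *: v)) l.
Proof. by rewrite -is_derive_lineP scale0r addr0. Qed.

Lemma is_derive_comp_dir f (th : R -> R) x v (l m : R) :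
  is_derive x v f l -> is_derive (f x) 1 th m -> is_derive x v (th \o f) (m * l).
Proof.
move=> /is_derive_line0P df dth; apply/is_derive_line0P.
apply: (@is_derive1_comp _ th (fun t : R => f (x + t *: v))).
by rewrite scale0r addr0.
Qed.

Lemma is_derive_translate f x y v (l : R) :
  is_derive (x + y) v f l -> is_derive x v (fun z => f (z + y)) l.
Proof.
move=> /is_derive_line0P df; apply/is_derive_line0P.
rewrite (_ : (fun _ => _) = fun t : R => f (x + y + t *: v)) //.
by apply/funext => t; rewrite addrAC.
Qed.

Lemma MVT_line f (df : R -> R) x v (t : R) : 0 <= t ->
  (forall s, 0 <= s <= t -> is_derive (x + s *: v) v f (df s)) ->
  exists2 s, 0 <= s <= t & f (x + t *: v) - f x = df s * t.
Proof.
move=> t0 hdf.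
have hd (s : R) : 0 <= s <= t -> is_derive s 1 (fun t : R => f (x + t *: v)) (df s).
  by move=> st; apply/is_derive_lineP; exact: hdf.
have [|//|s] := @MVT_segment R (fun t : R => f (x + t *: v)) df 0 t t0.
- by move=> s; rewrite in_itv /= => /andP[? ?]; apply: hd; rewrite !ltW.
- apply: derivable_within_continuous => s; rewrite in_itv /= => st.
  by have [] := hd s st.
- by rewrite in_itv /= scale0r addr0 subr0 => st e; exists s.
Qed.

Lemma Cc_unif_continuous f : Cc f -> forall e : R, 0 < e -> exists2 d : R, 0 < d &
  forall x y, `|x - y| < d -> `|f x - f y| < e.
Proof.
move=> cf e e0; have [M [M0 fM _]] := CcP cf.
set K := closed_ball (0 : 'rV[R]_n) (M + 1).
have M1 : 0 < M + 1 by rewrite addr_gt0.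
have inK x : K x <-> `|x| <= M + 1.
  by rewrite /K closed_ballE// /closed_ball_ /= sub0r normrN.
have cK : compact K.
  apply: bounded_closed_compact; last exact: closed_ball_closed.
  exists (M + 1); split; first exact: num_real.
  by move=> B MB x /inK xM; apply: le_trans xM _; exact: ltW.
have [d d0 hd] := within_unif_continuous cK (continuous_subspaceT cf.1) e0.
exists (Num.min d 1); first by rewrite lt_min d0 ltr01.
move=> x y; rewrite lt_min => /andP[xyd xy1].
have [xM|xM] := leP `|x| (M + 1); have [yM|yM] := leP `|y| (M + 1).
- by apply: hd => //; exact/inK.
- have := ler_distD 0 x y; have := ler_normB x (x - y).
  rewrite opprB addrC subrK => h1 _; rewrite !fM ?subrr ?normr0//; lra.
- have := ler_normD (x - y) y; rewrite subrK => h1; rewrite !fM ?subrr ?normr0//; lra.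
- by rewrite !fM ?subrr ?normr0//; lra.
Qed.

(** Translation invariance makes the integral of a difference quotient vanish,
    and difference quotients converge uniformly to the derivative. *)
Lemma intg_derive f (df : 'rV[R]_n -> R) v : Cc f -> Cc df ->
  (forall x, is_derive x v f (df x)) -> intg df = 0.
Proof.
move=> cf cdf hdf.
have [M [M0 fM _]] := CcP cf; have [M' [M'0 dfM _]] := CcP cdf.
set L := M + M' + `|v|.
have L0 : 0 < L by rewrite /L ltr_pwDl// addr_gt0.
suff h (e : R) : 0 < e -> `|intg df| <= e * (2 * L) ^+ n.
  apply/eqP; rewrite -normr_eq0 eq_le normr_ge0 andbT; apply/ler_addgt0Pl => e e0.
  have L2 : 0 < (2 * L) ^+ n by rewrite exprn_gt0// mulr_gt0.
  have := h (e / (2 * L) ^+ n) (divr_gt0 e0 L2).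
  by rewrite divfK ?gt_eqF// addr0.
move=> e0; have [d d0 hd] := Cc_unif_continuous cdf e0.
pose t := Num.min 1 (d / (2 * (`|v| + 1))).
have v1 : 0 < `|v| + 1 by rewrite ltr_wpDl.
have t0 : 0 < t by rewrite lt_min ltr01 divr_gt0// mulr_gt0.
have t1 : t <= 1 by rewrite ge_min lexx.
have tv : t * `|v| < d.
  have : t * (`|v| + 1) <= d / 2.
    by rewrite -ler_pdivlMr// -mulrA -invfM ge_min lexx orbT.
  by have := mulr_ge0 (ltW t0) (normr_ge0 v); lra.
pose q x := t^-1 * (f (x + t *: v) - f x).
have cq : Cc q by apply: CcZ; apply: CcB => //; exact: Cc_shift.
have iq : intg q = 0.
  rewrite /q intgZ; last by apply: CcB => //; exact: Cc_shift.
  by rewrite intgB ?intg_shift ?subrr ?mulr0//; exact: Cc_shift.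
have -> : intg df = intg (fun x => df x - q x) by rewrite intgB// iq subr0.
apply: intg_norm_le => // [|x|x xL]; first exact: CcB.
  have [s /andP[s0 st]] := @MVT_line f (fun s => df (x + s *: v)) x v t (ltW t0)
    (fun s _ => hdf _).
  rewrite /q => ->; rewrite mulrCA mulVf ?gt_eqF// mulr1 ltW//; apply: hd.
  rewrite opprD addNKr normrN normrZ (ger0_norm s0).
  by apply: le_lt_trans tv; rewrite ler_wpM2r.
have tv' : `|t *: v| <= `|v| by rewrite normrZ (ger0_norm (ltW t0)) ler_piMl.
rewrite /q dfM ?fM ?subrr ?mulr0//; rewrite /L in xL.
all: have := normr_ge0 v; have := ler_normB (x + t *: v) (t *: v).
all: by rewrite addrK; lra.
Qed.

End directional_derivatives.

Section smooth_bump.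
Variable R : realType.
Implicit Types (t : R) (m : nat).

(** [flat_exp 0] is the standard smooth function that vanishes to infinite
    order at 0; the exponent makes the family stable under derivation. *)
Definition flat_exp m t : R := if 0 < t then t^-1 ^+ m * expR (- t^-1) else 0.

Lemma flat_exp_ge0 m t : 0 <= flat_exp m t.
Proof.
rewrite /flat_exp; case: ifPn => // t0.
by rewrite mulr_ge0 ?expR_ge0// exprn_ge0// invr_ge0 ltW.
Qed.

(** The exponential series; applied to [flat_exp m.+1 t = flat_exp m t / t], it
    yields the derivative at 0. *)
Lemma flat_exp_le m t : flat_exp m t <= (m.+1)`!%:R * `|t|.
Proof.
rewrite /flat_exp; case: ifPn => [t0|_]; last by rewrite mulr_ge0.
rewrite gtr0_norm// expRN -[t in leRHS]invrK ler_pdivrMr ?expR_gt0//.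
have s0 : 0 < t^-1 by rewrite invr_gt0.
move: (t^-1) s0 => s s0.
have := @expR_ge1Dxn R s m (ltW s0) => h.
have f0 : 0 < (m.+1)`!%:R :> R by rewrite ltr0n fact_gt0.
have : s ^+ m.+1 <= (m.+1)`!%:R * expR s.
  rewrite -ler_pdivrMl// mulrC; apply: le_trans h; by rewrite lerDr.
by rewrite mulrAC ler_pdivlMr// -exprSr.
Qed.

Lemma is_derive_flat_exp m t :
  is_derive t 1 (flat_exp m) (flat_exp m.+2 t - m%:R * flat_exp m.+1 t).
Proof.
have [t0|t0|->] := ltgtP t 0.
- apply: (@near_eq_is_derive _ _ _ (cst 0)).
    near=> s; rewrite /flat_exp ifF//; apply/negbTE; rewrite -leNgt ltW//.
    by near: s; exact: lt_nbhsl.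
  rewrite /flat_exp ifF; last by apply/negbTE; rewrite -leNgt ltW.
  by rewrite ifF ?mulr0 ?subrr; [exact: is_derive_cst|apply/negbTE; rewrite -leNgt ltW].
- apply: (@near_eq_is_derive _ _ _ (fun s : R => s^-1 ^+ m * expR (- s^-1))).
    near=> s; rewrite /flat_exp ifT//.
    by near: s; exact: lt_nbhsr.
  have dV : is_derive t 1 (fun s : R => s^-1) (- t^-1 ^+ 2).
    have := @is_deriveV R id t 1 1 _ (is_derive_id _ _).
    move=> /(_ (lt0r_neq0 t0)) h; apply: (is_derive_eqW h).
    by rewrite /GRing.scale /= mulr1 exprVn.
  have dE : is_derive t 1 (expR \o (fun s : R => - s^-1)) (expR (- t^-1) * - - t^-1 ^+ 2).
    by apply: is_derive1_comp.
  have dX : is_derive t 1 (fun s : R => s^-1 ^+ m) (m%:R * t^-1 ^+ m.-1 * - t^-1 ^+ 2).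
    have := @is_deriveX _ _ (fun s : R => s^-1) m t 1 _ dV.
    by rewrite exprfctE.
  have h := is_deriveM dX dE; apply: (is_derive_eqW h).
  rewrite /flat_exp t0 /GRing.scale /= opprK !mulrA.
  move: (expR (- t^-1)) (t^-1) => E s.
  by case: (m) => [|k] /=; rewrite !exprS; ring.
- rewrite /flat_exp ltxx mulr0 subr0.
  have h : h^-1 *: ((flat_exp m \o shift 0) (h *: (1 : R^o)) - flat_exp m 0) @[h --> 0^'] --> (0 : R).
    apply/cvgrPdist_lt => e e0; set K : R := (m.+2)`!%:R.
    have K0 : 0 < K by rewrite ltr0n fact_gt0.
    near=> h; rewrite /= sub0r normrN addr0 [in flat_exp m 0]/flat_exp ltxx subr0.
    rewrite /GRing.scale /= mulr1.
    have -> : h^-1 * flat_exp m h = flat_exp m.+1 h.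
      by rewrite /flat_exp; case: ifPn => _; rewrite ?mulr0// exprS mulrA.
    rewrite ger0_norm ?flat_exp_ge0//; apply: le_lt_trans (flat_exp_le _ _) _.
    rewrite mulrC -ltr_pdivlMr//; near: h; apply: dnbhs0_lt.
    by rewrite divr_gt0.
  split; first by apply/cvg_ex; exists 0.
  by rewrite /derive; apply/cvg_lim.
Unshelve. all: end_near. Qed.

Lemma continuous_flat_exp m : continuous (flat_exp m).
Proof.
move=> t; apply: differentiable_continuous; apply/derivable1_diffP.
by have [] := is_derive_flat_exp m t.
Qed.

Lemma flat_exp_gt0 m t : 0 < t -> 0 < flat_exp m t.
Proof. by move=> t0; rewrite /flat_exp t0 mulr_gt0 ?expR_gt0// exprn_gt0// invr_gt0. Qed.

Lemma flat_exp0 m t : t <= 0 -> flat_exp m t = 0.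
Proof. by move=> t0; rewrite /flat_exp ltNge t0. Qed.

End smooth_bump.

(** * Smooth bumps as test functions *)

Section Ck_theory.
Variables (R : realType) (N : nat).
Implicit Types (u v : 'rV[R]_N -> R) (x y : 'rV[R]_N).
Local Notation e_ i := (delta_mx 0 i : 'rV[R]_N).

Lemma partial_is_derive i u x : differentiable u x -> is_derive x (e_ i) u (partial i u x).
Proof. by move=> du; split => //; exact: diff_derivable. Qed.

Lemma Ck_continuous k u : Ck k u -> continuous u.
Proof. by case: k => [//|k] [du _] x; exact: differentiable_continuous. Qed.

Lemma Ck_cst k (c : R) : Ck k (cst c : 'rV[R]_N -> R).
Proof.
elim: k c => [|k IH] c; first by move=> x; exact: cst_continuous.
split=> [x|i]; first exact: differentiable_cst.
rewrite (_ : partial i _ = cst 0); first exact: IH.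
by apply/funext => x; rewrite /partial derive_cst.
Qed.

Lemma CkD k u v : Ck k u -> Ck k v -> Ck k (fun x => u x + v x).
Proof.
elim: k u v => [|k IH] u v.
  by move=> cu cv x; apply: continuousD; [exact: cu|exact: cv].
move=> [du pu] [dv pv]; split=> [x|i]; first exact: differentiableD.
rewrite (_ : partial i _ = fun x => partial i u x + partial i v x).
  exact: (IH _ _ (pu i) (pv i)).
apply/funext => x; apply: derive_val; apply: is_deriveD; exact: partial_is_derive.
Qed.

Lemma Ck_pred k u : Ck k.+1 u -> Ck k u.
Proof.
elim: k u => [|k IH] u [du pu]; first by move=> x; exact: differentiable_continuous.
by split=> // i; exact/IH/pu.
Qed.

Lemma CkM k u v : Ck k u -> Ck k v -> Ck k (fun x => u x * v x).
Proof.
elim: k u v => [|k IH] u v.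
  by move=> cu cv x; apply: continuousM; [exact: cu|exact: cv].
move=> cu cv; have [du pu] := cu; have [dv pv] := cv.
split=> [x|i]; first exact: differentiableM.
rewrite (_ : partial i _ = fun x => u x * partial i v x + v x * partial i u x).
  apply: CkD; first exact: (IH _ _ (Ck_pred cu) (pv i)).
  exact: (IH _ _ (Ck_pred cv) (pu i)).
apply/funext => x; apply: derive_val; apply: is_deriveM; exact: partial_is_derive.
Qed.

Lemma Ck_prod k (I : Type) (r : seq I) (F : I -> 'rV[R]_N -> R) :
  (forall i, Ck k (F i)) -> Ck k (fun x => \prod_(i <- r) F i x).
Proof.
move=> cF; elim: r => [|i r IH].
  rewrite (_ : (fun _ => _) = cst 1); first exact: Ck_cst.
  by apply/funext => x; rewrite big_nil.
rewrite (_ : (fun _ => _) = fun x => F i x * \prod_(j <- r) F j x); first exact: CkM.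
by apply/funext => x; rewrite big_cons.
Qed.

Lemma is_derive_coord i j x : is_derive x (e_ i) (fun y => y 0 j : R) ((i == j)%:R).
Proof.
apply/is_derive_line0P.
rewrite (_ : (fun _ => _) = fun t : R => x 0 j + t * (i == j)%:R).
  have h1 := @is_deriveM _ _ id (cst (i == j)%:R : R -> R) (0 : R) 1 _ _
    (is_derive_id _ _) (is_derive_cst _ _ _).
  have h2 := @is_deriveD _ _ _ (cst (x 0 j)) _ (0 : R) 1 _ _ (is_derive_cst _ _ _) h1.
  by apply: (is_derive_eqW h2); rewrite /GRing.scale /= mulr0 !add0r mulr1.
by apply/funext => t; rewrite !mxE eqxx /= eq_sym.
Qed.

Lemma Ck_flat_exp k m (c s : R) j : Ck k (fun x : 'rV[R]_N => flat_exp m (c + s * x 0 j)).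
Proof.
elim: k m => [|k IH] m.
  move=> x; apply: (@continuous_comp _ _ _ (fun x : 'rV[R]_N => c + s * x 0 j)).
    apply: continuousD; first exact: cst_continuous.
    by apply: continuousM; [exact: cst_continuous|exact: coord_continuous].
  exact: continuous_flat_exp.
split=> [x|i].
  apply: (@differentiable_comp _ _ _ _ (fun x : 'rV[R]_N => c + s * x 0 j)).
    apply: differentiableD; first exact: differentiable_cst.
    by apply: differentiableM; [exact: differentiable_cst|exact: differentiable_coord].
  by apply/derivable1_diffP; have [] := is_derive_flat_exp m (c + s * x 0 j).
rewrite (_ : partial i _ = fun x => (s * (i == j)%:R) * flat_exp m.+2 (c + s * x 0 j)
   + (- (m%:R * (s * (i == j)%:R))) * flat_exp m.+1 (c + s * x 0 j)).
  by apply: CkD; apply: CkM => //; exact: Ck_cst.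
apply/funext => x; apply: derive_val.
have h : is_derive x (e_ i) (fun x : 'rV[R]_N => c + s * x 0 j) (s * (i == j)%:R).
  have h1 := @is_deriveM _ _ (cst s) (fun x : 'rV[R]_N => x 0 j) x (e_ i) _ _ (is_derive_cst _ _ _) (is_derive_coord i j x).
  have h2 := @is_deriveD _ _ _ (cst c) _ x (e_ i) _ _ (is_derive_cst _ _ _) h1.
  by apply: (is_derive_eqW h2); rewrite scaler0 addr0 add0r.
apply: (is_derive_eqW (is_derive_comp_dir h (is_derive_flat_exp m (c + s * x 0 j)))).
by ring.
Qed.

(** Being a product over the coordinates, its smoothness reduces to that of
    [flat_exp], and its support is a ball of the sup norm. *)
Definition smooth_bump (d : R) y x : R :=
  \prod_(i < N) (flat_exp 0 ((d + y 0 i) + (-1) * x 0 i) * flat_exp 0 ((d - y 0 i) + 1 * x 0 i)).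

Lemma Ck_bump k d y : Ck k (smooth_bump d y).
Proof. by apply: Ck_prod => i; apply: CkM; exact: Ck_flat_exp. Qed.

Lemma bump_shift d y x : smooth_bump d y x = smooth_bump d 0 (x - y).
Proof.
by apply: eq_bigr => i _; rewrite !mxE; congr (flat_exp _ _ * flat_exp _ _); ring.
Qed.

Lemma bump_ge0 d y x : 0 <= smooth_bump d y x.
Proof. by apply: prodr_ge0 => i _; rewrite mulr_ge0// flat_exp_ge0. Qed.

Lemma bump_gt0 d : 0 < d -> 0 < smooth_bump d 0 0.
Proof.
move=> d0; apply: prodr_gt0 => i _; rewrite !mxE.
by rewrite mulr_gt0// flat_exp_gt0//; lra.
Qed.

Lemma bump_supp d y x : 0 < d -> d <= `|x - y| -> smooth_bump d y x = 0.
Proof.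
move=> d0; apply: contraTeq => bx; rewrite -ltNge; apply: norm_lt_coord => // i.
rewrite ltNge; apply: contra bx => xi.
apply/eqP; rewrite /smooth_bump (bigD1 i)//=; move: xi; rewrite !mxE => xi.
have [xy|xy] := leP 0 (x 0 i - y 0 i).
  rewrite ger0_norm// in xi; rewrite (@flat_exp0 _ 0 (d + _ + _)) ?mul0r//; lra.
rewrite ltr0_norm// in xi; rewrite (@flat_exp0 _ 0 (d - _ + _)) ?mulr0 ?mul0r//; lra.
Qed.

Lemma Cc_bump d y : 0 < d -> Cc (smooth_bump d y).
Proof.
move=> d0; split; first exact: (Ck_continuous (Ck_bump 0 d y)).
exists (d + `|y|) => x xd; apply: bump_supp => //.
by have := lerB_dist x y; lra.
Qed.

Lemma test_fun_bump (Om : set 'rV[R]_N) d y : 0 < d ->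
  (forall x, `|x - y| <= d -> Om x) -> test_fun Om (smooth_bump d y).
Proof.
move=> d0 yd; split; first by move=> k; exact: Ck_bump.
have inK x : closed_ball y d x <-> `|x - y| <= d.
  by rewrite closed_ballE// /closed_ball_ /= distrC.
exists (closed_ball y d); split.
- apply: bounded_closed_compact; last exact: closed_ball_closed.
  exists (d + `|y|); split; first exact: num_real.
  move=> B MB x /inK xM; apply: le_trans (ltW MB).
  by have := lerB_dist x y; lra.
- by move=> x /inK; exact: yd.
- move=> x xK; apply: bump_supp => //; rewrite leNgt; apply/negP => xd.
  by apply: xK; apply/inK; exact: ltW.
Qed.

Lemma partial_bump_shift i d y x : partial i (smooth_bump d y) x = partial i (smooth_bump d 0) (x - y).
Proof.
apply: derive_val; rewrite (_ : smooth_bump d y = fun z => smooth_bump d 0 (z - y)).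
  have [du _] := Ck_bump 1 d 0.
  exact: (is_derive_translate (partial_is_derive i (du (x - y)))).
by apply/funext => z; exact: bump_shift.
Qed.

Lemma partial_supp i u (M : R) x : (forall x, M < `|x| -> u x = 0) -> M < `|x| ->
  partial i u x = 0.
Proof.
move=> uM xM; apply: derive_val.
apply: (@near_eq_is_derive _ _ _ (cst 0)).
apply/nbhs_ballP; exists (`|x| - M); first by rewrite /= subr_gt0.
move=> y; rewrite -ball_normE /= => xy; rewrite uM//.
by have := lerB_dist x y; lra.
Qed.

Lemma Cc_partial_bump i d y : 0 < d -> Cc (partial i (smooth_bump d y)).
Proof.
move=> d0; split; first by have [_ /(_ i)] := Ck_bump 1 d y.
have [_ [M hM]] := Cc_bump y d0.
by exists M => x; exact: partial_supp.
Qed.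

End Ck_theory.

(** * From smooth bumps to continuously differentiable test functions *)

Section mollification.
Variables (R : realType) (N : nat).
Implicit Types (f g k : 'rV[R]_N -> R) (x y : 'rV[R]_N).
Local Notation e_ i := (delta_mx 0 i : 'rV[R]_N).

Lemma le_intg_norm f g : Cc f -> Cc g -> (forall x, `|f x| <= g x) -> `|intg f| <= intg g.
Proof.
move=> cf cg fg; rewrite ler_norml; apply/andP; split.
  rewrite lerNl -mulN1r -intgZ//; apply: le_intg => //; first exact: CcZ.
  by move=> x; rewrite mulN1r; have := fg x; rewrite ler_norml; lra.
by apply: le_intg => // x; have := fg x; rewrite ler_norml; lra.
Qed.

Lemma Cc_norm f : Cc f -> Cc (fun x => `|f x|).
Proof.
move=> [cf [M fM]]; split; last by exists M => x /fM ->; rewrite normr0.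
by move=> x; apply: continuous_comp; [exact: cf|exact: norm_continuous].
Qed.

Lemma Cc_reflect k x : Cc k -> Cc (fun y => k (x - y)).
Proof.
move=> ck; have [M [M0 kM _]] := CcP ck; split.
  move=> y; apply: continuous_comp; last exact: ck.1.
  by apply: continuousB => //; exact: cst_continuous.
exists (M + `|x|) => y yM; apply: kM.
by have := lerB_dist y x; rewrite distrC; lra.
Qed.

Lemma Cc_convolution g k : Cc g -> Cc k -> Cc (fun x => intg (fun y => g y * k (x - y))).
Proof.
move=> cg ck.
have [Mg [Mg0 gM [Bg Bg0 gB]]] := CcP cg.
have [Mk [Mk0 kM _]] := CcP ck.
have cgk x : Cc (fun y => g y * k (x - y)) by apply: CcMr => //; have [] := Cc_reflect x ck.
split.
  move=> x; apply/continuousP_eps => e e0.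
  set L := Bg * (2 * Mg) ^+ N.
  have L0 : 0 < L by rewrite /L mulr_gt0// exprn_gt0// mulr_gt0.
  have [d d0 hd] := Cc_unif_continuous ck (divr_gt0 e0 (addr_gt0 L0 L0)).
  exists d => // x' xx'; rewrite -intgB//.
  apply: (@le_lt_trans _ _ ((Bg * (e / (L + L))) * (2 * Mg) ^+ N)).
    apply: intg_norm_le => //; first exact: CcB.
      move=> y; rewrite -mulrBr normrM ler_pM//; rewrite ltW//; apply: hd.
      by rewrite opprB addrA subrK.
    by move=> y yM; rewrite gM// !mul0r subrr.
  rewrite mulrAC -/L; have -> : L * (e / (L + L)) = e / 2.
    by field; rewrite gt_eqF//; lra.
  lra.
exists (Mg + Mk) => x xM; rewrite -[RHS](@intg0 R N); congr intg; apply/funext => y.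
have [yM|yM] := leP Mg `|y|; first by rewrite gM// mul0r.
by rewrite [k _]kM ?mulr0//; have := lerB_dist x y; lra.
Qed.

Lemma Cc_opp k : Cc k -> Cc (fun y => k (- y)).
Proof.
move=> ck; rewrite (_ : (fun _ => _) = fun y => k (0 - y)); first exact: Cc_reflect.
by apply/funext => y; rewrite sub0r.
Qed.

Lemma Cc_correlation g k : Cc g -> Cc k -> Cc (fun y => intg (fun x => g x * k (x - y))).
Proof.
move=> cg ck.
rewrite (_ : (fun _ => _) = fun y => intg (fun x => g x * k (- (y - x)))).
  exact: (Cc_convolution cg (Cc_opp ck)).
by apply/funext => y; congr intg; apply/funext => x; rewrite opprB.
Qed.

Lemma Cc_mul f g : Cc f -> Cc g -> Cc (fun x => f x * g x).
Proof. by move=> cf [cg _]; exact: CcMr. Qed.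

Lemma is_derive_reflect k x y v (l : R) :
  is_derive (x - y) v k l -> is_derive y v (fun z => k (x - z)) (- l).
Proof.
move=> /is_derive_line0P h; apply/is_derive_line0P.
have hN : is_derive (0 : R) 1 (fun t : R => - t) (-1) by exact: is_deriveN.
have h' : is_derive (- (0 : R)) 1 (fun t : R => k (x - y + t *: v)) l by rewrite oppr0.
have := is_derive1_comp h' hN; rewrite mulrN1.
rewrite (_ : _ \o _ = fun t : R => k (x - (y + t *: v)))//.
by apply/funext => t /=; rewrite scaleNr opprD addrA.
Qed.

(** Averaging the identity for the translate of [k] at [y] against [phi y],
    exchanging the integrals and integrating by parts in [y]. *)
Lemma convolution_identity (W : 'I_N -> 'rV[R]_N -> R) (H : 'rV[R]_N -> R)
  (phi : 'rV[R]_N -> R) (dphi : 'I_N -> 'rV[R]_N -> R) k (dk : 'I_N -> 'rV[R]_N -> R) :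
  (forall i, Cc (W i)) -> Cc H -> Cc phi -> (forall i, Cc (dphi i)) ->
  (forall i x, is_derive x (e_ i) phi (dphi i x)) ->
  Cc k -> (forall i, Cc (dk i)) -> (forall i x, is_derive x (e_ i) k (dk i x)) ->
  (forall y, phi y != 0 ->
    intg (fun x => \sum_i W i x * dk i (x - y)) = intg (fun x => H x * k (x - y))) ->
  \sum_i intg (fun x => W i x * intg (fun y => dphi i y * k (x - y))) =
  intg (fun x => H x * intg (fun y => phi y * k (x - y))).
Proof.
move=> cW cH cphi cdphi hdphi ck cdk hdk weak.
have ibp i x : intg (fun y => dphi i y * k (x - y)) = intg (fun y => phi y * dk i (x - y)).
  apply/eqP; rewrite -subr_eq0 -intgB; first last.
  - exact: Cc_mul (Cc_reflect _ _).
  - exact: Cc_mul (Cc_reflect _ _).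
  apply/eqP; apply: (@intg_derive _ _ (fun y => phi y * k (x - y)) _ (e_ i)).
  - exact: Cc_mul (Cc_reflect _ _).
  - by apply: CcB; exact: Cc_mul (Cc_reflect _ _).
  move=> y; apply: (is_derive_eqW (is_deriveM (hdphi i y) (is_derive_reflect (hdk i (x - y))))).
  by rewrite /GRing.scale /= mulrN addrC; congr (_ - _); rewrite mulrC.
transitivity (\sum_i intg (fun y => phi y * intg (fun x => W i x * dk i (x - y)))).
  apply: eq_bigr => i _; rewrite -(intg_fubini (cW i) cphi (cdk i)).
  by congr intg; apply/funext => x; rewrite ibp.
rewrite -intg_sum; last by move=> i; apply: Cc_mul => //; exact: Cc_correlation.
rewrite (intg_fubini cH cphi ck).
congr intg; apply/funext => y; rewrite -mulr_sumr.
have [->|phiy] := eqVneq (phi y) 0; first by rewrite !mul0r.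
rewrite -(weak y phiy) intg_sum// => i; exact: Cc_mul (Cc_shift (- y) (cdk i)).
Qed.

(** [J] is the integral of [k], which is not normalized; since [k] lives at
    distance less than [d], only the oscillation of [g] at that scale enters. *)
Lemma convolution_close g k (d e J : R) x : Cc g -> Cc k -> (forall z, 0 <= k z) ->
  (forall z, d <= `|z| -> k z = 0) -> (forall x, intg (fun y => k (x - y)) = J) ->
  (forall x y, `|x - y| < d -> `|g x - g y| < e) ->
  `|J * g x - intg (fun y => g y * k (x - y))| <= J * e.
Proof.
move=> cg ck k0 kd kJ hg.
have cr : Cc (fun y => k (x - y)) by exact: Cc_reflect.
have cgr : Cc (fun y => g y * k (x - y)) by exact: Cc_mul.
rewrite -[in J * g x](kJ x) mulrC -intgZ// -intgB//; last exact: CcZ.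
rewrite mulrC -(kJ x) -intgZ//; apply: le_intg_norm; [|exact: CcZ|].
  by apply: CcB => //; exact: CcZ.
move=> y; rewrite -mulrBl normrM (ger0_norm (k0 _)).
have [xy|xy] := ltP `|x - y| d; first by rewrite ler_wpM2r// ltW ?hg.
by rewrite kd// !mulr0.
Qed.

Lemma convolution_error f g k (d e J : R) : Cc f -> Cc g -> Cc k -> (forall z, 0 <= k z) ->
  (forall z, d <= `|z| -> k z = 0) -> (forall x, intg (fun y => k (x - y)) = J) ->
  (forall x y, `|x - y| < d -> `|g x - g y| < e) ->
  `|J * intg (fun x => f x * g x) - intg (fun x => f x * intg (fun y => g y * k (x - y)))| <=
  J * (e * intg (fun x => `|f x|)).
Proof.
move=> cf cg ck k0 kd kJ hg.
have cfg := Cc_mul cf cg; have cc := Cc_mul cf (Cc_convolution cg ck).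
rewrite -intgZ// -intgB//; last exact: CcZ.
rewrite mulrA -intgZ; last exact: Cc_norm.
apply: le_intg_norm; [by apply: CcB => //; exact: CcZ|by apply: CcZ; exact: Cc_norm|].
move=> x; rewrite mulrCA -mulrBr normrM mulrC ler_wpM2r//.
exact: convolution_close hg.
Qed.

Lemma intg_reflect_gt0 k : Cc k -> (forall z, 0 <= k z) -> 0 < k 0 -> 0 < intg (fun y => k (- y)).
Proof.
move=> ck k0 k00; have ckN := Cc_opp ck.
have /continuousP_eps := ckN.1 0.
move=> /(_ _ (divr_gt0 k00 (ltr0Sn _ 1)))[s s0 hs].
apply: (@lt_le_trans _ _ (k 0 / 2 * (2 * s) ^+ N)).
  by rewrite mulr_gt0 ?divr_gt0// exprn_gt0// mulr_gt0.
apply: (@le_intg_ball _ _ _ 0) => // y ys.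
have := hs y ys; rewrite oppr0 ltr_norml; lra.
Qed.

(** If the identity [\int W . grad rho = \int H rho] holds for all small smooth
    bumps centred in the support of [phi], it holds for [phi] itself: average
    the identity for the bump at [y] against [phi y], exchange the integrals, and
    let the width of the bump tend to 0. *)
Lemma mollify (W : 'I_N -> 'rV[R]_N -> R) (H : 'rV[R]_N -> R)
  (phi : 'rV[R]_N -> R) (dphi : 'I_N -> 'rV[R]_N -> R) (d0 : R) :
  (forall i, Cc (W i)) -> Cc H -> Cc phi -> (forall i, Cc (dphi i)) ->
  (forall i x, is_derive x (e_ i) phi (dphi i x)) -> 0 < d0 ->
  (forall y d, phi y != 0 -> 0 < d -> d < d0 ->
    intg (fun x => \sum_i W i x * partial i (smooth_bump d y) x) =
    intg (fun x => H x * smooth_bump d y x)) ->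
  intg (fun x => \sum_i W i x * dphi i x) = intg (fun x => H x * phi x).
Proof.
move=> cW cH cphi cdphi hdphi d00 weak.
have cc f g : Cc f -> Cc g -> Cc (fun x => f x * g x).
  by move=> cf cg; apply: CcMr => //; case: cg.
pose C := \sum_i intg (fun x => `|W i x|) + intg (fun x => `|H x|).
have C0 : 0 <= C.
  by apply: addr_ge0; [apply: sumr_ge0 => i _|]; exact: intg_ge0.
suff h (e : R) : 0 < e ->
    `|intg (fun x => \sum_i W i x * dphi i x) - intg (fun x => H x * phi x)| <= e * C.
  apply/eqP; rewrite -subr_eq0 -normr_eq0 eq_le normr_ge0 andbT.
  apply/ler_addgt0Pl => e e0; rewrite addr0.
  have C1 : 0 < C + 1 by rewrite ltr_wpDl.
  have := h (e / (C + 1)) (divr_gt0 e0 C1) => /le_trans; apply.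
  by rewrite -mulrA ler_piMr ?(ltW e0)// ler_pdivrMl// mulr1 lerDl.
move=> e0.
have [d [dpos dd0 hd hdi]] : exists d : R, [/\ 0 < d, d < d0,
    forall x y, `|x - y| < d -> `|phi x - phi y| < e &
    forall i x y, `|x - y| < d -> `|dphi i x - dphi i y| < e].
  have [d1 d1pos h1] := Cc_unif_continuous cphi e0.
  have /choice[D hD] (i : 'I_N) : exists d : R, 0 < d /\
      forall x y, `|x - y| < d -> `|dphi i x - dphi i y| < e.
    by have [d dp hd] := Cc_unif_continuous (cdphi i) e0; exists d.
  pose d2 := \big[Num.min/Num.min d1 (d0 / 2)]_i D i.
  have d2D i : d2 <= D i by exact: bigmin_le.
  have d2b : d2 <= Num.min d1 (d0 / 2) by exact: bigmin_le_id.
  exists d2; split.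
  - by apply/bigmin_gtP; split => [|i _]; [rewrite lt_min d1pos divr_gt0|case: (hD i)].
  - by apply: le_lt_trans d2b _; rewrite gt_min; apply/orP; right; lra.
  - by move=> x y xy; apply: h1; apply: lt_le_trans xy _; apply: le_trans d2b _; rewrite ge_min lexx.
  - by move=> i x y xy; case: (hD i) => _; apply; exact: lt_le_trans xy (d2D i).
have [dr _] := Ck_bump 1 d (0 : 'rV[R]_N).
have crho : Cc (smooth_bump d (0 : 'rV[R]_N)) by exact: Cc_bump.
have cdrho i : Cc (partial i (smooth_bump d (0 : 'rV[R]_N))) by exact: Cc_partial_bump.
have hdrho i x : is_derive x (e_ i) (smooth_bump d (0 : 'rV[R]_N)) (partial i (smooth_bump d 0) x).
  exact: partial_is_derive.
have weak' y : phi y != 0 -> intg (fun x => \sum_i W i x * partial i (smooth_bump d 0) (x - y)) =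
    intg (fun x => H x * smooth_bump d 0 (x - y)).
  move=> phiy; have := weak y d phiy dpos dd0.
  under eq_fun do under eq_bigr do rewrite partial_bump_shift.
  by move=> ->; congr intg; apply/funext => x; rewrite bump_shift.
have rho0 (z : 'rV[R]_N) : 0 <= smooth_bump d 0 z by exact: bump_ge0.
have rhod (z : 'rV[R]_N) : d <= `|z| -> smooth_bump d 0 z = 0.
  by move=> zd; apply: bump_supp; rewrite ?subr0.
have rho00 : 0 < smooth_bump d 0 (0 : 'rV[R]_N) by exact: bump_gt0.
move: (smooth_bump d 0) crho cdrho hdrho weak' rho0 rhod rho00 => rho.
move=> crho cdrho hdrho weak' rho0 rhod rho00.
have key := convolution_identity cW cH cphi cdphi hdphi crho cdrho hdrho weak'.
pose J := intg (fun y => rho (- y)).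
have J0 : 0 < J by exact: intg_reflect_gt0.
have Jx x : intg (fun y => rho (x - y)) = J.
  rewrite /J -(intg_shift (- x) (Cc_opp crho)); congr intg; apply/funext => y.
  by rewrite opprB.
have est f g cf cg := @convolution_error f g rho d e J cf cg crho rho0 rhod Jx.
rewrite -(ler_pM2l J0) -{1}(gtr0_norm J0) -normrM mulrBr intg_sum; last first.
  by move=> i; exact: Cc_mul.
have -> : J * (\sum_i intg (fun x => W i x * dphi i x)) - J * intg (fun x => H x * phi x) =
   \sum_i (J * intg (fun x => W i x * dphi i x) -
           intg (fun x => W i x * intg (fun y => dphi i y * rho (x - y)))) -
   (J * intg (fun x => H x * phi x) - intg (fun x => H x * intg (fun y => phi y * rho (x - y)))).
  by rewrite sumrB key mulr_sumr; ring.
rewrite /C !mulrDr; apply: le_trans (ler_normB _ _) _; apply: lerD; last exact: est.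
apply: le_trans (ler_norm_sum _ _ _) _; rewrite !mulr_sumr; apply: ler_sum => i _.
by apply: est => // x y; exact: hdi.
Qed.

End mollification.

(** * The vector field of the s-Laplacian *)

Section power_field.
Variables (R : realType) (N : nat).
Implicit Types (x y v w : 'rV[R]_N) (s t r : R).

(** The factor is junk at [v = 0] when [s < 2], but the product is 0 there, which
    makes the field continuous for every [s > 1]. *)
Definition pfield s v : 'rV[R]_N := enorm v `^ (s - 2) *: v.

Lemma mulr_powRB2 s t : 1 < s -> 0 <= t -> t `^ (s - 2) * t = t `^ (s - 1).
Proof.
move=> s1 t0; rewrite mulrC -[RHS]mulr_powRB1//; last by rewrite subr_gt0.
by congr (_ * _ `^ _); ring.
Qed.

Lemma enorm_pfield s v : 1 < s -> enorm (pfield s v) = enorm v `^ (s - 1).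
Proof. by move=> s1; rewrite enormZ ger0_norm ?powR_ge0// mulr_powRB2// enorm_ge0. Qed.

Lemma sqr_enormB x y : enorm (x - y) ^+ 2 =
  (enorm x - enorm y) ^+ 2 + 2 * (enorm x * enorm y - dotv x y).
Proof.
rewrite sqrrB !sqr_enorm !(dotvBl, dotvBr) (dotvC y x); ring.
Qed.

(** Splitting into a radial and an angular part; both are nonnegative. *)
Lemma dotv_pfieldB s x y : 1 < s ->
  dotv (pfield s x - pfield s y) (x - y) =
  (enorm x `^ (s - 1) - enorm y `^ (s - 1)) * (enorm x - enorm y) +
  (enorm x `^ (s - 2) + enorm y `^ (s - 2)) * (enorm x * enorm y - dotv x y).
Proof.
move=> s1; rewrite -!mulr_powRB2 ?enorm_ge0// !(dotvBl, dotvBr, dotvZl) (dotvC y x).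
rewrite -!sqr_enorm; ring.
Qed.

Lemma pfield_monotone s x y : 1 < s -> 0 <= dotv (pfield s x - pfield s y) (x - y).
Proof.
move=> s1; rewrite dotv_pfieldB// addr_ge0//; last first.
  by apply: mulr_ge0; [rewrite addr_ge0 ?powR_ge0|rewrite subr_ge0 dotv_le].
have s0 : 0 <= s - 1 by lra.
have [xy|/ltW xy] := leP (enorm y) (enorm x).
  by rewrite mulr_ge0 ?subr_ge0//; apply: ge0_ler_powR; rewrite ?nnegrE ?enorm_ge0.
by rewrite mulr_le0 ?subr_le0//; apply: ge0_ler_powR; rewrite ?nnegrE ?enorm_ge0.
Qed.

(** The mean value theorem for the derivative [(s - 1) t `^ (s - 2)]. *)
Lemma powRB_ge s (l a b : R) : 1 < s -> 0 < a -> a <= b ->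
  (forall t, a <= t <= b -> l <= t `^ (s - 2)) ->
  (s - 1) * l * (b - a) ^+ 2 <= (b `^ (s - 1) - a `^ (s - 1)) * (b - a).
Proof.
move=> s1 a0 ab hl.
have d t : 0 < t -> is_derive t 1 (fun t => t `^ (s - 1)) ((s - 1) * t `^ (s - 2)).
  move=> t0; apply: (is_derive_eqW (is_derive1_powR (s - 1) t0)).
  by congr (_ * _ `^ _); ring.
have [|//|t] := @MVT_segment R (fun t => t `^ (s - 1)) (fun t => (s - 1) * t `^ (s - 2)) a b ab.
- by move=> t; rewrite in_itv /= => /andP[? ?]; apply: d; lra.
- apply: derivable_within_continuous => t; rewrite in_itv /= => /andP[? ?].
  by have [] : is_derive t 1 (fun t => t `^ (s - 1)) ((s - 1) * t `^ (s - 2)) by apply: d; lra.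
rewrite in_itv /= => /hl lt ->; rewrite expr2 mulrA -[leRHS]mulrA -[leRHS]mulrA.
rewrite -!mulrA ler_wpM2l ?ler_wpM2r//; first lra.
by rewrite mulr_ge0 // subr_ge0.
Qed.

Lemma pfield_strongly_monotone s (l : R) x y : 1 < s -> 0 <= l ->
  0 < enorm x -> 0 < enorm y ->
  (forall t, Num.min (enorm x) (enorm y) <= t <= Num.max (enorm x) (enorm y) -> l <= t `^ (s - 2)) ->
  Num.min 1 (s - 1) * l * enorm (x - y) ^+ 2 <= dotv (pfield s x - pfield s y) (x - y).
Proof.
move=> s1 l0 x0 y0 hl; rewrite dotv_pfieldB// sqr_enormB.
have m1 : Num.min 1 (s - 1) <= 1 by rewrite ge_min lexx.
have ms : Num.min 1 (s - 1) <= s - 1 by rewrite ge_min lexx orbT.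
have m0 : 0 <= Num.min 1 (s - 1) by rewrite le_min ler01 subr_ge0 ltW.
rewrite mulrDr; apply: lerD.
  apply: (@le_trans _ _ ((s - 1) * l * (enorm x - enorm y) ^+ 2)).
    by rewrite ler_wpM2r ?sqr_ge0// ler_wpM2r.
  have [xy|/ltW xy] := leP (enorm y) (enorm x).
    by apply: powRB_ge => // t; move: hl; rewrite min_r// max_l//; apply.
  rewrite -[(_ - _) ^+ 2]sqrrN opprB -[leRHS]mulrNN !opprB.
  by apply: powRB_ge => // t; move: hl; rewrite min_l// max_r//; apply.
rewrite mulrA ler_wpM2r ?subr_ge0 ?dotv_le//.
have lx : l <= enorm x `^ (s - 2) by apply: hl; rewrite ge_min le_max lexx.
have ly : l <= enorm y `^ (s - 2) by apply: hl; rewrite ge_min le_max lexx !orbT.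
apply: (@le_trans _ _ (1 * l * 2)); last lra.
by rewrite ler_wpM2r// ler_wpM2r.
Qed.

(** The least factor by which [t `^ (s - 2)] changes when [t] changes by a factor
    of at most 2; the sign of [s - 2] decides which of the two is the minimum. *)
Definition pfield_const s : R := Num.min (2^-1 `^ (s - 2)) (2 `^ (s - 2)).

Lemma pfield_const_gt0 s : 0 < pfield_const s.
Proof. by rewrite lt_min !powR_gt0// invr_gt0. Qed.

Lemma powR_comparable s r t : 0 < r -> r / 2 <= t <= 2 * r ->
  pfield_const s * r `^ (s - 2) <= t `^ (s - 2).
Proof.
move=> r0 /andP[t1 t2]; have t0 : 0 < t by lra.
have -> : t = (t / r) * r by rewrite divfK// gt_eqF.
have h0 : 0 < t / r by rewrite divr_gt0.
rewrite powRM// ?(ltW h0)// ?(ltW r0)// ler_wpM2r ?powR_ge0//.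
have h1 : 2^-1 <= t / r by rewrite ler_pdivlMr//; lra.
have h2 : t / r <= 2 by rewrite ler_pdivrMr//; lra.
rewrite /pfield_const ge_min; have [s2|s2] := leP 2 s.
  by apply/orP; left; apply: ge0_ler_powR; rewrite ?nnegrE//; lra.
apply/orP; right; rewrite -[s - 2]opprB !powRN lef_pV2 ?posrE ?powR_gt0//.
by apply: ge0_ler_powR; rewrite ?nnegrE//; lra.
Qed.

(** As [x] and [y] have comparable lengths, so have all the weights
    [t `^ (s - 2)] for [t] between these lengths. *)
Lemma pfield_coercive s x y : 1 < s -> 0 < enorm y -> enorm (x - y) <= enorm y / 2 ->
  Num.min 1 (s - 1) * pfield_const s * enorm y `^ (s - 2) * enorm (x - y) ^+ 2 <=
  dotv (pfield s x - pfield s y) (x - y).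
Proof.
move=> s1 y0 xy.
have h1 : enorm x <= enorm (x - y) + enorm y by have := ler_enormD (x - y) y; rewrite subrK.
have h2 : enorm y <= enorm (x - y) + enorm x.
  by have := ler_enormB x (x - y); rewrite opprB addrC subrK addrC.
rewrite -[_ * _ * enorm y `^ _]mulrA; apply: pfield_strongly_monotone => //.
- by rewrite mulr_ge0 ?powR_ge0// ltW ?pfield_const_gt0.
- lra.
move=> t /andP[]; rewrite ge_min le_max => /orP t1 /orP t2.
by apply: powR_comparable => //; apply/andP; split; [case: t1|case: t2]; lra.
Qed.

Lemma continuous_enorm : continuous (@enorm R N).
Proof.
move=> x; apply/continuousP_eps => e e0.
have N1 : 0 < N%:R + 1 :> R by rewrite ltr_wpDl.
exists (e / (N%:R + 1)) => [|y]; first exact: divr_gt0.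
rewrite ltr_pdivlMr// => xy; apply: le_lt_trans (enorm_dist x y) _.
by apply: le_lt_trans xy; rewrite mulrC ler_wpM2l// lerDl.
Qed.

Lemma continuous_pfield s i : 1 < s -> continuous (fun v => pfield s v 0 i).
Proof.
move=> s1 v; have [v0|v0] := eqVneq v 0.
  apply/continuousP_eps => e e0.
  have N1 : 0 < N%:R + 1 :> R by rewrite ltr_wpDl.
  have d0 : 0 < e `^ (s - 1)^-1 by rewrite powR_gt0.
  exists (e `^ (s - 1)^-1 / (N%:R + 1)) => [|w]; first exact: divr_gt0.
  rewrite ltr_pdivlMr// v0 [pfield s 0]scaler0 mxE !sub0r !normrN => wd.
  apply: le_lt_trans (le_coord_norm _ _) _; apply: le_lt_trans (norm_le_enorm _) _.
  rewrite enorm_pfield//; have -> : e = (e `^ (s - 1)^-1) `^ (s - 1).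
    by rewrite -powRrM mulVf ?powRr1 ?(ltW e0)// gt_eqF// subr_gt0.
  apply: gt0_ltr_powR; rewrite ?nnegrE ?enorm_ge0 ?powR_ge0 ?subr_gt0//.
  apply: le_lt_trans (enorm_le_norm w) _; apply: le_lt_trans wd.
  by rewrite mulrC ler_wpM2l// lerDl.
rewrite (_ : (fun _ => _) = fun v => enorm v `^ (s - 2) * v 0 i); last first.
  by apply/funext => w; rewrite mxE.
apply: (@continuousM _ _ (fun v : 'rV[R]_N => enorm v `^ (s - 2)) (fun v => v 0 i));
  last exact: coord_continuous.
apply: continuous_powR_at; first by rewrite enorm_gt0.
exact: continuous_enorm.
Qed.

End power_field.

(** * Directions that few gradients are nearly orthogonal to *)

Section directions.
Variables (R : realType) (N : nat).
Implicit Types (x v xi : 'rV[R]_N) (c t : R).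

(** A continuous substitute for the indicator of a neighbourhood of 0, so that the
    averages below are integrals of continuous functions. *)
Definition tent t : R := Num.max 0 (Num.min 1 (4 - `|t|)).

Lemma tent_ge0 t : 0 <= tent t.
Proof. by rewrite le_max lexx. Qed.

Lemma tent_le1 t : tent t <= 1.
Proof. by rewrite ge_max ler01 ge_min lexx. Qed.

Lemma tent_eq1 t : `|t| <= 3 -> tent t = 1.
Proof.
move=> t3; have h : 1 <= 4 - `|t| by lra.
by rewrite /tent (min_l h) max_r.
Qed.

Lemma tent_eq0 t : 4 <= `|t| -> tent t = 0.
Proof.
move=> t4; have h : 4 - `|t| <= 0 by lra.
by rewrite /tent max_l// ge_min h orbT.
Qed.

Lemma continuous_tent : continuous tent.
Proof.
move=> t; apply: (@continuous_max _ _ (cst 0) (fun t => Num.min 1 (4 - `|t|))).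
  exact: cst_continuous.
apply: (@continuous_min _ _ (cst 1) (fun t => 4 - `|t|)); first exact: cst_continuous.
by apply: continuousB; [exact: cst_continuous|exact: norm_continuous].
Qed.

(** The points of an arithmetic progression of step [b] that lie in an interval
    of length [2 c] span at most that length. *)
Lemma count_progression (K : nat) (a b c : R) : b != 0 -> 0 < c ->
  \sum_(t < K) (`|a + b * t%:R| < c)%R%:R <= 2 * c / `|b| + 1.
Proof.
move=> b0 c0; have nb0 : 0 < `|b| by rewrite normr_gt0.
have rhs0 : 0 <= 2 * c / `|b| by rewrite divr_ge0// mulr_ge0// ltW.
pose A : {set 'I_K} := [set t : 'I_K | `|a + b * t%:R| < c]%SET.
have -> : \sum_(t < K) (`|a + b * t%:R| < c)%R%:R = #|A|%:R :> R.
  by rewrite -sum1_card natr_sum [in RHS]big_mkcond /=; apply: eq_bigr => t _; rewrite inE; case: ifP.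
have [->|[t1 t1A]] := set_0Vmem A; first by rewrite cards0; lra.
pose t0 := [arg min_(t < t1 in A) (t : nat)]%N.
pose tm := [arg max_(t > t1 in A) (t : nat)]%N.
have [t0A t0min] : t0 \in A /\ forall t : 'I_K, t \in A -> (t0 <= t)%N.
  by rewrite /t0; case: arg_minnP => // i iA hi.
have [tmA tmmax] : tm \in A /\ forall t : 'I_K, t \in A -> (t <= tm)%N.
  by rewrite /tm; case: arg_maxnP => // i iA hi.
have cardA : (#|A| <= tm - t0 + 1)%N.
  rewrite cardE -(size_map val) -(size_iota t0 (tm - t0 + 1)).
  apply: uniq_leq_size; first by rewrite map_inj_uniq ?enum_uniq//; exact: val_inj.
  move=> m /mapP[t]; rewrite mem_enum => tA ->; rewrite mem_iota.
  have h1 := t0min t tA; have h2 := tmmax t tA.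
  by rewrite addn1 addnS subnKC ?(leq_trans h1 h2)// ltnS h1 h2.
have t0m := t0min tm tmA.
have : `|b| * (tm%:R - t0%:R) <= 2 * c.
  have -> : `|b| * (tm%:R - t0%:R) = `|(a + b * tm%:R) - (a + b * t0%:R)|.
    rewrite (_ : a + _ - _ = b * (tm%:R - t0%:R)); last by ring.
    by rewrite normrM (@ger0_norm _ (_ - _)) // subr_ge0 ler_nat.
  apply: le_trans (ler_normB _ _) _; move: t0A tmA; rewrite !inE; lra.
rewrite mulrC -ler_pdivlMr// => h.
apply: (@le_trans _ _ (tm - t0 + 1)%:R); first by rewrite ler_nat.
by rewrite natrD natrB//; lra.
Qed.

Section grid.
Variable K : nat.
Hypothesis K0 : (0 < K)%N.
Implicit Type k : {ffun 'I_N -> 'I_K}.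

Definition upd k (j : 'I_N) (t : 'I_K) : {ffun 'I_N -> 'I_K} :=
  [ffun l => if l == j then t else k l].

(** Swapping the value of [k] at [j] with an independent one is an involution of
    the pairs, hence resampling one coordinate preserves sums. *)
Lemma sum_upd (f : {ffun 'I_N -> 'I_K} -> R) j :
  \sum_k \sum_(t < K) f (upd k j t) = K%:R * \sum_k f k.
Proof.
rewrite pair_big /=.
pose h (z : {ffun 'I_N -> 'I_K} * 'I_K) := (upd z.1 j z.2, z.1 j).
have hK : involutive h.
  move=> [k t]; rewrite /h /=; congr pair; last by rewrite ffunE eqxx.
  by apply/ffunP => l; rewrite !ffunE; case: eqP => [->|].
rewrite (reindex_inj (inv_inj hK)) /=.
rewrite (eq_bigr (fun z : {ffun 'I_N -> 'I_K} * 'I_K => f z.1)); last first.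
  move=> [k t] _ /=; congr f; apply/ffunP => l; rewrite !ffunE.
  by case: eqP => [->|].
rewrite -(pair_big xpredT xpredT (fun k (_ : 'I_K) => f k)) /= mulr_sumr.
by apply: eq_bigr => k _; rewrite sumr_const card_ord mulr_natl.
Qed.

(** Perturbations of the [i]-th basis vector by at most [1 / (4 N)] in each
    coordinate, small enough to keep [N] such vectors independent. *)
Definition grid_dir (i : 'I_N) k : 'rV[R]_N :=
  \row_l ((l == i)%:R + (k l)%:R / (4 * N%:R * K%:R)).

Lemma dotv_grid_dir_upd i k j (t : 'I_K) xi :
  dotv (grid_dir i (upd k j t)) xi =
  dotv (grid_dir i (upd k j (Ordinal K0))) xi + (xi 0 j / (4 * N%:R * K%:R)) * t%:R.
Proof.
rewrite /dotv (bigD1 j)//= [in RHS](bigD1 j)//= !mxE !ffunE eqxx /=.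
rewrite [in RHS](eq_bigr (fun l => grid_dir i (upd k j t) 0 l * xi 0 l)).
  by rewrite mul0r addr0; ring.
by move=> l lj; rewrite !mxE !ffunE (negbTE lj).
Qed.

(** Resample the coordinate [j] where [xi] is largest: the values of [dotv] then
    form a progression of step [|xi| / (4 N K)], so only a fraction of order
    [kappa / |xi|] of the directions is nearly orthogonal to [xi]. *)
Lemma grid_average (kappa L : R) i xi : 0 < kappa -> `|xi| <= L -> 1 <= kappa * K%:R ->
  \sum_k tent (dotv (grid_dir i k) xi / kappa) * `|xi| <=
  \sum_(k : {ffun 'I_N -> 'I_K}) ((32 * N%:R + L) * kappa).
Proof.
move=> k0 xiL kK; have K0' : 0 < K%:R :> R by rewrite ltr0n.
have [->|xi0] := eqVneq xi 0.
  rewrite big1 => [|k _]; last by rewrite normr0 mulr0.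
  apply: sumr_ge0 => k _; rewrite mulr_ge0 ?(ltW k0)// addr_ge0// ?mulr_ge0//.
  exact: le_trans xiL.
have [[z j] hj] : exists j, `|xi| = `|xi j.1 j.2|.
  by apply: mx_norm_neq0; change (`|xi| != 0); rewrite normr_eq0.
rewrite /= (ord1 z) in hj.
have M0 : 0 < `|xi| by rewrite normr_gt0.
have N0 : 0 < N%:R :> R by rewrite ltr0n; exact: leq_ltn_trans (ltn_ord j).
have D0 : 0 < 4 * N%:R * K%:R :> R by rewrite !mulr_gt0.
pose b := xi 0 j / (4 * N%:R * K%:R).
have nb : `|b| = `|xi| / (4 * N%:R * K%:R) by rewrite normrM normfV -hj (gtr0_norm D0).
have b0 : b != 0 by rewrite -normr_gt0 nb divr_gt0.
have fiber k : \sum_(t < K) tent (dotv (grid_dir i (upd k j t)) xi / kappa) <=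
    2 * (4 * kappa) / `|b| + 1.
  pose a := dotv (grid_dir i (upd k j (Ordinal K0))) xi.
  have k4 : 0 < 4 * kappa by rewrite mulr_gt0.
  apply: le_trans (count_progression K a b0 k4); apply: ler_sum => t _.
  rewrite dotv_grid_dir_upd -/a -/b; case: ltP => ab; first exact: tent_le1.
  rewrite tent_eq0// normrM normfV (gtr0_norm k0) ler_pdivlMr//.
rewrite -(ler_pM2l K0') -mulr_suml mulrA -(sum_upd _ j) mulr_suml [leRHS]mulr_sumr.
apply: ler_sum => k _.
apply: (@le_trans _ _ ((2 * (4 * kappa) / `|b| + 1) * `|xi|)).
  by rewrite ler_wpM2r.
rewrite nb mulrDl mul1r.
have -> : 2 * (4 * kappa) / (`|xi| / (4 * N%:R * K%:R)) * `|xi| = 32 * N%:R * K%:R * kappa.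
  by field; rewrite !gt_eqF.
apply: (@le_trans _ _ (32 * N%:R * K%:R * kappa + L * (kappa * K%:R))); last by lra.
rewrite lerD2l; apply: (le_trans xiL); rewrite ler_peMr//.
by apply: le_trans xiL.
Qed.

End grid.

(** For a fixed direction [v] the set where [v] is nearly orthogonal to [G] may be
    large. Averaging [grid_average] over the points and exchanging the two sums
    shows that a good direction exists near each basis vector. *)
Lemma good_direction (chi : 'rV[R]_N -> R) (G : 'rV[R]_N -> 'rV[R]_N) (kappa L : R) (i : 'I_N) :
  0 < kappa -> Cc chi -> (forall x, 0 <= chi x) -> (forall x, chi x != 0 -> `|G x| <= L) ->
  (forall v, Cc (fun x => chi x * (tent (dotv v (G x) / kappa) * `|G x|))) ->
  exists v, (forall l, 0 <= v 0 l - (l == i)%:R <= (4 * N%:R)^-1) /\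
    intg (fun x => chi x * (tent (dotv v (G x) / kappa) * `|G x|)) <=
    (32 * N%:R + L) * kappa * intg chi.
Proof.
move=> k0 cchi chi0 GL cv.
pose K := (Num.bound kappa^-1).+1.
have kK : 1 <= kappa * K%:R.
  rewrite mulrC -ler_pdivrMr// mul1r; apply: ltW.
  have := archi_boundP (_ : 0 <= kappa^-1); rewrite invr_ge0 (ltW k0) => /(_ isT) h.
  by apply: lt_le_trans h _; rewrite ler_nat leqnSn.
have K0 : (0 < K)%N by [].
have N0 : 0 < N%:R :> R by rewrite ltr0n; exact: leq_ltn_trans (ltn_ord i).
have Kr : 0 < K%:R :> R by rewrite ltr0n.
pose f (k : {ffun 'I_N -> 'I_K}) := intg (fun x => chi x * (tent (dotv (grid_dir i k) (G x) / kappa) * `|G x|)).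
have [[k hk]|hk] := pselect (exists k, f k <= (32 * N%:R + L) * kappa * intg chi).
  exists (grid_dir i k); split => // l; rewrite mxE addrC addKr.
  rewrite divr_ge0//= ?mulr_ge0// invfM mulrCA mulrC ler_piMl ?invr_ge0 ?mulr_ge0//.
  by rewrite ler_pdivrMr// mul1r ler_nat ltnW.
exfalso; have : \sum_k f k <= \sum_(k : {ffun 'I_N -> 'I_K}) (32 * N%:R + L) * kappa * intg chi.
  rewrite -intg_sum; last by move=> k; exact: cv.
  have -> : \sum_(k : {ffun 'I_N -> 'I_K}) (32 * N%:R + L) * kappa * intg chi =
      intg (fun x => chi x * \sum_(k : {ffun 'I_N -> 'I_K}) ((32 * N%:R + L) * kappa)).
    rewrite -mulr_suml -intgZ//; congr intg; apply/funext => x; exact: mulrC.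
  apply: le_intg; [by apply: Cc_sum => k; exact: cv|by apply: CcMr => // x; exact: cst_continuous|].
  move=> x; rewrite -mulr_sumr; have [->|cx] := eqVneq (chi x) 0; first by rewrite !mul0r.
  by rewrite ler_wpM2l//; apply: grid_average => //; exact: GL.
apply/negP; rewrite -ltNge; pose k0' : {ffun 'I_N -> 'I_K} := [ffun=> ord0].
apply: ltr_sum; first by apply/hasP; exists k0'; rewrite ?mem_index_enum.
by move=> k _; rewrite ltNge; apply/negP => fk; apply: hk; exists k.
Qed.

End directions.

(** * The equation in a ball *)

Section ball_geometry.
Variables (R : realType) (N : nat) (x0 : 'rV[R]_N).
Implicit Types (x y v : 'rV[R]_N) (r t : R).

Lemma continuous_dist : continuous (fun x => enorm (x - x0)).
Proof.
move=> x; apply: (@continuous_comp _ _ _ (fun x => x - x0) (@enorm R N)).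
  by apply: continuousB => //; exact: cst_continuous.
exact: continuous_enorm.
Qed.

Lemma open_eball r : open (eball x0 r).
Proof.
have /continuousP open_preim := continuous_dist.
exact: (open_preim [set t : R | t < r] (@open_lt R r)).
Qed.

Lemma closed_sublevel r : closed [set x | enorm (x - x0) <= r].
Proof.
have /continuous_closedP h := continuous_dist.
exact: (h [set t : R | t <= r] (@closed_le R r)).
Qed.

Lemma bounded_sublevel r x : enorm (x - x0) <= r -> `|x| <= r + `|x0|.
Proof.
move=> xr; have := norm_le_enorm (x - x0); have := ler_normD (x - x0) x0.
rewrite subrK; lra.
Qed.

Lemma compact_sublevel r : compact [set x | enorm (x - x0) <= r].
Proof.
apply: bounded_closed_compact; last exact: closed_sublevel.
exists (r + `|x0|); split; first exact: num_real.
by move=> M rM x /bounded_sublevel xr; exact: le_trans xr (ltW rM).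
Qed.

Lemma closure_eball_le r x : closure (eball x0 r) x -> enorm (x - x0) <= r.
Proof.
by move=> clx; apply: (@closed_sublevel r); apply: closureS clx => y; exact: ltW.
Qed.

Lemma closure_eball_ge r x : 0 < r -> enorm (x - x0) <= r -> closure (eball x0 r) x.
Proof.
move=> r0 xr B /nbhs_ballP[e /= e0 eB].
pose t := Num.min (1/2) (e / (2 * (`|x - x0| + 1))).
have n1 : 0 < `|x - x0| + 1 by rewrite ltr_wpDl.
have t0 : 0 < t by rewrite lt_min; apply/andP; split; [lra|rewrite divr_gt0// mulr_gt0].
have t1 : t <= 1/2 by rewrite ge_min lexx.
exists (x - t *: (x - x0)); split.
  rewrite /eball /= (_ : _ - _ = (1 - t) *: (x - x0)); last first.
    by rewrite scalerBl scale1r addrAC.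
  rewrite enormZ ger0_norm; last lra.
  have [->|e1] := eqVneq (enorm (x - x0)) 0; first by rewrite mulr0.
  have e1' : 0 < enorm (x - x0) by rewrite lt_def e1 enorm_ge0.
  have := mulr_gt0 t0 e1'; lra.
apply: eB; rewrite -ball_normE /= opprB addrC subrK normrZ gtr0_norm//.
have : t * (`|x - x0| + 1) <= e / 2.
  by rewrite -ler_pdivlMr// -mulrA -invfM ge_min lexx orbT.
by have := normr_ge0 (x - x0); lra.
Qed.

Lemma compact_closure_eball r : compact (closure (eball x0 r)).
Proof.
apply: (@subclosed_compact _ _ [set x | enorm (x - x0) <= r]).
- exact: closed_closure.
- exact: compact_sublevel.
- by move=> x; exact: closure_eball_le.
Qed.

Lemma enorm_convex x y t r : 0 <= t <= 1 -> enorm (x - x0) <= r -> enorm (y - x0) <= r ->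
  enorm (x + t *: (y - x) - x0) <= r.
Proof.
move=> /andP[t0 t1] xr yr.
have -> : x + t *: (y - x) - x0 = (1 - t) *: (x - x0) + t *: (y - x0).
  by apply/rowP => i; rewrite !mxE; ring.
apply: le_trans (ler_enormD _ _) _; rewrite !enormZ !ger0_norm; [|lra|lra].
have : (1 - t) * enorm (x - x0) <= (1 - t) * r by rewrite ler_wpM2l//; lra.
have : t * enorm (y - x0) <= t * r by rewrite ler_wpM2l.
lra.
Qed.

End ball_geometry.

Section patching.
Variables (R : realType) (N : nat).
Implicit Types (f w psi : 'rV[R]_N -> R) (B S : set 'rV[R]_N) (x v : 'rV[R]_N).

Lemma near_patch_in B w x : open B -> B x -> \forall y \near x, (w \_ B) y = w y.
Proof.
move=> oB Bx; apply: (filterS _ (open_nbhs_nbhs (conj oB Bx))) => y By.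
by rewrite patchE mem_set.
Qed.

Lemma near_patch_out B S w x : closed S -> (forall y, B y -> ~ S y -> w y = 0) -> ~ S x ->
  \forall y \near x, (w \_ B) y = 0.
Proof.
move=> cS w0 Sx; have oS : open (~` S) by rewrite openC.
apply: (filterS _ (open_nbhs_nbhs (conj oS Sx))) => y Sy.
by rewrite patchE; case: ifPn => // /set_mem By; rewrite w0.
Qed.

Lemma near_eq_continuous f w x : (\forall y \near x, f y = w y) ->
  {for x, continuous f} -> {for x, continuous w}.
Proof.
move=> fw cf; suff : w @ x --> w x by [].
rewrite -(nbhs_singleton fw); have cf' : f @ x --> f x := cf.
exact: cvg_trans (near_eq_cvg fw) cf'.
Qed.

(** Every point is either in the open set [B], where the extension is [w], or in
    the open complement of [S], where it is 0. *)
Lemma continuous_patch B S w : open B -> closed S -> S `<=` B ->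
  (forall x, B x -> {for x, continuous w}) -> (forall y, B y -> ~ S y -> w y = 0) ->
  continuous (w \_ B).
Proof.
move=> oB cS SB cw w0 x; have [Bx|Bx] := pselect (B x).
  apply: near_eq_continuous (cw x Bx).
  by have := near_patch_in w oB Bx; apply: filterS => y ->.
apply: (@near_eq_continuous (cst 0)); last exact: cst_continuous.
have Sx : ~ S x by move=> /SB.
by have := near_patch_out cS w0 Sx; apply: filterS => y ->.
Qed.

Lemma is_derive_patch B S w (dw : 'rV[R]_N -> R) v : open B -> closed S -> S `<=` B ->
  (forall x, B x -> is_derive x v w (dw x)) -> (forall y, B y -> ~ S y -> w y = 0) ->
  (forall y, B y -> ~ S y -> dw y = 0) ->
  forall x, is_derive x v (w \_ B) ((dw \_ B) x).
Proof.
move=> oB cS SB dwx w0 dw0 x; have [Bx|Bx] := pselect (B x).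
  rewrite patchE mem_set//; apply: near_eq_is_derive; last exact: dwx.
  by have := near_patch_in w oB Bx; apply: filterS => y ->.
have Sx : ~ S x by move=> /SB.
rewrite (nbhs_singleton (near_patch_out cS dw0 Sx)).
apply: (@near_eq_is_derive _ _ _ (cst 0)).
by have := near_patch_out cS w0 Sx; apply: filterS => y ->.
Qed.

Lemma Cc_patch B S w (M : R) : open B -> closed S -> S `<=` B ->
  (forall x, B x -> {for x, continuous w}) -> (forall y, B y -> ~ S y -> w y = 0) ->
  (forall x, S x -> `|x| <= M) -> Cc (w \_ B).
Proof.
move=> oB cS SB cw w0 SM; split; first exact: (continuous_patch oB cS SB cw w0).
exists M => x xM; rewrite patchE; case: ifPn => // /set_mem Bx; apply: w0 => //.
by move=> /SM; rewrite leNgt xM.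
Qed.

End patching.

Section ball_problem.
Variables (R : realType) (N : nat) (x0 : 'rV[R]_N) (rad p q : R).
Variables (u a F : 'rV[R]_N -> R) (G : 'rV[R]_N -> 'rV[R]_N).
Local Notation Om := (eball x0 rad).
Local Notation e_ i := (delta_mx 0 i : 'rV[R]_N).
Implicit Types (x y v : 'rV[R]_N) (r : R).
Hypotheses (hp : 1 < p) (hpq : p <= q).
Hypothesis cG : {within closure Om, continuous G}.
Hypothesis du : forall x, Om x -> differentiable u x.
Hypothesis Gu : forall x, Om x -> G x = grad u x.
Hypothesis ca : {within closure Om, continuous a}.
Hypothesis cF : forall x, Om x -> {for x, continuous F}.
Hypothesis weak : forall phi, test_fun Om phi ->
  \int[lebesgue_rV R N]_(x in Om) dotv (flux p q a u x) (grad phi x) =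
  \int[lebesgue_rV R N]_(x in Om) (F x * phi x).

Lemma within_closure_continuous (W : normedModType R) (f : 'rV[R]_N -> W) x :
  {within closure Om, continuous f} -> Om x -> {for x, continuous f}.
Proof.
move=> /withinP_eps cf Omx; apply/continuousP_eps => e e0.
have [d d0 hd] := cf x (subset_closure Omx) e e0.
have /nbhs_ballP[d' /= d'0 hd'] := open_nbhs_nbhs (conj (@open_eball _ _ x0 rad) Omx).
exists (Num.min d d'); first by rewrite lt_min d0.
move=> y; rewrite lt_min => /andP[xy xy']; apply: hd => //.
by apply: subset_closure; apply: hd'; rewrite -ball_normE.
Qed.

Definition fluxc (i : 'I_N) x : R := pfield p (G x) 0 i + a x * pfield q (G x) 0 i.

Lemma continuous_fluxc i x : Om x -> {for x, continuous (fluxc i)}.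
Proof.
move=> Omx; have cGx := within_closure_continuous cG Omx.
have cs s : 1 < s -> {for x, continuous (fun y => pfield s (G y) 0 i)}.
  by move=> s1; apply: (@continuous_comp _ _ _ G (fun v => pfield s v 0 i)) => //; exact: continuous_pfield.
apply: continuousD; first exact: cs.
apply: continuousM; first exact: within_closure_continuous.
by apply: cs; exact: lt_le_trans hpq.
Qed.

Lemma flux_coord i x : Om x -> flux p q a u x 0 i = fluxc i x.
Proof. by move=> Omx; rewrite /fluxc Gu// /flux /pfield !mxE mulrA. Qed.

Lemma is_derive_grad x v : Om x -> is_derive x v u (dotv v (G x)).
Proof.
move=> Omx; have d := du Omx; split; first exact: diff_derivable.
rewrite deriveE// {1}(row_sum_delta v) linear_sum; apply: eq_bigr => i _.
by rewrite linearZ Gu// mxE /partial deriveE.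
Qed.

Lemma sublevel_sub r x : r < rad -> enorm (x - x0) <= r -> Om x.
Proof. by move=> rr xr; rewrite /eball /=; exact: le_lt_trans rr. Qed.

Lemma Cc_patch_ball w r : r < rad -> (forall x, Om x -> {for x, continuous w}) ->
  (forall x, w x != 0 -> enorm (x - x0) <= r) -> Cc (w \_ Om).
Proof.
move=> rr cw wr.
apply: (@Cc_patch _ _ Om [set x | enorm (x - x0) <= r] w (r + `|x0|)) => //.
- exact: open_eball.
- exact: closed_sublevel.
- by move=> x /=; exact: sublevel_sub.
- by move=> x _ xr; apply/eqP/negPn/negP => /wr.
- by move=> x /=; exact: bounded_sublevel.
Qed.

Lemma patchM (f g : 'rV[R]_N -> R) : (fun x => (f \_ Om) x * g x) = (fun x => f x * g x) \_ Om.
Proof. by apply/funext => x; rewrite !patchE; case: ifP => // _; rewrite mul0r. Qed.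

Lemma Cc_patchM (w g : 'rV[R]_N -> R) r : r < rad -> (forall x, Om x -> {for x, continuous w}) ->
  continuous g -> (forall x, g x != 0 -> enorm (x - x0) <= r) ->
  Cc (fun x => (w \_ Om) x * g x).
Proof.
move=> rr cw cg gr; rewrite patchM; apply: (@Cc_patch_ball _ r) => // x.
  by move=> Omx; apply: continuousM; [exact: cw|exact: cg].
by rewrite mulf_eq0 negb_or => /andP[_]; exact: gr.
Qed.

Lemma Cc_ball (g : 'rV[R]_N -> R) r : continuous g -> (forall x, g x != 0 -> enorm (x - x0) <= r) -> Cc g.
Proof.
move=> cg gr; split => //; exists (r + `|x0|) => x xr.
by apply/eqP/negPn/negP => /gr/bounded_sublevel; rewrite leNgt xr.
Qed.

Lemma ball_cutoff r r' : r < r' -> exists chi : 'rV[R]_N -> R,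
  [/\ continuous chi, forall x, 0 <= chi x <= 1, forall x, enorm (x - x0) <= r -> chi x = 1 &
      forall x, chi x != 0 -> enorm (x - x0) <= r'].
Proof.
move=> rr; have d0 : 0 < r' - r by rewrite subr_gt0.
pose eta x : R := Num.max 0 (Num.min 1 ((r' - enorm (x - x0)) / (r' - r))).
exists eta; split => [||x xr|x].
- have cr : continuous (fun t : R => Num.max 0 (Num.min 1 t)).
    move=> t; apply: (@continuous_max _ _ (cst 0) (fun t : R => Num.min 1 t)).
      exact: cst_continuous.
    by apply: (@continuous_min _ _ (cst 1) id) => //; exact: cst_continuous.
  move=> x; apply: (@continuous_comp _ _ _ (fun x => (r' - enorm (x - x0)) / (r' - r))
    (fun t : R => Num.max 0 (Num.min 1 t))); last exact: cr.
  apply: (@continuousM _ _ (fun x => r' - enorm (x - x0)) (cst (r' - r)^-1)); last exact: cst_continuous.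
  by apply: continuousB; [exact: cst_continuous|exact: continuous_dist].
- by move=> x; rewrite le_max lexx ge_max ler01 ge_min lexx.
- have h : 1 <= (r' - enorm (x - x0)) / (r' - r) by rewrite ler_pdivlMr; lra.
  by rewrite /eta (min_l h) max_r.
- apply: contraNT; rewrite -ltNge => xr.
  have h : (r' - enorm (x - x0)) / (r' - r) <= 0 by rewrite pmulr_lle0 ?invr_gt0; lra.
  by rewrite /eta max_l// ge_min h orbT.
Qed.

(** The fields are cut off away from the support of [phi], where nothing changes,
    so as to become continuous on the whole space; then [mollify] applies. *)
Lemma weak_C1 (r : R) phi (dphi : 'I_N -> 'rV[R]_N -> R) : r < rad ->
  continuous phi -> (forall i, continuous (dphi i)) ->
  (forall i x, is_derive x (e_ i) phi (dphi i x)) ->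
  (forall x, phi x != 0 -> enorm (x - x0) <= r) ->
  (forall i x, dphi i x != 0 -> enorm (x - x0) <= r) ->
  intg (fun x => \sum_i (fluxc i \_ Om) x * dphi i x) = intg (fun x => (F \_ Om) x * phi x).
Proof.
move=> rr cphi cdphi hd supp dsupp.
pose r1 := (r + rad) / 2; pose r2 := (r1 + rad) / 2.
have r01 : r < r1 by rewrite /r1; lra.
have r12 : r1 < r2 by rewrite /r2 /r1; lra.
have r2r : r2 < rad by rewrite /r2 /r1; lra.
have [eta [ceta _ eta1 eta2]] := ball_cutoff r12.
pose W i x := (fluxc i \_ Om) x * eta x.
pose H x := (F \_ Om) x * eta x.
have cW i : Cc (W i) by apply: (@Cc_patchM _ _ r2) => // x; exact: continuous_fluxc.
have cH : Cc H by exact: (@Cc_patchM _ _ r2).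
have WE i f x : (f x != 0 -> enorm (x - x0) <= r1) -> W i x * f x = (fluxc i \_ Om) x * f x.
  have [->|f0 /(_ isT)/eta1 e1] := eqVneq (f x) 0; first by rewrite !mulr0.
  by rewrite /W e1 mulr1.
have HE f x : (f x != 0 -> enorm (x - x0) <= r1) -> H x * f x = (F \_ Om) x * f x.
  have [->|f0 /(_ isT)/eta1 e1] := eqVneq (f x) 0; first by rewrite !mulr0.
  by rewrite /H e1 mulr1.
have N1 : 0 < N%:R + 1 :> R by rewrite ltr_wpDl.
have d0 : 0 < (r1 - r) / (N%:R + 1) by rewrite divr_gt0// subr_gt0.
have := @mollify R N W H phi dphi _ cW cH (Cc_ball cphi supp)
  (fun i => Cc_ball (cdphi i) (dsupp i)) hd d0.
move=> h; rewrite (_ : (fun x => \sum_i _) = fun x => \sum_i W i x * dphi i x); last first.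
  apply/funext => x; apply: eq_bigr => i _; rewrite WE// => /dsupp xr; lra.
rewrite (_ : (fun x => _ * phi x) = fun x => H x * phi x); last first.
  by apply/funext => x; rewrite HE// => /supp xr; lra.
apply: h => y d phiy dpos dd.
have near_y x : `|x - y| <= d -> enorm (x - x0) <= r1.
  move=> xy; have yr := supp y phiy.
  have := ler_enormD (x - y) (y - x0); rewrite addrA subrK.
  have : d * (N%:R + 1) < r1 - r by rewrite -ltr_pdivlMr.
  have := enorm_le_norm (x - y).
  have : N%:R * `|x - y| <= N%:R * d by rewrite ler_wpM2l.
  lra.
have bsupp x : smooth_bump d y x != 0 -> enorm (x - x0) <= r1.
  by move=> bx; apply: near_y; apply: contraR bx; rewrite -ltNge => /ltW xd; rewrite bump_supp.
have dbsupp i x : partial i (smooth_bump d y) x != 0 -> enorm (x - x0) <= r1.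
  rewrite partial_bump_shift => bx; apply: near_y; apply: contraR bx; rewrite -ltNge => xd.
  by rewrite (@partial_supp _ _ i _ d)// => z zd; rewrite bump_supp// subr0 ltW.
have tb : test_fun Om (smooth_bump d y).
  by apply: test_fun_bump => // x /near_y xr; apply: sublevel_sub xr; lra.
have := weak tb; rewrite [LHS]Rintegral_mkcond [RHS]Rintegral_mkcond => wk.
transitivity (\int[lebesgue_rV R N]_x ((fun x => dotv (flux p q a u x) (grad (smooth_bump d y) x)) \_ Om) x).
  congr intg; apply/funext => x; rewrite patchE; case: ifPn => xOm.
    apply: eq_bigr => i _; rewrite WE; last exact: dbsupp.
    by rewrite patchE xOm flux_coord ?inE//; [rewrite mxE|exact: set_mem].
  by rewrite big1// => i _; rewrite /W patchE (negbTE xOm) !mul0r.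
rewrite wk; congr intg; apply/funext => x; rewrite HE; last exact: bsupp.
by rewrite !patchE; case: ifP => // _; rewrite mul0r.
Qed.

End ball_problem.

(** * Truncation profiles *)

Section truncation_profiles.
Variable R : realType.
Implicit Types (s t k : R).

Definition pos_part t : R := Num.max 0 t.

Lemma pos_partP t : (t <= 0 /\ pos_part t = 0) \/ (0 <= t /\ pos_part t = t).
Proof. by rewrite /pos_part; case: (leP 0 t) => h; [right|left]; split => //; exact: ltW. Qed.

Lemma continuous_pos_part : continuous pos_part.
Proof. by move=> t; apply: (@continuous_max _ _ (cst 0) id) => //; exact: cst_continuous. Qed.

(** Squaring makes the positive part continuously differentiable. *)
Lemma is_derive_pos_part2 t : is_derive t 1 (fun t => pos_part t ^+ 2) (2 * pos_part t).
Proof.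
have [t0|t0|->] := ltgtP t 0.
- apply: (@near_eq_is_derive _ _ _ (cst 0)); last first.
    by rewrite /pos_part max_l ?(ltW t0)// mulr0; exact: is_derive_cst.
  near=> s; rewrite /pos_part max_l ?expr0n// ltW//.
  by near: s; exact: lt_nbhsl.
- apply: (@near_eq_is_derive _ _ _ (fun s : R => s * s)); last first.
    apply: (is_derive_eqW (is_deriveM (is_derive_id _ _) (is_derive_id _ _))).
    by rewrite /pos_part max_r ?(ltW t0)// /GRing.scale /= mulr1; lra.
  near=> s; rewrite /pos_part max_r ?expr2// ltW//.
  by near: s; exact: lt_nbhsr.
- rewrite {2}/pos_part maxxx mulr0.
  have h : h^-1 *: (((fun t => pos_part t ^+ 2) \o shift 0) (h *: (1 : R^o)) - pos_part 0 ^+ 2)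
      @[h --> 0^'] --> (0 : R).
    apply/cvgrPdist_lt => e e0; near=> h.
    rewrite /= sub0r normrN addr0 {2}/pos_part maxxx expr0n /= subr0.
    rewrite /GRing.scale /= mulr1 normrM.
    have he : `|h| < e by near: h; exact: dnbhs0_lt.
    have h0 : h != 0 by near: h; exact: nbhs_dnbhs_neq.
    case: (pos_partP h) => -[_ ->]; first by rewrite expr0n normr0 mulr0.
    by rewrite expr2 normrM normfV mulKf// normr_eq0.
  split; first by apply/cvg_ex; exists 0.
  by rewrite /derive; apply/cvg_lim.
Unshelve. all: end_near. Qed.

(** A [C^1] transition from 0 to 1 on the interval [0, 2] and its derivative. *)
Definition hat t : R := pos_part t - 2 * pos_part (t - 1) + pos_part (t - 2).
Definition ramp t : R :=
  pos_part t ^+ 2 / 2 - pos_part (t - 1) ^+ 2 + pos_part (t - 2) ^+ 2 / 2.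

Lemma is_derive_ramp t : is_derive t 1 ramp (hat t).
Proof.
have d c : is_derive t 1 (fun s => pos_part (s - c) ^+ 2) (2 * pos_part (t - c)).
  have := @is_derive1_comp R (fun s => pos_part s ^+ 2) (fun s => s - c) t _ _
    (is_derive_pos_part2 (t - c)).
  have dc : is_derive t 1 (fun s : R => s - c) 1.
    have h := is_deriveD (is_derive_id t (1 : R)) (is_derive_cst (- c) t (1 : R)).
    by apply: (is_derive_eqW h); rewrite addr0.
  by move=> /(_ _ dc); rewrite mulr1.
have d0 : is_derive t 1 (fun s => pos_part s ^+ 2) (2 * pos_part t) by exact: is_derive_pos_part2.
have sc f (l : R) : is_derive t 1 f l -> is_derive t 1 (fun s => f s / 2) (l / 2).
  move=> df; have h := is_deriveM df (is_derive_cst (2^-1 : R) t (1 : R)).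
  by apply: (is_derive_eqW h); rewrite /GRing.scale /= mulr0 add0r mulrC.
have h := is_deriveD (is_deriveB (sc _ _ d0) (d 1)) (sc _ _ (d 2)).
by apply: (is_derive_eqW h); rewrite /hat; field.
Qed.

Lemma continuous_hat : continuous hat.
Proof.
have c (b : R) : continuous (fun t => pos_part (t - b)).
  move=> t; apply: (@continuous_comp _ _ _ (fun t : R => t - b) pos_part).
    by apply: continuousB => //; exact: cst_continuous.
  exact: continuous_pos_part.
move=> t; apply: (@continuousD _ _ _ (fun t => pos_part t - 2 * pos_part (t - 1))
  (fun t => pos_part (t - 2))); last exact: c.
apply: (@continuousB _ _ _ pos_part (fun t => 2 * pos_part (t - 1))).
  exact: continuous_pos_part.
by apply: continuousM; [exact: cst_continuous|exact: c].
Qed.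

Lemma continuous_ramp : continuous ramp.
Proof.
move=> t; apply: differentiable_continuous; apply/derivable1_diffP.
by have [] := is_derive_ramp t.
Qed.

Lemma hat_itv t : 0 <= hat t <= 1.
Proof.
rewrite /hat; case: (pos_partP t) => -[? ->]; case: (pos_partP (t - 1)) => -[? ->];
case: (pos_partP (t - 2)) => -[? ->]; apply/andP; split; lra.
Qed.

Lemma hat_out t : t <= 0 \/ 2 <= t -> hat t = 0.
Proof.
rewrite /hat; case: (pos_partP t) => -[? ->]; case: (pos_partP (t - 1)) => -[? ->];
case: (pos_partP (t - 2)) => -[? ->] []; lra.
Qed.

Lemma ramp0 t : t <= 0 -> ramp t = 0.
Proof.
rewrite /ramp; case: (pos_partP t) => -[? ->]; case: (pos_partP (t - 1)) => -[? ->];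
case: (pos_partP (t - 2)) => -[? ->] ?; rewrite ?expr0n /=; try lra.
by have t0 : t = 0; [lra|rewrite t0 expr2; lra].
Qed.

Lemma ramp1 t : 2 <= t -> ramp t = 1.
Proof.
move=> t2; rewrite /ramp; case: (pos_partP t) => -[? ->]; first lra.
case: (pos_partP (t - 1)) => -[? ->]; first lra.
case: (pos_partP (t - 2)) => -[? ->]; last by field.
by have t0 : t = 2; [lra|rewrite t0; field].
Qed.

Lemma ramp_itv t : 0 <= ramp t <= 1.
Proof.
rewrite /ramp; case: (pos_partP t) => -[? ->]; case: (pos_partP (t - 1)) => -[? ->];
case: (pos_partP (t - 2)) => -[? ->]; apply/andP; split; rewrite ?expr0n /=; nra.
Qed.

(** [cutoff k] vanishes where [|s| <= k] and is 1 where [|s| >= 3 k]; [clip k] is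
    its odd analogue. Up to a factor [k], their derivatives are [dcutoff k]
    and [dclip k], and the latter dominates the former. *)
Definition cutoff k s : R := ramp (s / k - 1) + ramp (- (s / k) - 1).
Definition dcutoff k s : R := hat (s / k - 1) - hat (- (s / k) - 1).
Definition clip k s : R := ramp (s / k - 1) - ramp (- (s / k) - 1).
Definition dclip k s : R := hat (s / k - 1) + hat (- (s / k) - 1).

Lemma is_derive_ramp_scale (c s : R) :
  is_derive s 1 (fun s => ramp (c * s - 1)) (hat (c * s - 1) * c).
Proof.
have dc : is_derive s 1 (fun s : R => c * s - 1) c.
  have h1 := is_deriveM (is_derive_cst c s (1 : R)) (is_derive_id s (1 : R)).
  have h := is_deriveD h1 (is_derive_cst (- 1 : R) s (1 : R)).
  by apply: (is_derive_eqW h); rewrite /GRing.scale /= mulr1 mulr0 !addr0.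
exact: (@is_derive1_comp R ramp (fun s => c * s - 1) s _ _ (is_derive_ramp (c * s - 1)) dc).
Qed.

Lemma is_derive_cutoff k s : is_derive s 1 (cutoff k) (dcutoff k s / k).
Proof.
have h := is_deriveD (is_derive_ramp_scale k^-1 s) (is_derive_ramp_scale (- k^-1) s).
have E : cutoff k = (fun s => ramp (k^-1 * s - 1)) + (fun s => ramp (- k^-1 * s - 1)).
  by apply/funext => z; rewrite /cutoff [z / k]mulrC -mulNr.
rewrite E; apply: (is_derive_eqW h).
by rewrite /dcutoff mulNr [k^-1 * s]mulrC; ring.
Qed.

Lemma is_derive_clip k s : is_derive s 1 (clip k) (dclip k s / k).
Proof.
have h := is_deriveB (is_derive_ramp_scale k^-1 s) (is_derive_ramp_scale (- k^-1) s).
have E : clip k = (fun s => ramp (k^-1 * s - 1)) - (fun s => ramp (- k^-1 * s - 1)).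
  by apply/funext => z; rewrite /clip [z / k]mulrC -mulNr.
rewrite E; apply: (is_derive_eqW h).
by rewrite /dclip mulNr [k^-1 * s]mulrC; ring.
Qed.

Let lin_cont (f : R -> R) (c : R) : continuous f -> continuous (fun s => f (c * s - 1)).
Proof.
move=> cf s; apply: (@continuous_comp _ _ _ (fun s : R => c * s - 1) f); last exact: cf.
apply: continuousB; last exact: cst_continuous.
by apply: continuousM => //; exact: cst_continuous.
Qed.

Lemma continuous_dclip k : continuous (dclip k).
Proof.
rewrite (_ : dclip k = fun s => hat (k^-1 * s - 1) + hat (- k^-1 * s - 1)); last first.
  by apply/funext => s; rewrite /dclip [s / k]mulrC -mulNr.
move=> s; apply: (@continuousD _ _ _ (fun s => hat (k^-1 * s - 1)) (fun s => hat (- k^-1 * s - 1)));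
  by apply: lin_cont; exact: continuous_hat.
Qed.

Lemma continuous_dcutoff k : continuous (dcutoff k).
Proof.
rewrite (_ : dcutoff k = fun s => hat (k^-1 * s - 1) - hat (- k^-1 * s - 1)); last first.
  by apply/funext => s; rewrite /dcutoff [s / k]mulrC -mulNr.
move=> s; apply: (@continuousB _ _ _ (fun s => hat (k^-1 * s - 1)) (fun s => hat (- k^-1 * s - 1)));
  by apply: lin_cont; exact: continuous_hat.
Qed.

Lemma continuous_clip k : continuous (clip k).
Proof.
move=> t; apply: differentiable_continuous; apply/derivable1_diffP.
by have [] := is_derive_clip k t.
Qed.

Lemma continuous_cutoff k : continuous (cutoff k).
Proof.
move=> t; apply: differentiable_continuous; apply/derivable1_diffP.
by have [] := is_derive_cutoff k t.
Qed.

Section bounds.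
Variables (k : R) (k0 : 0 < k).

Lemma le_div_scale s c : `|s| <= c * k <-> - c <= s / k <= c.
Proof. by rewrite -ler_norml normrM normfV (gtr0_norm k0) ler_pdivrMr. Qed.

Lemma ge_div_scale s c : c * k <= `|s| -> (c <= s / k) \/ (s / k <= - c).
Proof.
rewrite -ler_pdivlMr// -[k in X in X -> _](gtr0_norm k0) -normfV -normrM ler_normr.
by move=> /orP[]; [left|right; rewrite lerNr].
Qed.

Lemma cutoff0 s : `|s| <= k -> cutoff k s = 0.
Proof.
by rewrite -[k in X in X -> _]mul1r => /le_div_scale/andP[h1 h2];
  rewrite /cutoff !ramp0 ?addr0//; lra.
Qed.

Lemma cutoff1 s : 3 * k <= `|s| -> cutoff k s = 1.
Proof.
move=> /ge_div_scale[] h; rewrite /cutoff; [rewrite ramp1 ?ramp0 ?addr0|rewrite ramp0 ?ramp1 ?add0r];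
  by lra.
Qed.

Lemma dclip_out s : `|s| <= k \/ 3 * k <= `|s| -> dclip k s = 0.
Proof.
rewrite -[k in X in X \/ _]mul1r => -[/le_div_scale/andP[h1 h2]|/ge_div_scale[] h];
  rewrite /dclip !hat_out ?addr0//; first [by left; lra | by right; lra].
Qed.

Lemma dclip_itv s : 0 <= dclip k s <= 1.
Proof.
rewrite /dclip; have := hat_itv (s / k - 1); have := hat_itv (- (s / k) - 1).
have [h|h] := leP 0 (s / k).
  by rewrite (@hat_out (- _ - _)) ?addr0//; left; lra.
by rewrite (@hat_out (s / k - 1)) ?add0r//; left; lra.
Qed.

Lemma dcutoff_le s : `|dcutoff k s| <= dclip k s.
Proof.
rewrite /dcutoff /dclip; have /andP[h1 _] := hat_itv (s / k - 1).
have /andP[h2 _] := hat_itv (- (s / k) - 1).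
rewrite ler_norml; apply/andP; split; lra.
Qed.

Lemma clip_le1 s : `|clip k s| <= 1.
Proof.
rewrite /clip; have := ramp_itv (s / k - 1); have := ramp_itv (- (s / k) - 1).
by move=> /andP[? ?] /andP[? ?]; rewrite ler_norml; apply/andP; split; lra.
Qed.

Lemma clip0 s : `|s| <= k -> clip k s = 0.
Proof.
by rewrite -[k in X in X -> _]mul1r => /le_div_scale/andP[h1 h2];
  rewrite /clip !ramp0 ?subr0//; lra.
Qed.

Lemma cutoff_itv s : 0 <= cutoff k s <= 1.
Proof.
rewrite /cutoff; have := ramp_itv (s / k - 1); have := ramp_itv (- (s / k) - 1).
have [h|h] := leP 0 (s / k).
  by rewrite (@ramp0 (- _ - _)) ?addr0//; lra.
by rewrite (@ramp0 (s / k - 1)) ?add0r//; lra.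
Qed.

End bounds.
End truncation_profiles.

(** * No part of the noncritical set stays away from the boundary *)

Section near_basis_directions.
Variables (R : realType) (N : nat).
Implicit Types (v xi : 'rV[R]_N).

(** The bound [1 / (4 N)] makes [dotv v] agree with the [i]-th coordinate up to a
    quarter of the sup norm, whence [near_basis_coercive]. *)
Definition near_basis (i : 'I_N) v : Prop :=
  forall l, 0 <= v 0 l - (l == i)%:R <= (4 * N%:R)^-1.

Lemma near_basis_dotv i v xi : near_basis i v -> `|dotv v xi - xi 0 i| <= `|xi| / 4.
Proof.
move=> vi; have N0 : 0 < N%:R :> R by rewrite ltr0n; exact: leq_ltn_trans (ltn_ord i).
have -> : dotv v xi - xi 0 i = \sum_l (v 0 l - (l == i)%:R) * xi 0 l.
  under eq_bigr do rewrite mulrBl; rewrite sumrB; congr (_ - _).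
  rewrite (bigD1 i)//= eqxx mul1r big1 ?addr0// => l li.
  by rewrite (negbTE li) mul0r.
apply: le_trans (ler_norm_sum _ _ _) _.
apply: (@le_trans _ _ (\sum_(l < N) (4 * N%:R)^-1 * `|xi|)).
  apply: ler_sum => l _; rewrite normrM; have /andP[h1 h2] := vi l.
  by rewrite ler_pM// ?(ger0_norm h1)// le_coord_norm.
rewrite sumr_const card_ord -[leLHS]mulr_natl.
have -> : N%:R * ((4 * N%:R)^-1 * `|xi|) = `|xi| / 4 by field; rewrite gt_eqF.
by [].
Qed.

Lemma near_basis_le i v xi : near_basis i v -> `|dotv v xi| <= 2 * `|xi|.
Proof.
move=> /(@near_basis_dotv _ _ xi); have := le_coord_norm xi i.
move=> h1 h2; have := ler_normD (dotv v xi - xi 0 i) (xi 0 i); rewrite subrK.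
by have := normr_ge0 xi; lra.
Qed.

Lemma near_basis_norm i v : near_basis i v -> `|v| <= 2.
Proof.
move=> vi; have N1 : 1 <= N%:R :> R.
  by rewrite ler1n; exact: leq_ltn_trans (ltn_ord i).
apply: norm_le_coord => // l; have /andP[h1 h2] := vi l.
have h3 : (4 * N%:R)^-1 <= 1 :> R by rewrite invf_le1; lra.
rewrite ger0_norm; move: h1 h2; case: (l == i) => /= h1 h2; lra.
Qed.

(** In the coordinate [j] where [xi] is largest, [dotv (v j)] sees at least three
    quarters of it. *)
Lemma near_basis_coercive (v : 'I_N -> 'rV[R]_N) xi (c : R) : 0 <= c ->
  (forall i, near_basis i (v i)) -> (forall i, `|dotv (v i) xi| <= c) -> `|xi| <= 2 * c.
Proof.
move=> c0 vi vc; have [->|xi0] := eqVneq xi 0; first by rewrite normr0 mulr_ge0.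
have [[z j] hj] : exists j, `|xi| = `|xi j.1 j.2|.
  by apply: mx_norm_neq0; change (`|xi| != 0); rewrite normr_eq0.
rewrite /= (ord1 z) in hj.
have := near_basis_dotv xi (vi j); rewrite distrC => /(le_trans (lerB_dist _ _)).
by rewrite -hj; have := vc j; have := normr_ge0 xi; lra.
Qed.

End near_basis_directions.

Section double_phase.
Variables (R : realType) (N : nat).
Implicit Types (x y xi : 'rV[R]_N).

Definition coercivity (p : R) : R := Num.min 1 (p - 1) * pfield_const p.

Lemma coercivity_gt0 (p : R) : 1 < p -> 0 < coercivity p.
Proof. by move=> p1; rewrite mulr_gt0 ?pfield_const_gt0// lt_min ltr01 subr_gt0. Qed.

(** The [p]-part is coercive and the [q]-part monotone for a frozen coefficient;
    the variation of the coefficient costs [h |xi|^(q-1) |xi' - xi|], of which half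
    of the coercive term absorbs a part by Young's inequality. *)
Lemma double_phase_coercive (p q al al' h : R) xi xi' : 1 < p -> p <= q -> 0 <= al' ->
  `|al' - al| <= h -> 0 < enorm xi -> enorm (xi' - xi) <= enorm xi / 2 ->
  coercivity p / 2 * (enorm xi `^ (p - 2) * enorm (xi' - xi) ^+ 2) <=
  \sum_i ((pfield p xi' 0 i + al' * pfield q xi' 0 i) -
          (pfield p xi 0 i + al * pfield q xi 0 i)) * (xi' - xi) 0 i +
  h ^+ 2 / (2 * coercivity p) * enorm xi `^ (2 * q - p).
Proof.
move=> p1 pq al0 alh xi0 xixi.
have q1 : 1 < q by exact: lt_le_trans pq.
have c0 := coercivity_gt0 p1; set c := coercivity p in c0 *.
have h0 : 0 <= h by exact: le_trans alh.
have -> : \sum_i ((pfield p xi' 0 i + al' * pfield q xi' 0 i) -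
          (pfield p xi 0 i + al * pfield q xi 0 i)) * (xi' - xi) 0 i =
   dotv (pfield p xi' - pfield p xi) (xi' - xi) +
   al' * dotv (pfield q xi' - pfield q xi) (xi' - xi) +
   (al' - al) * dotv (pfield q xi) (xi' - xi).
  rewrite /dotv !mulr_sumr -!big_split /=; apply: eq_bigr => i _.
  by move: (pfield p xi) (pfield p xi') (pfield q xi) (pfield q xi') => f1 f2 f3 f4;
    rewrite !mxE; ring.
have h1 := pfield_coercive p1 xi0 xixi; rewrite -/(coercivity p) -/c in h1.
have h2 : 0 <= al' * dotv (pfield q xi' - pfield q xi) (xi' - xi).
  by rewrite mulr_ge0// pfield_monotone.
set Y := enorm (xi' - xi) in h1 xixi *; set m := enorm xi `^ (p - 2) in h1 *.
have Y0 : 0 <= Y by exact: enorm_ge0.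
have m0 : 0 < m by exact: powR_gt0.
set X := enorm xi `^ (q - 1).
have X0 : 0 <= X by exact: powR_ge0.
have h3 : - (h * (X * Y)) <= (al' - al) * dotv (pfield q xi) (xi' - xi).
  rewrite lerNl; apply: le_trans (ler_norm _) _; rewrite normrN normrM.
  by rewrite ler_pM//; apply: le_trans (dotv_norm_le _ _) _; rewrite enorm_pfield.
have -> : enorm xi `^ (2 * q - p) = X ^+ 2 / m.
  have -> : 2 * q - p = (q - 1) + (q - 1) - (p - 2) by ring.
  have x0 : enorm xi != 0 by rewrite gt_eqF.
  by rewrite powRB ?x0 ?implybT// powRD ?x0 ?implybT// expr2.
have young : h * (X * Y) <= c / 2 * (m * Y ^+ 2) + h ^+ 2 / (2 * c) * (X ^+ 2 / m).
  rewrite -subr_ge0.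
  have -> : c / 2 * (m * Y ^+ 2) + h ^+ 2 / (2 * c) * (X ^+ 2 / m) - h * (X * Y) =
     (c * m * Y - h * X) ^+ 2 / (2 * c * m) by field; rewrite !gt_eqF.
  have c2 : 0 < 2 * c by rewrite mulr_gt0.
  exact: divr_ge0 (sqr_ge0 _) (ltW (mulr_gt0 c2 m0)).
rewrite -mulrA in h1.
set D1 := dotv _ _ in h1 *; set D2 := al' * _ in h2 *; set D3 := (al' - al) * _ in h3 *.
set E := h ^+ 2 / _ * _ in young *; set K := m * Y ^+ 2 in h1 young *.
move: young h1 h2 h3; move: (h * (X * Y)) => Z; lra.
Qed.

Lemma double_phase_le (p q al A L : R) xi : 1 < p -> p <= q -> 0 <= al <= A -> enorm xi <= L ->
  enorm (pfield p xi + al *: pfield q xi) <= (1 + A * L `^ (q - p)) * enorm xi `^ (p - 1).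
Proof.
move=> p1 pq /andP[al0 alA] xiL; have q1 : 1 < q by exact: lt_le_trans pq.
apply: le_trans (ler_enormD _ _) _; rewrite enormZ (ger0_norm al0) !enorm_pfield//.
rewrite mulrDl mul1r lerD2l -mulrA ler_pM ?powR_ge0//.
have -> : q - 1 = (q - p) + (p - 1) by ring.
rewrite powRD; last by apply/implyP => /eqP; lra.
rewrite ler_wpM2r ?powR_ge0//; apply: ge0_ler_powR; rewrite ?nnegrE ?enorm_ge0//; first lra.
by apply: le_trans xiL; exact: enorm_ge0.
Qed.

End double_phase.

Section interior_pieces.
Variables (R : realType) (N : nat) (x0 : 'rV[R]_N) (rad p q : R).
Variables (u a F : 'rV[R]_N -> R) (G : 'rV[R]_N -> 'rV[R]_N).
Local Notation Om := (eball x0 rad).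
Local Notation e_ i := (delta_mx 0 i : 'rV[R]_N).
Implicit Types (x y v w : 'rV[R]_N) (r : R).
Hypotheses (hp : 1 < p) (hpq : p <= q).
Hypothesis cG : {within closure Om, continuous G}.
Hypothesis du : forall x, Om x -> differentiable u x.
Hypothesis Gu : forall x, Om x -> G x = grad u x.
Hypothesis ca : {within closure Om, continuous a}.
Hypothesis cF : forall x, Om x -> {for x, continuous F}.
Hypothesis weak : forall phi, test_fun Om phi ->
  \int[lebesgue_rV R N]_(x in Om) dotv (flux p q a u x) (grad phi x) =
  \int[lebesgue_rV R N]_(x in Om) (F x * phi x).
Local Notation fluxc := (fluxc p q a G).

Let weak1 r phi dphi := @weak_C1 R N x0 rad p q u a F G hp hpq cG Gu ca cF weak r phi dphi.
Let cflux i x (Omx : Om x) := @continuous_fluxc R N x0 rad p q a G hp hpq cG ca i x Omx.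
Let dgrad x v (Omx : Om x) := @is_derive_grad R N x0 rad u G du Gu x v Omx.

(** Test the equation with [phi] and with its translate by [w]: a [C^1] solution
    has no second derivatives, and the equation is differenced instead. *)
Lemma weak_difference (r r' : R) w phi (dphi : 'I_N -> 'rV[R]_N -> R) : r <= r' -> r' < rad ->
  (forall x, enorm (x - x0) <= r -> enorm (x + w - x0) <= r') ->
  continuous phi -> (forall i, continuous (dphi i)) ->
  (forall i x, is_derive x (e_ i) phi (dphi i x)) ->
  (forall x, phi x != 0 -> enorm (x - x0) <= r) ->
  (forall i x, dphi i x != 0 -> enorm (x - x0) <= r) ->
  intg (fun x => \sum_i ((fluxc i \_ Om) (x + w) - (fluxc i \_ Om) x) * dphi i x) =
  intg (fun x => ((F \_ Om) (x + w) - (F \_ Om) x) * phi x).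
Proof.
move=> rr' r'rad move cphi cdphi hd supp dsupp.
have rrad : r < rad by exact: le_lt_trans r'rad.
have csh f : continuous f -> continuous (fun x : 'rV[R]_N => f (x - w) : R).
  move=> cf x; apply: (@continuous_comp _ _ _ (fun x => x - w) f); last exact: cf.
  by apply: continuousB => //; exact: cst_continuous.
have shsupp (f : 'rV[R]_N -> R) : (forall x, f x != 0 -> enorm (x - x0) <= r) ->
    forall x, f (x - w) != 0 -> enorm (x - x0) <= r'.
  by move=> h x /h/move; rewrite subrK.
have := weak1 r'rad (csh _ cphi) (fun i => csh _ (cdphi i))
  (fun i x => is_derive_translate (hd i (x - w))) (shsupp _ supp) (fun i => shsupp _ (dsupp i)).
have c1 i : Cc (fun x => (fluxc i \_ Om) x * dphi i (x - w)).
  by apply: (Cc_patchM r'rad); [exact: cflux|exact: csh|exact: (shsupp _ (dsupp i))].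
have c2 : Cc (fun x => (F \_ Om) x * phi (x - w)).
  by apply: (Cc_patchM r'rad); [exact: cF|exact: csh|exact: (shsupp _ supp)].
have c3 i : Cc (fun x => (fluxc i \_ Om) x * dphi i x).
  by apply: (Cc_patchM rrad); [exact: cflux|exact: cdphi|exact: dsupp].
have c4 : Cc (fun x => (F \_ Om) x * phi x) by exact: (Cc_patchM rrad).
rewrite -(intg_shift w (Cc_sum _ c1)) -(intg_shift w c2) => e1.
have e2 := weak1 rrad cphi cdphi hd supp dsupp.
have c1' i : Cc (fun x => (fluxc i \_ Om) (x + w) * dphi i x).
  by have := Cc_shift w (c1 i); under eq_fun do rewrite addrK.
have c2' : Cc (fun x => (F \_ Om) (x + w) * phi x).
  by have := Cc_shift w c2; under eq_fun do rewrite addrK.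
transitivity (intg (fun x => \sum_i (fluxc i \_ Om) (x + w) * dphi i x) -
              intg (fun x => \sum_i (fluxc i \_ Om) x * dphi i x)).
  rewrite -intgB; [|exact: Cc_sum|exact: Cc_sum].
  by congr intg; apply/funext => x; rewrite -sumrB; apply: eq_bigr => i _; rewrite mulrBl.
transitivity (intg (fun x => (F \_ Om) (x + w) * phi x) - intg (fun x => (F \_ Om) x * phi x)).
  congr (_ - _) => //; move: e1.
  under eq_fun do under eq_bigr do rewrite addrK.
  by under [in X in _ = X -> _]eq_fun do rewrite addrK.
by rewrite -intgB//; congr intg; apply/funext => x; rewrite mulrBl.
Qed.

(** [B] is a relatively clopen part of the noncritical set that stays in a
    smaller ball; [no_interior_piece] shows that it is empty. *)
Section piece.
Variables (B : set 'rV[R]_N) (r0 r1 L La Am LF : R).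
Hypotheses (r01 : r0 < r1) (r1rad : r1 < rad) (La0 : 0 <= La) (LF0 : 0 <= LF).
Hypothesis oB : open B.
Hypothesis Br : forall x, B x -> enorm (x - x0) <= r0.
Hypothesis BG : forall x, B x -> G x != 0.
Hypothesis Bcl : forall x, closure B x -> Om x -> G x != 0 -> B x.
Hypotheses (L0 : 0 < L) (GL : forall x, Om x -> enorm (G x) <= L).
Hypothesis aA : forall x, Om x -> 0 <= a x <= Am.
Hypothesis aL : forall x y, Om x -> Om y -> `|a x - a y| <= La * `|x - y|.
Hypothesis FL : forall x y, enorm (x - x0) <= r1 -> enorm (y - x0) <= r1 ->
  `|F x - F y| <= LF * `|x - y|.

Let r0rad : r0 < rad. Proof. exact: lt_trans r1rad. Qed.

Let BOm x : B x -> Om x.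
Proof. by move=> /Br; apply: sublevel_sub. Qed.

(** Limits of points of [B] are either in [B] or critical, so that requiring a
    lower bound on the gradient makes the set closed in the whole space. This is
    what allows functions that vanish where the gradient is small to be extended
    by 0 outside [B]. *)
Lemma closed_piece (k : R) : 0 < k -> closed [set x | B x /\ k <= `|G x|].
Proof.
move=> k0 x clx.
have cBx : closure B x by apply: closureS clx => y [].
have xr : enorm (x - x0) <= r0.
  have := closureS Br cBx.
  by have /closure_id <- := @closed_sublevel R N x0 r0.
have Omx := sublevel_sub r0rad xr.
have kG : k <= `|G x|.
  rewrite leNgt; apply/negP => Gk.
  have /continuousP_eps/(_ (k - `|G x|)) := within_closure_continuous cG Omx.
  rewrite subr_gt0 => /(_ Gk)[d d0 hd].
  have [y [[_ ky] ]] := clx _ (nbhsx_ballx x _ d0).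
  rewrite -ball_normE /= => /hd xy.
  by have := ler_distD 0 (G y) (G x); rewrite !(subr0, sub0r, normrN);
    have := lerB_dist (G y) (G x); rewrite distrC; lra.
by split => //; apply: Bcl => //; rewrite -normr_gt0; exact: lt_le_trans kG.
Qed.

Let vol : R := (2 * (`|r0| + `|x0| + 1)) ^+ N.

Definition quot (tau : R) v x : R := (u (x + tau *: v) - u x) / tau.

Section scale.
Variables (k tau : R) (k0 : 0 < k) (tau0 : 0 < tau).
(* Small enough for [N * eta] to be below [k / 8]. *)
Let eta : R := k / (8 * (N%:R + 1)).
Hypothesis tauP : forall x w, enorm (x - x0) <= r0 -> `|w| <= 2 * tau ->
  enorm (x + w - x0) <= r1 /\ `|G (x + w) - G x| <= eta.

Let eta0 : 0 < eta. Proof. by rewrite divr_gt0// mulr_gt0// ltr_wpDl. Qed.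
Let eta8 : eta <= k / 8.
Proof. by rewrite /eta invfM mulrA ler_piMr ?divr_ge0 ?(ltW k0)// invf_le1 ?ltr_wpDl// lerDr. Qed.
Let etaN : N%:R * eta <= k / 8.
Proof.
have N1 : 0 < N%:R + 1 :> R by rewrite ltr_wpDl.
rewrite /eta (_ : _ * _ = k / 8 * (N%:R / (N%:R + 1))); last by field; rewrite gt_eqF.
by rewrite ler_piMr ?divr_ge0 ?(ltW k0)// ler_pdivrMr// mul1r lerDl.
Qed.

Section direction.
Variables (i0 : 'I_N) (v : 'rV[R]_N) (vi : near_basis i0 v).

Let wle (s : R) : 0 <= s <= tau -> `|s *: v| <= 2 * tau.
Proof.
move=> /andP[s0 st]; rewrite normrZ (ger0_norm s0) mulrC.
by apply: ler_pM => //; exact: near_basis_norm vi.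
Qed.

Let wtau : `|tau *: v| <= 2 * tau.
Proof. by apply: wle; rewrite lexx ltW. Qed.

Let moveOm x w : enorm (x - x0) <= r0 -> `|w| <= 2 * tau -> Om (x + w).
Proof. by move=> xr /(tauP xr)[h _]; exact: sublevel_sub h. Qed.

Lemma quot_close x : enorm (x - x0) <= r0 -> `|quot tau v x - dotv v (G x)| <= 2 * eta.
Proof.
move=> xr.
have [s st E] := @MVT_line R N u (fun s => dotv v (G (x + s *: v))) x v tau (ltW tau0)
  (fun s st => dgrad v (moveOm xr (wle st))).
rewrite /quot E mulfK ?gt_eqF// -dotvBr.
apply: le_trans (near_basis_le _ vi) _; rewrite ler_pM2l//.
by have [_] := tauP xr (wle st).
Qed.

Lemma is_derive_quot x w : enorm (x - x0) <= r0 ->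
  is_derive x w (quot tau v) ((dotv w (G (x + tau *: v)) - dotv w (G x)) / tau).
Proof.
move=> xr.
have h1 := is_derive_translate (dgrad w (moveOm xr wtau)).
have h2 := is_deriveB h1 (dgrad w (sublevel_sub r0rad xr)).
have h := is_deriveM h2 (is_derive_cst (tau^-1) x w).
by apply: (is_derive_eqW h); rewrite scaler0 add0r /GRing.scale /= mulrC.
Qed.

Lemma continuous_quot x : enorm (x - x0) <= r0 -> {for x, continuous (quot tau v)}.
Proof.
move=> xr.
have cu y : Om y -> {for y, continuous u} by move=> Omy; apply: differentiable_continuous; exact: du.
apply: (@continuousM _ _ (fun x => u (x + tau *: v) - u x) (cst tau^-1)); last exact: cst_continuous.
apply: continuousB; last exact: cu (sublevel_sub r0rad xr).
apply: (@continuous_comp _ _ _ (fun x => x + tau *: v) u); last exact: cu (moveOm xr wtau).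
exact: continuous_addr_rV.
Qed.

Lemma quot_small x : enorm (x - x0) <= r0 -> `|G x| < k / 4 -> `|quot tau v x| <= k.
Proof.
move=> xr Gx; have h := quot_close xr; have h' := near_basis_le (G x) vi.
have := ler_normD (quot tau v x - dotv v (G x)) (dotv v (G x)); rewrite subrK.
by move: h eta8 k0 h' Gx; move: (eta) => et; lra.
Qed.

Let S := [set x | B x /\ k / 4 <= `|G x|].
Let cS : closed S. Proof. by apply: closed_piece; rewrite divr_gt0. Qed.
Let SB : S `<=` B. Proof. by move=> x []. Qed.
Let notS x : B x -> ~ S x -> `|G x| < k / 4.
Proof. by move=> Bx Sx; rewrite ltNge; apply/negP => h; exact: Sx. Qed.

Lemma Cc_piece (f : 'rV[R]_N -> R) : (forall x, B x -> {for x, continuous f}) ->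
  (forall x, B x -> `|G x| < k / 4 -> f x = 0) -> Cc (f \_ B).
Proof.
move=> cw w0; apply: (@Cc_patch _ _ B S f (r0 + `|x0|)) => //.
  by move=> y By Sy; exact: w0 (notS By Sy).
by move=> x [/Br xr _]; exact: bounded_sublevel.
Qed.

Lemma is_derive_piece (f df : 'rV[R]_N -> R) e : (forall x, B x -> is_derive x e f (df x)) ->
  (forall x, B x -> `|G x| < k / 4 -> f x = 0) ->
  (forall x, B x -> `|G x| < k / 4 -> df x = 0) ->
  forall x, is_derive x e (f \_ B) ((df \_ B) x).
Proof.
move=> hw w0 dw0; apply: (is_derive_patch oB cS SB hw).
- by move=> y By Sy; exact: w0 (notS By Sy).
- by move=> y By Sy; exact: dw0 (notS By Sy).
Qed.

Let dt x := dclip k (quot tau v x).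
(** The length of the difference quotient of the gradient, a substitute for the
    second derivatives in the direction [v]. *)
Definition hess x : R := enorm (G (x + tau *: v) - G x) / tau.

Let dt0 x : B x -> `|G x| < k / 4 -> dt x = 0.
Proof. by move=> Bx Gx; apply: dclip_out => //; left; exact: quot_small (Br Bx) Gx. Qed.

Lemma continuous_G x : B x -> {for x, continuous G}.
Proof. by move=> Bx; exact: (within_closure_continuous cG (BOm Bx)). Qed.

Lemma continuous_Gmove x : B x -> {for x, continuous (fun x => G (x + tau *: v))}.
Proof.
move=> Bx; apply: (@continuous_comp _ _ _ (fun x => x + tau *: v) G); first exact: continuous_addr_rV.
exact: (within_closure_continuous cG (moveOm (Br Bx) wtau)).
Qed.

Let cdt x : B x -> {for x, continuous dt}.
Proof.
move=> Bx; apply: (@continuous_comp _ _ _ (quot tau v) (dclip k)).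
  exact: continuous_quot (Br Bx).
exact: continuous_dclip.
Qed.

Lemma continuous_dquot i x : B x ->
  {for x, continuous (fun x => (G (x + tau *: v) 0 i - G x 0 i) / tau)}.
Proof.
move=> Bx; apply: (@continuousM _ _ (fun x => G (x + tau *: v) 0 i - G x 0 i) (cst tau^-1));
  last exact: cst_continuous.
apply: (@continuousB _ _ _ (fun x => G (x + tau *: v) 0 i) (fun x => G x 0 i)).
  exact: continuous_coord_at (continuous_Gmove Bx).
exact: continuous_coord_at (continuous_G Bx).
Qed.

Lemma continuous_hess x : B x -> {for x, continuous hess}.
Proof.
move=> Bx; apply: (@continuousM _ _ (fun x => enorm (G (x + tau *: v) - G x)) (cst tau^-1));
  last exact: cst_continuous.
apply: (@continuous_comp _ _ _ (fun x => G (x + tau *: v) - G x) (@enorm R N)); last exact: continuous_enorm.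
by apply: continuousB; [exact: continuous_Gmove|exact: continuous_G].
Qed.

Lemma continuous_powG (s : R) x : B x -> {for x, continuous (fun x => enorm (G x) `^ s)}.
Proof.
move=> Bx; apply: continuous_powR_at; first by rewrite enorm_gt0; exact: BG.
by apply: (@continuous_comp _ _ _ G (@enorm R N)); [exact: continuous_G|exact: continuous_enorm].
Qed.

Let energy x := dt x * (enorm (G x) `^ (p - 2) * hess x ^+ 2).

Lemma Cc_energy : Cc (energy \_ B).
Proof.
apply: Cc_piece => x Bx; last by move=> /(dt0 Bx) e; rewrite /energy e mul0r.
apply: (@continuousM _ _ dt (fun x => enorm (G x) `^ (p - 2) * hess x ^+ 2)); first exact: cdt.
apply: (@continuousM _ _ (fun x => enorm (G x) `^ (p - 2)) (fun x => hess x ^+ 2)).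
  exact: continuous_powG.
by apply: (@continuousM _ _ hess hess); exact: continuous_hess.
Qed.

Lemma Cc_dtG : Cc ((fun x => dt x * `|G x|) \_ B).
Proof.
apply: Cc_piece => x Bx; last by move=> /(dt0 Bx) ->; rewrite mul0r.
apply: (@continuousM _ _ dt (fun x => `|G x|)); first exact: cdt.
by apply: (@continuous_comp _ _ _ G (@Num.norm _ 'rV[R]_N)); [exact: continuous_G|exact: norm_continuous].
Qed.

(** Test the differenced equation with [clip k] of the difference quotient of [u],
    which vanishes near the critical points and is therefore localized to [B].
    Its gradient lives where the quotient is of order [k], and coercivity bounds
    the weighted squares of the second differences there. The right-hand side is
    of order [k] because the source is Lipschitz; the last term, where the
    dependence of [a] on the position enters, is controlled by the choice of [v]. *)
Lemma energy_estimate : coercivity p / 2 * intg (energy \_ B) <=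
  2 * LF * vol * k +
  (2 * La) ^+ 2 / (2 * coercivity p) * (L `^ (2 * q - p - 1) * N%:R) *
    intg ((fun x => dt x * `|G x|) \_ B).
Proof.
pose phi := (fun x => clip k (quot tau v x)) \_ B.
pose dphi (i : 'I_N) := (fun x => dt x / k * ((G (x + tau *: v) 0 i - G x 0 i) / tau)) \_ B.
have cphi : Cc phi.
  apply: Cc_piece => x Bx; last by move=> Gx; rewrite clip0//; exact: quot_small (Br Bx) Gx.
  apply: (@continuous_comp _ _ _ (quot tau v) (clip k)); last exact: continuous_clip.
  exact: continuous_quot (Br Bx).
have cdphi i : Cc (dphi i).
  apply: Cc_piece => x Bx; last by move=> /(dt0 Bx) ->; rewrite !mul0r.
  apply: (@continuousM _ _ (fun x => dt x / k) (fun x => (G (x + tau *: v) 0 i - G x 0 i) / tau)).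
    by apply: (@continuousM _ _ dt (cst k^-1)); [exact: cdt|exact: cst_continuous].
  exact: continuous_dquot.
have hd i x : is_derive x (e_ i) phi (dphi i x).
  apply: is_derive_piece => [y By|y By Gy|y By /(dt0 By) ->]; last by rewrite !mul0r.
    apply: (is_derive_eqW (is_derive_comp_dir (is_derive_quot (e_ i) (Br By)) (is_derive_clip k _))).
    by rewrite !dotv_delta.
  by rewrite clip0//; exact: quot_small (Br By) Gy.
have inB (f : 'rV[R]_N -> R) x : (f \_ B) x != 0 -> enorm (x - x0) <= r0.
  by rewrite patchE; case: ifPn => [/set_mem/Br//|_]; rewrite eqxx.
have E := @weak_difference r0 r1 (tau *: v) phi dphi (ltW r01) r1rad
   (fun x xr => (tauP xr wtau).1) cphi.1 (fun i => (cdphi i).1) hd (inB _) (fun i => inB _).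
pose D i x := (fluxc i (x + tau *: v) - fluxc i x) *
  (dt x / k * ((G (x + tau *: v) 0 i - G x 0 i) / tau)).
have cD i : Cc (D i \_ B).
  apply: Cc_piece => x Bx; last by move=> /(dt0 Bx) e; rewrite /D e !mul0r mulr0.
  have Omx := moveOm (Br Bx) wtau.
  apply: (@continuousM _ _ (fun x => fluxc i (x + tau *: v) - fluxc i x)
    (fun x => dt x / k * ((G (x + tau *: v) 0 i - G x 0 i) / tau))).
    apply: (@continuousB _ _ _ (fun x => fluxc i (x + tau *: v)) (fluxc i)); last exact: cflux (BOm Bx).
    apply: (@continuous_comp _ _ _ (fun x => x + tau *: v) (fluxc i)); first exact: continuous_addr_rV.
    exact: cflux.
  apply: near_eq_continuous ((cdphi i).1 x).
  by have := near_patch_in (fun x => dt x / k * ((G (x + tau *: v) 0 i - G x 0 i) / tau)) oB Bx.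
pose H x := (F (x + tau *: v) - F x) * clip k (quot tau v x).
have cH : Cc (H \_ B).
  apply: Cc_piece => x Bx; last by move=> Gx; rewrite /H clip0 ?mulr0//; exact: quot_small (Br Bx) Gx.
  have Omx := moveOm (Br Bx) wtau.
  apply: (@continuousM _ _ (fun x => F (x + tau *: v) - F x) (fun x => clip k (quot tau v x))).
    apply: (@continuousB _ _ _ (fun x => F (x + tau *: v)) F); last exact: cF (BOm Bx).
    apply: (@continuous_comp _ _ _ (fun x => x + tau *: v) F); first exact: continuous_addr_rV.
    exact: cF.
  apply: (@continuous_comp _ _ _ (quot tau v) (clip k)); last exact: continuous_clip.
  exact: continuous_quot (Br Bx).
have {}E : intg (fun x => \sum_i (D i \_ B) x) = intg (H \_ B).
  move: E; rewrite (_ : (fun x => \sum_i _) = fun x => \sum_i (D i \_ B) x); last first.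
    apply/funext => x; apply: eq_bigr => i _; rewrite /dphi ![(_ \_ B) x]patchE.
    case: ifPn => [/set_mem Bx|_]; last by rewrite mulr0.
    by rewrite !patchE !mem_set//; [exact: BOm|exact: moveOm (Br Bx) wtau].
  move=> ->; congr intg; apply/funext => x; rewrite /phi ![(_ \_ B) x]patchE.
  case: ifPn => [/set_mem Bx|_]; last by rewrite mulr0.
  by rewrite !patchE !mem_set//; [exact: BOm|exact: moveOm (Br Bx) wtau].
set C2 := (2 * La) ^+ 2 / _ * _.
have pointwise x : coercivity p / 2 * (energy \_ B) x <=
    k / tau * (\sum_i (D i \_ B) x) + C2 * ((fun x => dt x * `|G x|) \_ B) x.
  have [Bx|Bx] := pselect (B x); last first.
    rewrite !patchE memNset// big1 ?mulr0 ?addr0// => i _.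
    by rewrite patchE memNset.
  under eq_bigr do rewrite patchE mem_set//.
  rewrite !patchE mem_set//.
  have [e|dtx] := eqVneq (dt x) 0.
    rewrite /energy e !mul0r big1 ?mulr0 ?addr0// => i _.
    by rewrite /D e !mul0r mulr0.
  have Gx : k / 4 <= `|G x| by rewrite leNgt; apply: contra dtx => /(dt0 Bx) ->.
  have eG : k / 4 <= enorm (G x) by apply: le_trans (norm_le_enorm _).
  have eG0 : 0 < enorm (G x) by apply: lt_le_trans eG; rewrite divr_gt0.
  have [mv dG] := tauP (Br Bx) wtau.
  have eY : enorm (G (x + tau *: v) - G x) <= enorm (G x) / 2.
    apply: le_trans (enorm_le_norm _) _; apply: (@le_trans _ _ (N%:R * eta)); first by rewrite ler_wpM2l.
    by apply: (le_trans etaN); lra.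
  have Om1 := moveOm (Br Bx) wtau; have Omx := BOm Bx.
  have ah : `|a (x + tau *: v) - a x| <= La * (2 * tau).
    apply: le_trans (aL Om1 Omx) _; rewrite ler_wpM2l//.
    by rewrite addrAC subrr add0r.
  have /andP[a0 _] := aA Om1.
  have := double_phase_coercive hp hpq a0 ah eG0 eY.
  set Y := enorm _ in eY *; set SS := \sum_i _ => h.
  have -> : \sum_i D i x = dt x / (k * tau) * SS.
    rewrite /SS mulr_sumr; apply: eq_bigr => i _; rewrite /D /fluxc.
    set V1 := _ + _ * pfield q _ 0 i; rewrite !mxE.
    by field; rewrite !gt_eqF.
  have dt_ge : 0 <= dt x by have /andP[] := dclip_itv k (quot tau v x).
  have pw : enorm (G x) `^ (2 * q - p) <= L `^ (2 * q - p - 1) * N%:R * `|G x|.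
    have -> : enorm (G x) `^ (2 * q - p) = enorm (G x) `^ (2 * q - p - 1) * enorm (G x).
      have -> : 2 * q - p = (2 * q - p - 1) + 1 by ring.
      by rewrite powRD ?(gt_eqF eG0) ?implybT// powRr1 ?enorm_ge0// addrK.
    rewrite -mulrA ler_pM ?powR_ge0 ?enorm_ge0 ?enorm_le_norm//.
    have s0 : 0 <= 2 * q - p - 1 by move: hp hpq; lra.
    by apply: ge0_ler_powR => //; rewrite ?nnegrE ?enorm_ge0 ?(ltW L0)//; exact: GL.
  have c0 := coercivity_gt0 hp.
  have t2 : 0 <= dt x / tau ^+ 2 by rewrite divr_ge0// sqr_ge0.
  have := ler_wpM2l t2 h.
  have -> : dt x / tau ^+ 2 * (coercivity p / 2 * (enorm (G x) `^ (p - 2) * Y ^+ 2)) =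
      coercivity p / 2 * energy x.
    by rewrite /energy /hess -/Y; field; rewrite gt_eqF.
  have -> : k / tau * (dt x / (k * tau) * SS) = dt x / tau ^+ 2 * SS.
    by field; rewrite !gt_eqF.
  move=> /le_trans; apply; rewrite mulrDr lerD2l.
  have -> : dt x / tau ^+ 2 * ((La * (2 * tau)) ^+ 2 / (2 * coercivity p) * enorm (G x) `^ (2 * q - p)) =
    (2 * La) ^+ 2 / (2 * coercivity p) * dt x * enorm (G x) `^ (2 * q - p).
    by field; rewrite !gt_eqF.
  have -> : C2 * (dt x * `|G x|) = (2 * La) ^+ 2 / (2 * coercivity p) * dt x *
     (L `^ (2 * q - p - 1) * N%:R * `|G x|) by rewrite /C2; ring.
  rewrite ler_wpM2l// mulr_ge0// divr_ge0 ?sqr_ge0//.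
  by rewrite mulr_ge0// ltW.
have cSD : Cc (fun x => \sum_i (D i \_ B) x) by exact: Cc_sum.
have Ce := Cc_energy; have CdtG := Cc_dtG.
rewrite -intgZ//; apply: (@le_trans _ _ (intg (fun x => k / tau * (\sum_i (D i \_ B) x) +
    C2 * ((fun x => dt x * `|G x|) \_ B) x))).
  by apply: le_intg => //; [exact: CcZ|apply: CcD; exact: CcZ].
rewrite intgD; [|exact: CcZ|exact: CcZ].
rewrite !intgZ// E lerD2r.
have Hle : intg (H \_ B) <= LF * (2 * tau) * vol.
  apply: le_trans (ler_norm _) _; apply: intg_norm_le => //.
  - move=> x; rewrite patchE; case: ifPn => [/set_mem Bx|_]; last by rewrite normr0 !mulr_ge0// ltW.
    rewrite /H normrM -[leRHS]mulr1 ler_pM ?clip_le1//.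
    have [mv _] := tauP (Br Bx) wtau.
    apply: le_trans (FL mv (le_trans (Br Bx) (ltW r01))) _; rewrite ler_wpM2l//.
    by rewrite addrAC subrr add0r.
  - move=> x xM; rewrite patchE; case: ifPn => // /set_mem /Br/bounded_sublevel xr.
    by exfalso; have := ler_norm r0; lra.
apply: (@le_trans _ _ (k / tau * (LF * (2 * tau) * vol))).
  by rewrite ler_wpM2l// divr_ge0 ?ltW.
by rewrite le_eqVlt; apply/orP; left; apply/eqP; field; rewrite gt_eqF.
Qed.

Lemma quot_dotv x : B x -> `|quot tau v x| <= 3 * k -> `|dotv v (G x)| <= 4 * k.
Proof.
move=> Bx h.
have := quot_close (Br Bx); have := lerB_dist (dotv v (G x)) (quot tau v x).
rewrite (distrC (dotv _ _)); move: eta8 h k0; move: (eta) => et; lra.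
Qed.

Lemma dclip_quot0 x : B x -> `|G x| < k / 4 -> dclip k (quot tau v x) = 0.
Proof. exact: dt0. Qed.

Lemma Cc_dclip_quot : Cc (dt \_ B).
Proof. by apply: Cc_piece => x Bx; [exact: cdt|exact: dt0]. Qed.

End direction.

(** The test function [phi] is 1 where some difference quotient in the [N] good
    directions exceeds [3 k] and 0 where all are below [k]; it approximates the
    indicator of [B] as [k] tends to 0. *)
Section family.
Variables (v : 'I_N -> 'rV[R]_N) (vP : forall i, near_basis i (v i)).
Variables (chi : 'rV[R]_N -> R) (M : R).
Hypotheses (chi0 : forall x, 0 <= chi x) (chi1 : forall x, B x -> chi x = 1).
Hypothesis good : forall i,
  Cc (fun x => chi x * (tent (dotv (v i) (G x) / (2 * k)) * `|G x|)) /\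
  intg (fun x => chi x * (tent (dotv (v i) (G x) / (2 * k)) * `|G x|)) <= M * k.

Let dt i x := dclip k (quot tau (v i) x).
Let en i x := dt i x * (enorm (G x) `^ (p - 2) * hess (v i) x ^+ 2).

Definition energy_const : R := 2 / coercivity p * (2 * LF * vol +
  (2 * La) ^+ 2 / (2 * coercivity p) * (L `^ (2 * q - p - 1) * N%:R) * M).

Lemma energy_le i : intg (en i \_ B) <= energy_const * k.
Proof.
have c0 := coercivity_gt0 hp.
have h := energy_estimate (vP i).
have h2 : intg ((fun x => dt i x * `|G x|) \_ B) <= M * k.
  have [c1 /(le_trans _)] := good i; apply; apply: le_intg => // [|x]; first exact: Cc_dtG (vP i).
  rewrite patchE; case: ifPn => [/set_mem Bx|_]; last by rewrite !mulr_ge0// tent_ge0.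
  rewrite chi1// mul1r; have [->|dtx] := eqVneq (dt i x) 0.
    by rewrite mul0r mulr_ge0// tent_ge0.
  rewrite tent_eq1; last first.
    have k20 : 0 < 2 * k by rewrite mulr_gt0.
    rewrite normrM normfV (gtr0_norm k20) ler_pdivrMr//.
    have q3 : `|quot tau (v i) x| <= 3 * k.
      by rewrite leNgt; apply: contra dtx => /ltW h3; apply/eqP; apply: dclip_out => //; right.
    by have := quot_dotv (vP i) Bx q3; move: k0; lra.
  by rewrite ler_wpM2r//; have /andP[] := dclip_itv k (quot tau (v i) x).
rewrite /energy_const -/(en i) in h *.
have K0 : 0 <= (2 * La) ^+ 2 / (2 * coercivity p) * (L `^ (2 * q - p - 1) * N%:R).
  apply: mulr_ge0; last by rewrite mulr_ge0 ?powR_ge0.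
  exact: divr_ge0 (sqr_ge0 _) (mulr_ge0 (ler0n _ 2) (ltW c0)).
have h3 := le_trans h (lerD (lexx _) (ler_wpM2l K0 h2)).
rewrite -(ler_pM2l (divr_gt0 c0 (ltr0Sn R 1))); apply: (le_trans h3).
by rewrite le_eqVlt; apply/orP; left; apply/eqP; field; rewrite gt_eqF.
Qed.

Let T x := \sum_i cutoff k (quot tau (v i) x).
Let dT (l : 'I_N) x := \sum_i dcutoff k (quot tau (v i) x) / k * ((G (x + tau *: v i) 0 l - G x 0 l) / tau).

Let T0 x : B x -> `|G x| < k / 4 -> T x = 0.
Proof. by move=> Bx Gx; rewrite /T big1// => i _; apply: cutoff0 => //; exact: quot_small (Br Bx) Gx. Qed.

Let dT0 l x : B x -> `|G x| < k / 4 -> dT l x = 0.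
Proof.
move=> Bx Gx; rewrite /dT big1// => i _.
suff -> : dcutoff k (quot tau (v i) x) = 0 by rewrite !mul0r.
apply/eqP; rewrite -normr_le0 (le_trans (dcutoff_le _ _))//.
by rewrite dclip_out//; left; exact: quot_small (Br Bx) Gx.
Qed.

Let cT x : B x -> {for x, continuous T}.
Proof.
move=> Bx; apply: (@continuous_sum_at _ _ _ _ (fun i x => cutoff k (quot tau (v i) x))) => i.
apply: (@continuous_comp _ _ _ (quot tau (v i)) (cutoff k)); last exact: continuous_cutoff.
exact: continuous_quot (vP i) _ (Br Bx).
Qed.

Let cdT l x : B x -> {for x, continuous (dT l)}.
Proof.
move=> Bx; apply: (@continuous_sum_at _ _ _ _ (fun i x =>
  dcutoff k (quot tau (v i) x) / k * ((G (x + tau *: v i) 0 l - G x 0 l) / tau))) => i.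
apply: (@continuousM _ _ (fun x => dcutoff k (quot tau (v i) x) / k)
  (fun x => (G (x + tau *: v i) 0 l - G x 0 l) / tau)).
  apply: (@continuousM _ _ (fun x => dcutoff k (quot tau (v i) x)) (cst k^-1)); last exact: cst_continuous.
  apply: (@continuous_comp _ _ _ (quot tau (v i)) (dcutoff k)); last exact: continuous_dcutoff.
  exact: continuous_quot (vP i) _ (Br Bx).
exact: continuous_dquot.
Qed.

Let phi := (fun x => ramp (2 * T x)) \_ B.
Let dphi l := (fun x => hat (2 * T x) * (2 * dT l x)) \_ B.

Let c2T x : B x -> {for x, continuous (fun x => 2 * T x)}.
Proof.
by move=> Bx; apply: (@continuousM _ _ (cst 2) T); [exact: cst_continuous|exact: cT].
Qed.

Let cphi : Cc phi.
Proof.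
apply: Cc_piece => x Bx; last by move=> Gx; rewrite T0// mulr0 ramp0.
apply: (@continuous_comp _ _ _ (fun x => 2 * T x) (@ramp R)); first exact: c2T.
exact: continuous_ramp.
Qed.

Let cdphi l : Cc (dphi l).
Proof.
apply: Cc_piece => x Bx; last by move=> Gx; rewrite dT0// !mulr0.
apply: (@continuousM _ _ (fun x => hat (2 * T x)) (fun x => 2 * dT l x)).
  apply: (@continuous_comp _ _ _ (fun x => 2 * T x) (@hat R)); first exact: c2T.
  exact: continuous_hat.
by apply: (@continuousM _ _ (cst 2) (dT l)); [exact: cst_continuous|exact: cdT].
Qed.

Let dphiP l x : is_derive x (e_ l) phi (dphi l x).
Proof.
apply: is_derive_piece => [y By|y By Gy|y By Gy].
- have dTy : is_derive y (e_ l) T (dT l y).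
    have h := @is_derive_sum _ _ _ N (fun i x => cutoff k (quot tau (v i) x)) y (e_ l) _
      (fun i => is_derive_comp_dir (is_derive_quot (vP i) (e_ l) (Br By)) (is_derive_cutoff k _)).
    rewrite fct_sumE in h; apply: (is_derive_eqW h); apply: eq_bigr => i _.
    by rewrite !dotv_delta.
  have d2 := is_deriveZ 2 dTy.
  exact: (is_derive_comp_dir d2 (is_derive_ramp _)).
- by rewrite T0// mulr0 ramp0.
- by rewrite dT0// !mulr0.
Qed.

(** The weak equation for the approximate indicator of [B]. *)
Lemma flux_balance :
  intg (fun x => \sum_l (fluxc l \_ Om) x * dphi l x) = intg (fun x => (F \_ Om) x * phi x).
Proof.
have inB (f : 'rV[R]_N -> R) x : (f \_ B) x != 0 -> enorm (x - x0) <= r0.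
  by rewrite patchE; case: ifPn => [/set_mem/Br//|_]; rewrite eqxx.
by apply: (weak1 r0rad cphi.1 (fun l => (cdphi l).1)); [exact: dphiP|exact: inB|move=> l; exact: inB].
Qed.

Let CF : R := 1 + Am * L `^ (q - p).

Definition source_const : R := 4 * (8 * N%:R) `^ (p - 1) * (8 * N%:R * CF) ^+ 2.

Let CF0 x : B x -> 0 <= CF.
Proof.
move=> /BOm/aA/andP[a0 aAm]; rewrite addr_ge0// mulr_ge0 ?powR_ge0//.
exact: le_trans aAm.
Qed.

Let dt_itv i x : 0 <= dt i x <= 1.
Proof. exact: dclip_itv. Qed.

(** On the support of the gradient of [phi] all quotients are at most [3 k], hence
    [|G|] is of order [k] and the flux of order [k^(p-1)]. Young's inequality with a
    weight [m] separates the energy from a multiple of [k^(p-2)]. *)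
Let flux_term (m : R) i x : 0 < m -> B x ->
  hat (2 * T x) * (2 * (dcutoff k (quot tau (v i) x) / k *
    ((\sum_l fluxc l x * (G (x + tau *: v i) - G x) 0 l) / tau))) <=
  m * en i x + source_const / m * (k `^ (p - 1) / k) * dt i x.
Proof.
move=> m0 Bx; have /andP[d0 d1] := dt_itv i x.
have /andP[h0 h1] := hat_itv (2 * T x).
have D0 : 0 <= source_const by apply: mulr_ge0 (sqr_ge0 _); rewrite mulr_ge0// powR_ge0.
have R0 : 0 <= m * en i x + source_const / m * (k `^ (p - 1) / k) * dt i x.
  apply: addr_ge0.
    exact: mulr_ge0 (ltW m0) (mulr_ge0 d0 (mulr_ge0 (powR_ge0 _ _) (sqr_ge0 _))).
  by apply: mulr_ge0 => //; rewrite mulr_ge0// divr_ge0 ?powR_ge0 ?(ltW m0) ?(ltW k0).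
have [->|hne] := eqVneq (hat (2 * T x)) 0; first by rewrite mul0r.
have [dte|dtne] := eqVneq (dt i x) 0.
  suff -> : dcutoff k (quot tau (v i) x) = 0 by rewrite !mul0r mulr0 mulr0.
  by apply/eqP; rewrite -normr_le0 -dte; exact: dcutoff_le.
have T1 : T x < 1.
  rewrite ltNge; apply: contra hne => T1; apply/eqP; apply: hat_out; right; lra.
have q3 j : `|quot tau (v j) x| <= 3 * k.
  rewrite leNgt; apply/negP => /ltW q3; move: T1; rewrite ltNge => /negP; apply.
  rewrite /T (bigD1 j)//= cutoff1// lerDl; apply: sumr_ge0 => l _.
  by have /andP[] := cutoff_itv k (quot tau (v l) x).
have k40 : 0 <= 4 * k by rewrite mulr_ge0// ltW.
have G8 := near_basis_coercive k40 vP (fun j => quot_dotv (vP j) Bx (q3 j)).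
have eL : enorm (G x) <= 8 * N%:R * k.
  apply: le_trans (enorm_le_norm _) _; rewrite [leRHS](_ : _ = N%:R * (2 * (4 * k))); last by ring.
  by rewrite ler_wpM2l.
have Gk : k / 4 <= enorm (G x).
  apply: le_trans (norm_le_enorm _); rewrite leNgt; apply: contra dtne => Gk.
  by rewrite /dt (dclip_quot0 (vP i)).
set e := enorm (G x) in eL Gk *.
have e0 : 0 < e by apply: lt_le_trans Gk; rewrite divr_gt0.
set V := pfield p (G x) + a x *: pfield q (G x).
set Y := G (x + tau *: v i) - G x.
have VY : `|\sum_l fluxc l x * Y 0 l| <= CF * e `^ (p - 1) * enorm Y.
  rewrite (_ : \sum_l _ = dotv V Y); last first.
    apply: eq_bigr => l _; congr (_ * _); rewrite /V /fluxc.
    by move: (pfield p _) (pfield q _) => f1 f2; rewrite !mxE.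
  apply: le_trans (dotv_norm_le _ _) _; rewrite ler_wpM2r ?enorm_ge0//.
  exact: double_phase_le hp hpq (aA (BOm Bx)) (GL (BOm Bx)).
set P := e `^ (p - 2).
have P0 : 0 < P by exact: powR_gt0.
have eP : e `^ (p - 1) = P * e.
  have -> : p - 1 = (p - 2) + 1 by ring.
  by rewrite powRD ?(gt_eqF e0) ?implybT// powRr1 ?ltW.
have Ple : P <= 4 * (8 * N%:R) `^ (p - 1) * (k `^ (p - 1) / k).
  have Ee : P = e `^ (p - 1) * e^-1 by rewrite eP mulfK// gt_eqF.
  have e1 : e^-1 <= 4 / k.
    by rewrite -[4]invrK -invfM mulrC lef_pV2 ?posrE// divr_gt0.
  rewrite Ee; apply: (@le_trans _ _ ((8 * N%:R * k) `^ (p - 1) * (4 / k))).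
    rewrite ler_pM ?powR_ge0 ?invr_ge0 ?(ltW e0)//.
    apply: ge0_ler_powR => //; rewrite ?nnegrE ?(ltW e0) ?mulr_ge0 ?(ltW k0)//.
    by rewrite subr_ge0 ltW.
  by rewrite powRM ?mulr_ge0 ?(ltW k0)// le_eqVlt; apply/orP; left; apply/eqP; ring.
set h := hess (v i) x.
have hE : enorm Y = h * tau by rewrite /h /hess mulfVK ?gt_eqF.
have hh0 : 0 <= h by rewrite divr_ge0 ?enorm_ge0 ?(ltW tau0).
have CFB := CF0 Bx.
have step1 : hat (2 * T x) * (2 * (dcutoff k (quot tau (v i) x) / k *
    ((\sum_l fluxc l x * Y 0 l) / tau))) <= dt i x * (2 * CF / k * (P * e) * h).
  apply: le_trans (ler_norm _) _; rewrite normrM (ger0_norm h0) -[leRHS]mul1r.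
  rewrite ler_pM// !normrM !normfV (gtr0_norm k0) (gtr0_norm tau0) (ger0_norm (ler0n _ 2)).
  have -> : dt i x * (2 * CF / k * (P * e) * h) = 2 * (dt i x / k * (CF * (P * e) * h)) by ring.
  rewrite ler_pM2l// ler_pM ?divr_ge0 ?normr_ge0 ?(ltW k0) ?(ltW tau0)//.
    by rewrite ler_pM2r ?invr_gt0//; exact: dcutoff_le.
  by move: VY; rewrite eP hE mulrA -ler_pdivrMr.
apply: (le_trans step1).
have -> : m * en i x + source_const / m * (k `^ (p - 1) / k) * dt i x =
  dt i x * (m * (P * h ^+ 2) + source_const / m * (k `^ (p - 1) / k)).
  by rewrite /en -/e -/P -/h; ring.
rewrite ler_wpM2l//.
have young : 2 * CF / k * (P * e) * h <= m * (P * h ^+ 2) + (CF * (e / k)) ^+ 2 / m * P.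
  rewrite -subr_ge0.
  have -> : m * (P * h ^+ 2) + (CF * (e / k)) ^+ 2 / m * P - 2 * CF / k * (P * e) * h =
     (m * h - CF * (e / k)) ^+ 2 / m * P by field; rewrite !gt_eqF.
  by rewrite mulr_ge0 ?(ltW P0)// divr_ge0 ?sqr_ge0 ?ltW.
apply: (le_trans young); rewrite lerD2l.
have ek : (CF * (e / k)) ^+ 2 <= (8 * N%:R * CF) ^+ 2.
  rewrite ler_pXn2r ?nnegrE//; [|exact: mulr_ge0 CFB (divr_ge0 (ltW e0) (ltW k0))|by rewrite mulr_ge0].
  by rewrite mulrC ler_wpM2r// ler_pdivrMr.
apply: (@le_trans _ _ ((8 * N%:R * CF) ^+ 2 / m * (4 * (8 * N%:R) `^ (p - 1) * (k `^ (p - 1) / k)))).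
  apply: ler_pM => //; last by rewrite ler_pM2r ?invr_gt0.
  - by rewrite divr_ge0 ?sqr_ge0 ?ltW.
  - exact: ltW.
by rewrite /source_const le_eqVlt; apply/orP; left; apply/eqP; ring.
Qed.

Let inB (f : 'rV[R]_N -> R) x : (f \_ B) x != 0 -> enorm (x - x0) <= r0.
Proof. by rewrite patchE; case: ifPn => [/set_mem/Br//|_]; rewrite eqxx. Qed.

Let flux_le (m : R) : 0 < m ->
  intg (fun x => \sum_l (fluxc l \_ Om) x * dphi l x) <=
  N%:R * (m * (energy_const * k) + source_const / m * (k `^ (p - 1) / k) * vol).
Proof.
move=> m0; set D := source_const / m * _.
have Cen i : Cc (en i \_ B) := Cc_energy (vP i).
have Cdt i : Cc (dt i \_ B) := Cc_dclip_quot (vP i).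
pose W i x := m * (en i \_ B) x + D * (dt i \_ B) x.
have CW i : Cc (W i) by apply: CcD; exact: CcZ.
have D0 : 0 <= D.
  have S0 : 0 <= source_const by apply: mulr_ge0 (sqr_ge0 _); rewrite mulr_ge0// powR_ge0.
  by rewrite /D mulr_ge0// divr_ge0 ?powR_ge0 ?(ltW m0) ?(ltW k0).
apply: (@le_trans _ _ (intg (fun x => \sum_i W i x))).
  apply: le_intg; [|exact: Cc_sum|].
    apply: Cc_sum => l; apply: (Cc_patchM r0rad) => [x Omx||x]; [exact: cflux|exact: (cdphi l).1|exact: inB].
  move=> x; have [Bx|nBx] := pselect (B x); last first.
    rewrite !big1// => i _; first by rewrite /W !patchE memNset// !mulr0 addr0.
    by rewrite /dphi [X in _ * X]patchE memNset// mulr0.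
  rewrite (eq_bigr (fun l => \sum_i hat (2 * T x) * (2 * (dcutoff k (quot tau (v i) x) / k *
    ((fluxc l x * (G (x + tau *: v i) - G x) 0 l) / tau))))); last first.
    move=> l _; rewrite /dphi !patchE !mem_set//; last exact: BOm.
    by rewrite /dT !mulr_sumr; apply: eq_bigr => i _; rewrite !mxE; ring.
  rewrite exchange_big /=; apply: ler_sum => i _.
  rewrite /W !patchE !mem_set//; apply: le_trans (flux_term i m0 Bx).
  by rewrite mulr_suml !mulr_sumr.
rewrite intg_sum//; apply: (@le_trans _ _ (\sum_(i < N) (m * (energy_const * k) + D * vol))); last first.
  by rewrite sumr_const card_ord mulr_natl.
apply: ler_sum => i _; rewrite intgD ?intgZ//; [|exact: CcZ|exact: CcZ].
apply: lerD; rewrite ler_wpM2l ?(ltW m0) ?energy_le//.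
apply: le_trans (ler_norm _) _; rewrite -[vol]mul1r; apply: intg_norm_le => //.
- move=> x; rewrite patchE; case: ifPn => [/set_mem Bx|_]; last by rewrite normr0.
  by have /andP[d0 d1] := dt_itv i x; rewrite ger0_norm.
- move=> x xM; rewrite patchE; case: ifPn => // /set_mem /Br/bounded_sublevel xr.
  by exfalso; have := ler_norm r0; lra.
Qed.

(** With [m = k^((p-3)/2)] both parts of [flux_term] become of order
    [k^((p-1)/2)], while the source integrates to at least a fixed amount. *)
Lemma source_le (c0 rho : R) x1 : 0 < c0 -> 0 < rho -> (forall x, B x -> c0 <= F x) ->
  (forall y, `|x1 - y| < rho -> B y /\ 8 * k < `|G y|) ->
  c0 * (2 * rho) ^+ N <=
  N%:R * (energy_const + source_const * vol) * Num.sqrt (k `^ (p - 1)).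
Proof.
move=> c00 rho0 Fc ballB; set s := Num.sqrt _.
have s0 : 0 < s by rewrite sqrtr_gt0 powR_gt0.
have ss : k `^ (p - 1) = s * s by rewrite -expr2 sqr_sqrtr// powR_ge0.
have := flux_le (divr_gt0 s0 k0); rewrite flux_balance.
have -> : N%:R * (s / k * (energy_const * k) + source_const / (s / k) * (k `^ (p - 1) / k) * vol) =
  N%:R * (energy_const + source_const * vol) * s.
  by rewrite ss; field; rewrite !gt_eqF.
apply: le_trans; apply: le_intg_ball.
- by apply: (Cc_patchM r0rad) => // [|x]; [exact: cphi.1|exact: inB].
- exact: rho0.
- move=> y; rewrite /phi; have [By|nBy] := pselect (B y); last first.
    by rewrite [X in _ * X]patchE memNset// mulr0.
  rewrite !patchE !mem_set//; last exact: BOm.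
  have /andP[r0' _] := ramp_itv (2 * T y).
  by rewrite mulr_ge0// (le_trans (ltW c00))// Fc.
- move=> y /ballB[By G8]; rewrite /phi !patchE !mem_set//; last exact: BOm.
  suff T1 : 1 <= T y.
    by rewrite ramp1 ?mulr1 ?Fc//; lra.
  have [j qj] : exists j, 3 * k <= `|quot tau (v j) y|.
    apply: contrapT => nj; have k40 : 0 <= 4 * k by rewrite mulr_ge0// ltW.
    have h j : `|dotv (v j) (G y)| <= 4 * k.
      apply: (quot_dotv (vP j) By); rewrite leNgt; apply/negP => /ltW qj.
      by apply: nj; exists j.
    by have := near_basis_coercive k40 vP h; move: G8; lra.
  rewrite /T (bigD1 j)//= cutoff1// lerDl; apply: sumr_ge0 => l _.
  by have /andP[] := cutoff_itv k (quot tau (v l) y).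
Qed.

End family.
End scale.
(** Let [k] tend to 0 in [source_le]. The step [tau] of the difference quotients
    is chosen after [k], by uniform continuity of the gradient. *)
Lemma no_interior_piece (c0 : R) x1 : 0 < c0 -> (forall x, B x -> c0 <= F x) -> ~ B x1.
Proof.
move=> c00 Fc Bx1.
have [chi [cchi chi_itv chi1 chi_supp]] := @ball_cutoff R N x0 _ _ r01.
have Cchi : Cc chi by exact: Cc_ball chi_supp.
have chi0 x : 0 <= chi x by have /andP[] := chi_itv x.
have chiB x : B x -> chi x = 1 by move=> /Br; exact: chi1.
pose M : R := (32 * N%:R + L) * 2 * intg chi.
pose C : R := N%:R * (energy_const M + source_const * vol).
have g0 : 0 < `|G x1| by rewrite normr_gt0; exact: BG.
have [rho rho0 hrho] : exists2 rho : R, 0 < rho & forall y, `|x1 - y| < rho -> B y /\ `|G x1| / 2 < `|G y|.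
  have /continuousP_eps/(_ (`|G x1| / 2)) := continuous_G Bx1.
  rewrite divr_gt0// => /(_ isT)[d d0 hd].
  have /nbhs_ballP[d' /= d'0 hd'] := open_nbhs_nbhs (conj oB Bx1).
  exists (Num.min d d'); first by rewrite lt_min d0.
  move=> y; rewrite lt_min => /andP[xy xy']; split; first by apply: hd'; rewrite -ball_normE.
  have := hd _ xy; have := lerB_dist (G x1) (G y); lra.
pose A : R := c0 * (2 * rho) ^+ N.
have A0 : 0 < A by rewrite mulr_gt0// exprn_gt0// mulr_gt0.
pose t : R := A / (2 * (`|C| + 1)).
have C1 : 0 < 2 * (`|C| + 1) by rewrite mulr_gt0// ltr_wpDl.
have t0 : 0 < t by rewrite divr_gt0.
(* The first bound makes the gradient exceed [8 k] near [x1], the second makes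
   the bound of [source_le] smaller than [A]. *)
pose k : R := Num.min (`|G x1| / 32) ((t ^+ 2) `^ ((p - 1)^-1)).
have k0 : 0 < k by rewrite lt_min divr_gt0//= powR_gt0// exprn_gt0.
have kG : k <= `|G x1| / 32 by rewrite ge_min lexx.
have p10 : 0 < p - 1 by rewrite subr_gt0.
have kt : k `^ (p - 1) <= t ^+ 2.
  apply: (@le_trans _ _ (((t ^+ 2) `^ ((p - 1)^-1)) `^ (p - 1))).
    apply: ge0_ler_powR; rewrite ?nnegrE ?powR_ge0 ?(ltW k0) ?(ltW p10)//.
    by rewrite ge_min lexx orbT.
  by rewrite -powRrM mulVf ?gt_eqF// powRr1// sqr_ge0.
have sk : Num.sqrt (k `^ (p - 1)) <= t.
  by rewrite -[leRHS](ger0_norm (ltW t0)) -sqrtr_sqr ler_wsqrtr.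
have CA : C * Num.sqrt (k `^ (p - 1)) < A.
  apply: le_lt_trans (ler_norm _) _; rewrite normrM (ger0_norm (sqrtr_ge0 _)).
  apply: (@le_lt_trans _ _ (`|C| * t)); first by rewrite ler_wpM2l.
  rewrite /t mulrA ltr_pdivrMr// mulrC ltr_pM2l//.
  by have := normr_ge0 C; lra.
have N1 : 0 < N%:R + 1 :> R by rewrite ltr_wpDl.
have eta0 : 0 < k / (8 * (N%:R + 1)) by rewrite divr_gt0// mulr_gt0.
have [d d0 hd] := within_unif_continuous (@compact_closure_eball _ _ x0 rad) cG eta0.
pose tau : R := Num.min (d / 4) ((r1 - r0) / (2 * (N%:R + 1))).
have N2 : 0 < 2 * (N%:R + 1) :> R by rewrite mulr_gt0.
have tau0 : 0 < tau by rewrite lt_min !divr_gt0// subr_gt0.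
have tauP x w : enorm (x - x0) <= r0 -> `|w| <= 2 * tau ->
    enorm (x + w - x0) <= r1 /\ `|G (x + w) - G x| <= k / (8 * (N%:R + 1)).
  move=> xr wt; have wr : enorm (x + w - x0) <= r1.
    rewrite addrAC; apply: le_trans (ler_enormD _ _) _.
    have : tau * (2 * (N%:R + 1)) <= r1 - r0 by rewrite -ler_pdivlMr// ge_min lexx orbT.
    have := enorm_le_norm w; have : N%:R * `|w| <= N%:R * (2 * tau) by rewrite ler_wpM2l.
    by move: tau0 xr; move: (tau) => ta; lra.
  split => //; apply: ltW; apply: hd.
  - by apply: subset_closure; exact: sublevel_sub wr.
  - by apply: subset_closure; exact: sublevel_sub xr.
  - rewrite addrAC subrr add0r; apply: (le_lt_trans wt).
    by have : tau <= d / 4 by [rewrite ge_min lexx]; move: d0; lra.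
have k20 : 0 < 2 * k by rewrite mulr_gt0.
have Ctent v : Cc (fun x => chi x * (tent (dotv v (G x) / (2 * k)) * `|G x|)).
  have h : Cc ((fun x => chi x * (tent (dotv v (G x) / (2 * k)) * `|G x|)) \_ Om).
    apply: (@Cc_patch_ball _ _ _ _ _ r1) => // x; last first.
      by rewrite mulf_eq0 negb_or => /andP[/chi_supp].
    move=> Omx; have cGx := within_closure_continuous cG Omx.
    apply: (@continuousM _ _ chi (fun x => tent (dotv v (G x) / (2 * k)) * `|G x|)); first exact: cchi.
    apply: (@continuousM _ _ (fun x => tent (dotv v (G x) / (2 * k))) (fun x => `|G x|)).
      apply: (@continuous_comp _ _ _ (fun x => dotv v (G x) / (2 * k)) (@tent R)); last exact: continuous_tent.
      apply: (@continuousM _ _ (fun x => dotv v (G x)) (cst (2 * k)^-1)); last exact: cst_continuous.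
      apply: (@continuous_sum_at _ _ _ _ (fun i x => v 0 i * G x 0 i)) => i.
      apply: (@continuousM _ _ (cst (v 0 i)) (fun x => G x 0 i)); first exact: cst_continuous.
      exact: continuous_coord_at.
    by apply: (@continuous_comp _ _ _ G (@Num.norm _ 'rV[R]_N)) => //; exact: norm_continuous.
  congr Cc: h; apply/funext => x; rewrite patchE; case: ifPn => // xOm.
  suff -> : chi x = 0 by rewrite mul0r.
  by apply/eqP; apply: contraNT xOm => /chi_supp xr; apply/mem_set; exact: sublevel_sub xr.
have chiL x : chi x != 0 -> `|G x| <= L.
  by move=> /chi_supp xr; apply: le_trans (norm_le_enorm _) (GL _); exact: sublevel_sub xr.
have [v hv] : exists v : 'I_N -> 'rV[R]_N, forall i, near_basis i (v i) /\
    intg (fun x => chi x * (tent (dotv (v i) (G x) / (2 * k)) * `|G x|)) <= M * k.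
  have := fun i => good_direction i k20 Cchi chi0 chiL Ctent.
  move=> /choice[v hv]; exists v => i; have [h1 h2] := hv i; split => //.
  by apply: (le_trans h2); rewrite /M le_eqVlt; apply/orP; left; apply/eqP; ring.
have ballB y : `|x1 - y| < rho -> B y /\ 8 * k < `|G y|.
  by move=> /hrho[By h]; split => //; move: h kG g0; lra.
have := @source_le k tau k0 tau0 tauP v (fun i => (hv i).1) chi M chi0 chiB
  (fun i => conj (Ctent (v i)) (hv i).2) c0 rho x1 c00 rho0 Fc ballB.
by rewrite leNgt => /negP; apply; exact: CA.
Qed.

End piece.
End interior_pieces.

(** * No critical points near the boundary *)

Section boundary.
Variables (R : realType) (N : nat) (x0 : 'rV[R]_N) (rad p q : R).
Variables (u a F : 'rV[R]_N -> R) (G Ga : 'rV[R]_N -> 'rV[R]_N).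
Local Notation Om := (eball x0 rad).
Local Notation e_ i := (delta_mx 0 i : 'rV[R]_N).
Implicit Types (x y v w z : 'rV[R]_N) (r s : R).

Section paraboloid.
Variable c : R.
Let Z x : 'rV[R]_N := c *: (x - x0).

Let is_derive_Z i j x : is_derive x (e_ i) (fun x => Z x 0 j) (c * (i == j)%:R).
Proof.
have h := is_deriveZ c (is_deriveB (is_derive_coord i j x) (is_derive_cst (x0 0 j) x (e_ i))).
rewrite (_ : (fun x => _) = (c \*: ((fun y : 'rV[R]_N => y 0 j) - cst (x0 0 j)))); last first.
  by apply/funext => y; rewrite /Z !mxE.
by apply: (is_derive_eqW h); rewrite subr0.
Qed.

Let powR_enorm z s : enorm z `^ s = dotv z z `^ (s / 2).
Proof. by rewrite /enorm -powR12_sqrt ?dotv_ge0// -powRrM mulrC. Qed.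

(** The derivative in the [i]-th direction of the [i]-th component of [pfield s]
    along the affine field [Z], the gradient of a paraboloid. *)
Definition dpfield s (i : 'I_N) x : R :=
  c * (enorm (Z x) `^ (s - 2) + (s - 2) * enorm (Z x) `^ (s - 4) * Z x 0 i ^+ 2).

Lemma is_derive_dotv_scale i x :
  is_derive x (e_ i) (fun x => dotv (Z x) (Z x)) (2 * c * Z x 0 i).
Proof.
have h := @is_derive_sum _ _ _ N (fun j x => Z x 0 j * Z x 0 j) x (e_ i) _
  (fun j => is_deriveM (is_derive_Z i j x) (is_derive_Z i j x)).
rewrite fct_sumE in h; apply: (is_derive_eqW h).
rewrite (bigD1 i)//= big1 => [|j /negbTE ji]; first by rewrite eqxx addr0 /GRing.scale /=; ring.
by rewrite eq_sym ji mulr0 scaler0 addr0.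
Qed.

Lemma is_derive_pfield s i x : Z x != 0 ->
  is_derive x (e_ i) (fun x => pfield s (Z x) 0 i) (dpfield s i x).
Proof.
move=> z0.
have dQ := is_derive_dotv_scale i x.
have Q0 : 0 < dotv (Z x) (Z x) by rewrite -sqr_enorm exprn_gt0// enorm_gt0.
have dP := is_derive_comp_dir dQ (is_derive1_powR ((s - 2) / 2) Q0).
have h := is_deriveM dP (is_derive_Z i i x).
rewrite (_ : (fun x => pfield _ _ _ _) =
  ((fun t => t `^ ((s - 2) / 2)) \o (fun x => dotv (Z x) (Z x))) * (fun x => Z x 0 i)); last first.
  by apply/funext => y; rewrite /pfield mxE powR_enorm.
apply: (is_derive_eqW h); rewrite eqxx /dpfield !powR_enorm /GRing.scale /=.
have -> : (s - 4) / 2 = (s - 2) / 2 - 1 by field.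
by field.
Qed.

(** Where [|x - x0| >= b], one has [|c| <= |Z| / b]: the divergence has the same
    order as the field itself. *)
Lemma dpfield_le s i x (b : R) : 1 < s -> 0 < b -> b * `|c| <= enorm (Z x) ->
  `|dpfield s i x| <= (1 + `|s - 2|) / b * enorm (Z x) `^ (s - 1).
Proof.
move=> s1 b0 hz; have [c0|c0] := eqVneq c 0.
  by rewrite /dpfield c0 mul0r normr0 mulr_ge0 ?powR_ge0 ?divr_ge0 ?(ltW b0)// addr_ge0.
have z0 : 0 < enorm (Z x) by apply: lt_le_trans hz; rewrite mulr_gt0// normr_gt0.
have pE : enorm (Z x) `^ (s - 4) * enorm (Z x) ^+ 2 = enorm (Z x) `^ (s - 2).
  rewrite -powR_mulrn ?enorm_ge0// -powRD; last by rewrite (gt_eqF z0) implybT.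
  by congr (_ `^ _); ring.
rewrite /dpfield normrM.
have zi : Z x 0 i ^+ 2 <= enorm (Z x) ^+ 2.
  rewrite -[_ ^+ 2 in leLHS]ger0_norm ?sqr_ge0// normrX ler_pXn2r ?nnegrE ?enorm_ge0//.
  exact: le_trans (le_coord_norm _ _) (norm_le_enorm _).
set P := enorm (Z x) `^ (s - 2).
have h : `|P + (s - 2) * enorm (Z x) `^ (s - 4) * Z x 0 i ^+ 2| <= (1 + `|s - 2|) * P.
  apply: le_trans (ler_normD _ _) _; rewrite (ger0_norm (powR_ge0 _ _)) [leRHS]mulrDl mul1r lerD2l.
  rewrite -mulrA normrM ler_wpM2l// (ger0_norm (mulr_ge0 (powR_ge0 _ _) (sqr_ge0 _))).
  by rewrite /P -pE ler_wpM2l ?powR_ge0.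
apply: le_trans (ler_wpM2l (normr_ge0 c) h) _.
rewrite -mulr_powRB2 ?enorm_ge0// -/P.
rewrite (_ : _ / b * _ = (1 + `|s - 2|) * P * (enorm (Z x) / b)); last by ring.
rewrite mulrC ler_wpM2l//; first by rewrite mulr_ge0 ?powR_ge0// addr_ge0.
by rewrite ler_pdivlMr// mulrC.
Qed.

End paraboloid.
Hypotheses (hp : 1 < p) (hpq : p <= q) (rad0 : 0 < rad).
Hypothesis cG : {within closure Om, continuous G}.
Hypothesis du : forall x, Om x -> differentiable u x.
Hypothesis Gu : forall x, Om x -> G x = grad u x.
Hypothesis ca : {within closure Om, continuous a}.
Hypothesis cGa : {within closure Om, continuous Ga}.
Hypothesis da : forall x, Om x -> differentiable a x.
Hypothesis Gau : forall x, Om x -> Ga x = grad a x.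
Hypothesis cF : forall x, Om x -> {for x, continuous F}.
Hypothesis weak : forall phi, test_fun Om phi ->
  \int[lebesgue_rV R N]_(x in Om) dotv (flux p q a u x) (grad phi x) =
  \int[lebesgue_rV R N]_(x in Om) (F x * phi x).
Hypothesis upos : forall x, Om x -> 0 < u x.
Variables (Am La c1 : R).
Hypothesis aA : forall x, Om x -> 0 <= a x <= Am.
Hypothesis GaL : forall x, Om x -> `|Ga x| <= La.
Hypotheses (c10 : 0 < c1) (Fc : forall x, Om x -> c1 <= F x).
Local Notation fluxc := (fluxc p q a G).

Let q1 : 1 < q. Proof. exact: lt_le_trans hpq. Qed.
Let cu x : Om x -> {for x, continuous u}.
Proof. by move=> Omx; apply: differentiable_continuous; exact: du. Qed.

Section comparison.
Variables (eps kap : R).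
Hypotheses (eps0 : 0 < eps) (kap0 : 0 < kap).
Let c : R := - (2 * eps).
Let Z x : 'rV[R]_N := c *: (x - x0).

(** The barrier, in the form whose gradient is visibly [Z]. *)
Definition paraboloid x : R := eps * rad ^+ 2 - (4 * eps)^-1 * dotv (Z x) (Z x).

Lemma paraboloidE x : paraboloid x = eps * (rad ^+ 2 - enorm (x - x0) ^+ 2).
Proof. by rewrite /paraboloid dotvZl dotvZr -sqr_enorm /c; field; rewrite gt_eqF. Qed.

Definition barrier_const : R :=
  (1 + `|p - 2|) / (rad / 2) + (La + Am * ((1 + `|q - 2|) / (rad / 2))).

Hypothesis below : forall x, enorm (x - x0) <= 3 / 4 * rad -> paraboloid x <= u x.
Hypothesis eps1 : 2 * eps * rad <= 1.
Hypothesis eps_small : N%:R * ((2 * eps * rad) `^ (p - 1) * barrier_const) <= c1 / 2.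

Let E := [set x | Om x /\ rad / 2 < enorm (x - x0)].
(* Beyond [r'] the barrier is below [kap], hence below [u + kap]. *)
Let r' : R := Num.max (3 / 4 * rad) (rad - kap / (2 * eps * rad)).
Let S := [set x | 3 / 4 * rad <= enorm (x - x0) <= r'].
Let w x := paraboloid x - u x - kap.

Let er0 : 0 < 2 * eps * rad. Proof. by rewrite !mulr_gt0. Qed.

Let r'rad : r' < rad.
Proof.
have h : 0 < kap / (2 * eps * rad) by rewrite divr_gt0.
by rewrite gt_max; apply/andP; split; move: rad0; lra.
Qed.

Let oE : open E.
Proof.
apply: openI; first exact: open_eball.
have /continuousP h := @continuous_dist R N x0.
exact: (h [set t : R | rad / 2 < t] (@open_gt _ _)).
Qed.

Let cS : closed S.
Proof.
rewrite (_ : S = [set x | enorm (x - x0) <= r'] `&` [set x | 3 / 4 * rad <= enorm (x - x0)]).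
  apply: closedI; first exact: closed_sublevel.
  have /continuous_closedP h := @continuous_dist R N x0.
  exact: (h [set t : R | 3 / 4 * rad <= t] (@closed_ge _ _)).
by apply/seteqP; split => x; [move=> /andP[]|move=> [? ?]; apply/andP].
Qed.

Let SE : S `<=` E.
Proof.
move=> x /andP[h1 h2]; split; first exact: (le_lt_trans h2 r'rad).
by move: rad0 h1; lra.
Qed.

Let w0 x : E x -> ~ S x -> pos_part (w x) = 0.
Proof.
move=> [Omx hx] Sx; suff wx : w x <= 0.
  by have [[]//|[h ->]] := pos_partP (w x); apply/eqP; rewrite eq_le wx h.
have [h1|h1] := leP (enorm (x - x0)) (3 / 4 * rad).
  by have := below h1; rewrite /w; move: kap0; lra.
have h2 : r' < enorm (x - x0) by rewrite ltNge; apply/negP => h2; apply: Sx; rewrite /S /= h2 ltW.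
have h3 : rad - kap / (2 * eps * rad) < enorm (x - x0).
  by apply: le_lt_trans h2; rewrite le_max lexx orbT.
rewrite /w paraboloidE; have := upos Omx.
have : eps * (rad ^+ 2 - enorm (x - x0) ^+ 2) <= kap; last lra.
have h4 : (rad - enorm (x - x0)) * (2 * eps * rad) <= kap.
  by rewrite -ler_pdivlMr//; lra.
apply: le_trans h4.
have -> : rad ^+ 2 - enorm (x - x0) ^+ 2 = (rad - enorm (x - x0)) * (rad + enorm (x - x0)) by ring.
have h5 : enorm (x - x0) < rad by exact: Omx.
rewrite mulrCA ler_wpM2l//; first by rewrite subr_ge0 ltW.
rewrite (_ : 2 * eps * rad = eps * (2 * rad)); last by ring.
by rewrite ler_wpM2l ?(ltW eps0)//; move: h5; lra.
Qed.

Let enormZc x : enorm (Z x) = 2 * eps * enorm (x - x0).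
Proof. by rewrite /Z enormZ normrN ger0_norm// mulr_ge0// ltW. Qed.

Let Zn0 x : E x -> Z x != 0.
Proof.
move=> [_ hx]; rewrite -enorm_gt0 enormZc !mulr_gt0//.
by apply: lt_trans hx; rewrite divr_gt0.
Qed.

Let cZ x : {for x, continuous Z}.
Proof.
apply: (@continuousZ _ _ _ (cst c) (fun x => x - x0)); first exact: cst_continuous.
by apply: continuousB => //; exact: cst_continuous.
Qed.

Let cpow s x : E x -> {for x, continuous (fun x => enorm (Z x) `^ s)}.
Proof.
move=> Ex; apply: continuous_powR_at; first by rewrite enorm_gt0; exact: Zn0.
by apply: (@continuous_comp _ _ _ Z (@enorm R N)); [exact: cZ|exact: continuous_enorm].
Qed.

Let cZi i x : {for x, continuous (fun x => Z x 0 i)}.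
Proof. exact: continuous_coord_at. Qed.

Let cpf s i x : 1 < s -> {for x, continuous (fun x => pfield s (Z x) 0 i)}.
Proof.
move=> s1; apply: (@continuous_comp _ _ _ Z (fun y => pfield s y 0 i)); first exact: cZ.
exact: continuous_pfield.
Qed.

Let cdpf s i x : E x -> {for x, continuous (dpfield c s i)}.
Proof.
move=> Ex; apply: (@continuousM _ _ (cst c) (fun x => enorm (Z x) `^ (s - 2) +
  (s - 2) * enorm (Z x) `^ (s - 4) * Z x 0 i ^+ 2)); first exact: cst_continuous.
apply: (@continuousD _ _ _ (fun x => enorm (Z x) `^ (s - 2))
  (fun x => (s - 2) * enorm (Z x) `^ (s - 4) * Z x 0 i ^+ 2)); first exact: cpow.
apply: (@continuousM _ _ (fun x => (s - 2) * enorm (Z x) `^ (s - 4)) (fun x => Z x 0 i ^+ 2)).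
  apply: (@continuousM _ _ (cst (s - 2)) (fun x => enorm (Z x) `^ (s - 4))); first exact: cst_continuous.
  exact: cpow.
by apply: (@continuousM _ _ (fun x => Z x 0 i) (fun x => Z x 0 i)); exact: cZi.
Qed.

Let V i x := pfield p (Z x) 0 i + a x * pfield q (Z x) 0 i.
Let dV i x := dpfield c p i x + (Ga x 0 i * pfield q (Z x) 0 i + a x * dpfield c q i x).

Let dVP i x : E x -> is_derive x (e_ i) (V i) (dV i x).
Proof.
move=> Ex; have z0 := Zn0 Ex; have [Omx _] := Ex.
have dax := @is_derive_grad R N x0 rad a Ga da Gau x (e_ i) Omx.
have h := is_deriveD (is_derive_pfield p i z0) (is_deriveM dax (is_derive_pfield q i z0)).
apply: (is_derive_eqW h); rewrite dotv_delta /dV /GRing.scale /=.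
by congr (_ + _); rewrite addrC mulrC.
Qed.

Let cV i x : E x -> {for x, continuous (V i)}.
Proof.
move=> [Omx _]; apply: (@continuousD _ _ _ (fun x => pfield p (Z x) 0 i) (fun x => a x * pfield q (Z x) 0 i)).
  exact: cpf.
apply: (@continuousM _ _ a (fun x => pfield q (Z x) 0 i)); last exact: cpf.
exact: within_closure_continuous ca Omx.
Qed.

Let cdV i x : E x -> {for x, continuous (dV i)}.
Proof.
move=> Ex; have [Omx _] := Ex.
apply: (@continuousD _ _ _ (dpfield c p i) (fun x => Ga x 0 i * pfield q (Z x) 0 i + a x * dpfield c q i x)).
  exact: cdpf.
apply: (@continuousD _ _ _ (fun x => Ga x 0 i * pfield q (Z x) 0 i) (fun x => a x * dpfield c q i x)).
  apply: (@continuousM _ _ (fun x => Ga x 0 i) (fun x => pfield q (Z x) 0 i)); last exact: cpf.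
  exact: continuous_coord_at (within_closure_continuous cGa Omx).
apply: (@continuousM _ _ a (dpfield c q i)); last exact: cdpf.
exact: within_closure_continuous ca Omx.
Qed.

Let dV_le i x : E x -> `|dV i x| <= (2 * eps * rad) `^ (p - 1) * barrier_const.
Proof.
move=> Ex; have [Omx hx] := Ex; have /andP[ax aAx] := aA Omx.
have xr : enorm (x - x0) < rad by exact: Omx.
set th := (2 * eps * rad) `^ (p - 1).
have zle : enorm (Z x) <= 2 * eps * rad.
  by rewrite enormZc ler_wpM2l ?mulr_ge0 ?(ltW eps0)// ltW.
have zp s : p <= s -> enorm (Z x) `^ (s - 1) <= th.
  move=> ps; apply: (@le_trans _ _ ((2 * eps * rad) `^ (s - 1))).
    apply: ge0_ler_powR; rewrite ?nnegrE ?enorm_ge0 ?(ltW er0)//.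
    by move: hp ps; lra.
  by rewrite -[leRHS]/(_ `^ _) ger_powR ?er0 ?lerD2r.
have b0 : 0 < rad / 2 by rewrite divr_gt0.
have hz : rad / 2 * `|c| <= enorm (Z x).
  rewrite /c normrN ger0_norm ?mulr_ge0 ?(ltW eps0)// enormZc mulrC.
  by rewrite ler_wpM2l ?mulr_ge0 ?(ltW eps0)// ltW.
have dle s : p <= s -> `|dpfield c s i x| <= (1 + `|s - 2|) / (rad / 2) * th.
  move=> ps; apply: le_trans (dpfield_le _ _ b0 hz) _; first exact: lt_le_trans ps.
  by rewrite ler_wpM2l ?zp// divr_ge0 ?(ltW b0)// addr_ge0.
rewrite /barrier_const /dV mulrDr; apply: le_trans (ler_normD _ _) _; apply: lerD.
  by rewrite mulrC; exact: dle.
rewrite mulrDr; apply: le_trans (ler_normD _ _) _; apply: lerD.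
  rewrite normrM mulrC ler_pM//.
    apply: le_trans (le_coord_norm _ _) _; apply: le_trans (norm_le_enorm _) _.
    by rewrite enorm_pfield// zp.
  by apply: le_trans (le_coord_norm _ _) (GaL Omx).
rewrite normrM (ger0_norm ax) mulrCA ler_pM//.
by rewrite mulrC; exact: dle.
Qed.

Let dw i x : Om x -> is_derive x (e_ i) w (Z x 0 i - G x 0 i).
Proof.
move=> Omx; have dux := @is_derive_grad R N x0 rad u G du Gu x (e_ i) Omx.
have h1 := is_deriveB (is_derive_cst (eps * rad ^+ 2) x (e_ i))
  (is_deriveZ (4 * eps)^-1 (is_derive_dotv_scale c i x)).
have h := is_deriveB (is_deriveB h1 dux) (is_derive_cst kap x (e_ i)).
apply: (is_derive_eqW h); rewrite dotv_delta /GRing.scale /= /c.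
by field; rewrite gt_eqF.
Qed.

Let cw x : Om x -> {for x, continuous (fun x => pos_part (w x))}.
Proof.
move=> Omx; apply: (@continuous_comp _ _ _ w (@pos_part R)); last exact: continuous_pos_part.
apply: (@continuousB _ _ _ (fun x => paraboloid x - u x) (cst kap)); last exact: cst_continuous.
apply: (@continuousB _ _ _ paraboloid u); last exact: cu.
apply: (@continuousB _ _ _ (cst (eps * rad ^+ 2)) (fun x => (4 * eps)^-1 * dotv (Z x) (Z x)));
  first exact: cst_continuous.
apply: (@continuousM _ _ (cst (4 * eps)^-1) (fun x => dotv (Z x) (Z x))); first exact: cst_continuous.
apply: (@continuous_sum_at _ _ _ _ (fun i x => Z x 0 i * Z x 0 i)) => i.
by apply: (@continuousM _ _ (fun x => Z x 0 i) (fun x => Z x 0 i)); exact: cZi.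
Qed.

Let psi i x := 2 * pos_part (w x) * (Z x 0 i - G x 0 i).
Let sq x := pos_part (w x) ^+ 2.

Let csq x : Om x -> {for x, continuous sq}.
Proof.
by move=> Omx; apply: (@continuousM _ _ (fun x => pos_part (w x)) (fun x => pos_part (w x))); exact: cw.
Qed.

Let cpsi i x : Om x -> {for x, continuous (psi i)}.
Proof.
move=> Omx; apply: (@continuousM _ _ (fun x => 2 * pos_part (w x)) (fun x => Z x 0 i - G x 0 i)).
  by apply: (@continuousM _ _ (cst 2) (fun x => pos_part (w x))); [exact: cst_continuous|exact: cw].
apply: (@continuousB _ _ _ (fun x => Z x 0 i) (fun x => G x 0 i)); first exact: cZi.
exact: continuous_coord_at (within_closure_continuous cG Omx).
Qed.

Let sq0 x : E x -> ~ S x -> sq x = 0.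
Proof. by move=> Ex /(w0 Ex) h; rewrite /sq h expr0n. Qed.

Let psi0 i x : E x -> ~ S x -> psi i x = 0.
Proof. by move=> Ex /(w0 Ex) h; rewrite /psi h mulr0 mul0r. Qed.

Let dsq i x : Om x -> is_derive x (e_ i) sq (psi i x).
Proof. by move=> Omx; exact: (is_derive_comp_dir (dw i Omx) (is_derive_pos_part2 _)). Qed.

Let CcE (f : 'rV[R]_N -> R) : (forall x, E x -> {for x, continuous f}) ->
  (forall x, E x -> ~ S x -> f x = 0) -> Cc (f \_ E).
Proof.
move=> cf f0; apply: (@Cc_patch _ _ E S f (r' + `|x0|)) => //.
by move=> x /andP[_]; exact: bounded_sublevel.
Qed.

Let suppE (f : 'rV[R]_N -> R) x : (forall x, E x -> ~ S x -> f x = 0) ->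
  (f \_ E) x != 0 -> enorm (x - x0) <= r'.
Proof.
move=> f0; rewrite patchE; case: ifPn => [/set_mem Ex|]; last by rewrite eqxx.
by move=> fx; have [/andP[]//|Sx] := pselect (S x); rewrite f0// eqxx in fx.
Qed.

Let Csq : Cc (sq \_ E).
Proof. by apply: CcE => [x [Omx _]|]; [exact: csq|exact: sq0]. Qed.

Let Cdiv i : Cc ((fun x => V i x * psi i x + sq x * dV i x) \_ E).
Proof.
apply: CcE => x Ex; last by move=> Sx; rewrite sq0// psi0// mulr0 mul0r addr0.
have [Omx _] := Ex; apply: (@continuousD _ _ _ (fun x => V i x * psi i x) (fun x => sq x * dV i x)).
  by apply: (@continuousM _ _ (V i) (psi i)); [exact: cV|exact: cpsi].
by apply: (@continuousM _ _ sq (dV i)); [exact: csq|exact: cdV].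
Qed.

Let parts i : intg ((fun x => V i x * psi i x + sq x * dV i x) \_ E) = 0.
Proof.
apply: (@intg_derive R N ((fun x => V i x * sq x) \_ E) _ (e_ i)).
- apply: CcE => x Ex; last by move=> /(sq0 Ex) ->; rewrite mulr0.
  by have [Omx _] := Ex; apply: (@continuousM _ _ (V i) sq); [exact: cV|exact: csq].
- exact: Cdiv.
- apply: (is_derive_patch oE cS SE).
  + by move=> x Ex; have [Omx _] := Ex; exact: (is_deriveM (dVP i Ex) (dsq i Omx)).
  + by move=> x Ex Sx; rewrite sq0// mulr0.
  + by move=> x Ex Sx; rewrite sq0// psi0// mulr0 mul0r addr0.
Qed.

(** Comparison principle: test the equation with [sq], the square of the positive
    part of [w], integrate the flux of the barrier by parts, and use that the
    field is monotone. The divergence of the barrier is at most half of the lower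
    bound [c1] of the source, so that the integral of [sq] is nonpositive. *)
Let sq_int : intg (sq \_ E) <= 0.
Proof.
have Cpsi i : Cc (psi i \_ E) by apply: CcE => [x [Omx _]|]; [exact: cpsi|exact: psi0].
have wk := @weak_C1 R N x0 rad p q u a F G hp hpq cG Gu ca cF weak r' (sq \_ E)
  (fun i => psi i \_ E) r'rad Csq.1 (fun i => (Cpsi i).1).
have {}wk := wk (fun i => is_derive_patch oE cS SE (fun x (Ex : E x) => dsq i Ex.1) sq0 (psi0 i))
  (fun x => suppE sq0) (fun i x => suppE (psi0 i)).
have CF : Cc (fun x => (F \_ Om) x * (sq \_ E) x).
  by apply: (Cc_patchM r'rad) => // [|x]; [exact: Csq.1|exact: suppE].
have Cfl : Cc (fun x => \sum_i (fluxc i \_ Om) x * (psi i \_ E) x).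
  apply: Cc_sum => i; apply: (Cc_patchM r'rad) => [x Omx||x].
  - exact: (@continuous_fluxc R N x0 rad p q a G hp hpq cG ca i x Omx).
  - exact: (Cpsi i).1.
  - exact: (suppE (psi0 i)).
pose W i := (fun x => V i x * psi i x + sq x * dV i x) \_ E.
have CW i : Cc (W i) by exact: Cdiv.
have W0 : intg (fun x => \sum_i W i x) = 0 by rewrite intg_sum// big1// => i _; exact: parts.
rewrite -(pmulr_rle0 _ (divr_gt0 c10 (ltr0Sn R 1))) -intgZ//.
apply: (@le_trans _ _ (intg (fun x => (F \_ Om) x * (sq \_ E) x -
   \sum_i (fluxc i \_ Om) x * (psi i \_ E) x + \sum_i W i x))); last first.
  rewrite intgD; [|exact: CcB|exact: Cc_sum].
  by rewrite intgB// wk subrr W0 addr0.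
apply: le_intg; [exact: CcZ|by apply: CcD; [exact: CcB|exact: Cc_sum]|move=> x].
have [Ex|nEx] := pselect (E x); last first.
  rewrite !patchE (memNset nEx) !mulr0 !big1 ?subrr ?addr0// => i _.
    by rewrite /W patchE memNset.
  by rewrite [X in _ * X]patchE memNset// mulr0.
have [Omx _] := Ex.
rewrite (eq_bigr (fun i => fluxc i x * psi i x)) => [|i _]; last by rewrite !patchE !mem_set.
have -> : \sum_i W i x = \sum_i (V i x * psi i x + sq x * dV i x).
  by apply: eq_bigr => i _; rewrite /W patchE mem_set.
rewrite !patchE !mem_set//.
have mono : \sum_i fluxc i x * psi i x <= \sum_i V i x * psi i x.
  have /andP[ax _] := aA Omx.
  rewrite -subr_ge0 -sumrB.
  rewrite (_ : \sum_i _ = 2 * pos_part (w x) * (dotv (pfield p (Z x) - pfield p (G x)) (Z x - G x) +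
     a x * dotv (pfield q (Z x) - pfield q (G x)) (Z x - G x))); last first.
    rewrite /dotv !mulr_sumr -big_split mulr_sumr /=; apply: eq_bigr => i _.
    rewrite /V /fluxc /psi.
    by move: (pfield p (Z x)) (pfield q (Z x)) (pfield p (G x)) (pfield q (G x)) (Z x) (G x) (w x) => ? ? ? ? ? ? ?;
      rewrite !mxE; ring.
  rewrite mulr_ge0// ?mulr_ge0// ?le_max ?lexx//.
  by rewrite addr_ge0// ?mulr_ge0// pfield_monotone.
have sq_ge0 : 0 <= sq x by exact: sqr_ge0.
have div_ge : - (c1 / 2) * sq x <= \sum_i sq x * dV i x.
  rewrite -mulr_sumr mulrC ler_wpM2l// lerNl; apply: le_trans (ler_norm _) _; rewrite normrN.
  apply: le_trans (ler_norm_sum _ _ _) _; apply: le_trans eps_small.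
  rewrite mulr_natl -[X in _ <= _ *+ X](card_ord N) -sumr_const.
  by apply: ler_sum => i _; exact: dV_le.
have Fsq : c1 * sq x <= F x * sq x by rewrite ler_wpM2r// Fc.
by rewrite big_split /=; lra.
Qed.

Lemma comparison x : Om x -> rad / 2 < enorm (x - x0) -> paraboloid x <= u x + kap.
Proof.
move=> Omx hx; rewrite leNgt; apply/negP => h; have Ex : E x by [].
have w_gt0 : 0 < w x by rewrite /w; lra.
have sq_gt0 : 0 < (sq \_ E) x.
  by rewrite patchE mem_set// exprn_gt0//; have [[]|[_ ->]] := pos_partP (w x); first lra.
have /continuousP_eps/(_ ((sq \_ E) x / 2)) := Csq.1 x.
rewrite divr_gt0// => /(_ isT)[d d0 hd].
have := @le_intg_ball R N (sq \_ E) x d ((sq \_ E) x / 2) Csq d0.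
have h1 y : 0 <= (sq \_ E) y by rewrite patchE; case: ifP => // _; exact: sqr_ge0.
move=> /(_ h1); have h2 y : `|x - y| < d -> (sq \_ E) x / 2 <= (sq \_ E) y.
  by move=> /hd; have := ler_norm ((sq \_ E) x - (sq \_ E) y); lra.
move=> /(_ h2) /le_trans/(_ sq_int); apply/negP; rewrite -ltNge.
by rewrite mulr_gt0 ?divr_gt0// exprn_gt0// mulr_gt0.
Qed.

End comparison.
(** For a small [eps] the paraboloid is below [u] on the ball of radius [3 rad / 4],
    and its divergence is below the source; [comparison] extends the inequality up
    to the boundary. *)
Lemma hopf_growth : exists2 eps : R, 0 < eps &
  forall x, Om x -> rad / 2 < enorm (x - x0) -> eps * (rad ^+ 2 - enorm (x - x0) ^+ 2) <= u x.
Proof.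
have Omx0 : Om x0 by rewrite /eball /= subrr enorm0.
have [m m0 hm] : exists2 m : R, 0 < m & forall x, enorm (x - x0) <= 3 / 4 * rad -> m <= u x.
  pose K := [set x | enorm (x - x0) <= 3 / 4 * rad].
  have KOm x : K x -> Om x by apply: sublevel_sub; move: rad0; lra.
  have K0 : K !=set0 by exists x0; rewrite /K /= subrr enorm0 mulr_ge0 ?divr_ge0 ?(ltW rad0).
  have cuK : {within K, continuous u} by apply: continuous_at_within => x /KOm; exact: cu.
  have [c /set_mem Kc cmin] := compact_EVT_min K0 (@compact_sublevel R N x0 _) cuK.
  by exists (u c) => [|x Kx]; [exact: upos (KOm _ Kc)|apply: cmin; exact/mem_set].
have La0 : 0 <= La by exact: le_trans (normr_ge0 _) (GaL Omx0).
have Am0 : 0 <= Am by have /andP[h1 h2] := aA Omx0; exact: le_trans h2.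
pose D := N%:R * barrier_const + 1.
have B0 : 0 <= barrier_const.
  have b0 : 0 <= rad / 2 by rewrite divr_ge0// ltW.
  have h s : 0 <= (1 + `|s - 2|) / (rad / 2) by rewrite divr_ge0// addr_ge0.
  exact: addr_ge0 (h p) (addr_ge0 La0 (mulr_ge0 Am0 (h q))).
have D0 : 0 < D by rewrite ltr_wpDl// mulr_ge0.
pose t := (c1 / 2 / D) `^ (p - 1)^-1.
have t0 : 0 < t by rewrite powR_gt0// !divr_gt0.
pose e := Num.min (m / rad ^+ 2) (Num.min 1 t / (2 * rad)).
have r20 : 0 < 2 * rad by rewrite mulr_gt0.
have e0 : 0 < e by rewrite lt_min !divr_gt0 ?exprn_gt0//= lt_min ltr01.
have eT : 2 * e * rad <= Num.min 1 t.
  by rewrite mulrAC mulrC -ler_pdivlMr// ge_min lexx orbT.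
have e1 : 2 * e * rad <= 1 by apply: le_trans eT _; rewrite ge_min lexx.
have et : 2 * e * rad <= t by apply: le_trans eT _; rewrite ge_min lexx orbT.
have er0 : 0 <= 2 * e * rad by rewrite !mulr_ge0// ltW.
have p10 : 0 < p - 1 by rewrite subr_gt0.
have small : N%:R * ((2 * e * rad) `^ (p - 1) * barrier_const) <= c1 / 2.
  have h : (2 * e * rad) `^ (p - 1) <= c1 / 2 / D.
    apply: (@le_trans _ _ (t `^ (p - 1))).
      by apply: ge0_ler_powR; rewrite ?nnegrE ?(ltW t0) ?(ltW p10).
    by rewrite -powRrM mulVf ?gt_eqF// powRr1// !divr_ge0 ?(ltW D0)// ltW.
  move: h; rewrite ler_pdivlMr//; apply: le_trans.
  rewrite mulrCA ler_wpM2l ?powR_ge0// /D; lra.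
have below x : enorm (x - x0) <= 3 / 4 * rad -> paraboloid e x <= u x.
  move=> hx; apply: le_trans (hm _ hx); rewrite paraboloidE//.
  apply: (@le_trans _ _ (e * rad ^+ 2)).
    by rewrite ler_wpM2l ?(ltW e0)// lerBlDr lerDl sqr_ge0.
  by rewrite -ler_pdivlMr ?exprn_gt0// ge_min lexx.
exists e => // x Omx hx; rewrite -paraboloidE//; apply/ler_addgt0Pr => kap kap0.
exact: (comparison e0 kap0 below e1 small Omx hx).
Qed.

Hypothesis cuc : {within closure Om, continuous u}.
Hypothesis ub : forall x, bdry Om x -> u x = 0.

(** Were the gradient small somewhere near the boundary, integrating along the
    ray to the boundary would contradict the linear growth of [u]. *)
Lemma noncritical_near_boundary : exists2 r, r < rad &
  forall x, Om x -> r <= enorm (x - x0) -> G x != 0.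
Proof.
have [eps eps0 growth] := hopf_growth.
have N1 : 0 < N%:R + 1 :> R by rewrite ltr_wpDl.
pose eta := eps * rad / (N%:R + 1).
have eta0 : 0 < eta by rewrite divr_gt0// mulr_gt0.
have [d d0 hd] := within_unif_continuous (@compact_closure_eball _ _ x0 rad) cG eta0.
exists (Num.max (3 / 4 * rad) (rad - d / 2)).
  by rewrite gt_max; apply/andP; split; move: rad0 d0; lra.
move=> x Omx; rewrite ge_max => /andP[x34 xd]; apply/negP => /eqP Gx0.
set t := enorm (x - x0) in x34 xd *.
have trad : t < rad by exact: Omx.
have t0 : 0 < t by move: rad0 x34; lra.
pose b := x + (rad / t - 1) *: (x - x0).
have ray (s : R) : x + s *: (x - x0) - x0 = (1 + s) *: (x - x0) by rewrite scalerDl scale1r addrAC.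
have raye (s : R) : 0 <= s -> enorm (x + s *: (x - x0) - x0) = (1 + s) * t.
  by move=> s0; rewrite ray enormZ ger0_norm// addr_ge0.
have s10 : 0 < rad / t - 1 by rewrite subr_gt0 ltr_pdivlMr// mul1r.
have eb : enorm (b - x0) = rad by rewrite raye ?(ltW s10)// addrC subrK divfK// gt_eqF.
have clb : closure Om b by apply: closure_eball_ge; rewrite // eb.
have ubb : u b = 0.
  by apply: ub; split => // /interior_subset; rewrite /eball /= eb ltxx.
have key (s : R) : 0 <= s -> s < rad / t - 1 -> u x <= u (x + s *: (x - x0)) + N%:R * eta * (rad - t).
  move=> s0 ss.
  have inOm (l : R) : 0 <= l <= s -> Om (x + l *: (x - x0)).
    move=> /andP[l0 ls]; rewrite /eball /= raye// -ltr_pdivlMr//; lra.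
  have [l ls E] := @MVT_line R N u (fun l => dotv (x - x0) (G (x + l *: (x - x0)))) x (x - x0) s s0
    (fun l ls => @is_derive_grad R N x0 rad u G du Gu _ (x - x0) (inOm l ls)).
  have st : s * t <= rad - t by move: (ltW ss); rewrite lerBrDr ler_pdivlMr// mulrDl mul1r; lra.
  have /andP[l0 ls'] := ls.
  have Gl : `|G (x + l *: (x - x0))| <= eta.
    have := hd x (x + l *: (x - x0)) (subset_closure Omx) (subset_closure (inOm l ls)).
    rewrite Gx0 sub0r normrN opprD addrA subrr sub0r normrN => h; apply/ltW/h.
    rewrite normrZ (ger0_norm l0); apply: (@le_lt_trans _ _ (l * t)).
      by rewrite ler_wpM2l// norm_le_enorm.
    have : l * t <= s * t by rewrite ler_wpM2r// ltW.
    by move: st xd d0; lra.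
  have : `|dotv (x - x0) (G (x + l *: (x - x0))) * s| <= N%:R * eta * (rad - t).
    rewrite normrM (ger0_norm s0).
    apply: (@le_trans _ _ (t * (N%:R * eta) * s)).
      rewrite ler_wpM2r//; apply: le_trans (dotv_norm_le _ _) _; rewrite ler_wpM2l ?(ltW t0)//.
      by apply: le_trans (enorm_le_norm _) _; rewrite ler_wpM2l.
    rewrite mulrAC mulrC ler_wpM2l//; first by rewrite mulr_ge0 ?(ltW eta0).
    by rewrite mulrC.
  move: E => /eqP; rewrite subr_eq => /eqP -> h.
  have := ler_norm (- (dotv (x - x0) (G (x + l *: (x - x0))) * s)); rewrite normrN; move: h; lra.
have ux : u x <= N%:R * eta * (rad - t).
  apply/ler_addgt0Pr => e e0; move/withinP_eps: cuc => /(_ b clb e e0)[d' d'0 hd'].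
  pose s := Num.max 0 (rad / t - 1 - d' / (2 * t)).
  have dt0 : 0 < d' / (2 * t) by rewrite divr_gt0// mulr_gt0.
  have s0 : 0 <= s by rewrite le_max lexx.
  have ss : s < rad / t - 1 by rewrite gt_max s10/= ltrBlDr ltrDl.
  have Oms : Om (x + s *: (x - x0)) by rewrite /eball /= raye// -ltr_pdivlMr//; lra.
  apply: le_trans (key s s0 ss) _; rewrite addrC lerD2l.
  have := hd' _ (subset_closure Oms).
  have -> : b - (x + s *: (x - x0)) = (rad / t - 1 - s) *: (x - x0).
    by rewrite [RHS]scalerBl /b opprD addrACA subrr add0r.
  rewrite ubb sub0r normrN => h; apply: le_trans (ler_norm _) _; apply/ltW/h.
  have ds : rad / t - 1 - s <= d' / (2 * t).
    by rewrite lerBlDr -lerBlDl le_max lexx orbT.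
  rewrite normrZ ger0_norm ?subr_ge0 ?(ltW ss)//.
  apply: (@le_lt_trans _ _ (d' / (2 * t) * t)).
    by rewrite ler_pM ?subr_ge0 ?(ltW ss)// norm_le_enorm.
  have -> : d' / (2 * t) * t = d' / 2 by field; rewrite gt_eqF.
  by move: d'0; lra.
have h2 : rad / 2 < enorm (x - x0) by rewrite -/t; move: rad0 x34; lra.
have := growth x Omx h2; rewrite -/t.
have : N%:R * eta <= eps * rad.
  rewrite /eta mulrCA ler_piMr ?mulr_ge0 ?(ltW eps0) ?(ltW rad0)//.
  by rewrite ler_pdivrMr// mul1r lerDl.
have rt : 0 < rad - t by rewrite subr_gt0.
move=> h3; have := ler_wpM2r (ltW rt) h3; move: ux.
have -> : eps * (rad ^+ 2 - t ^+ 2) = eps * rad * (rad - t) + eps * t * (rad - t) by ring.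
have : 0 < eps * t * (rad - t) by rewrite !mulr_gt0.
lra.
Qed.

End boundary.

(** * Connectedness of an annulus and regularity of the source *)

Section annulus.
Variables (R : realType) (N : nat) (x0 : 'rV[R]_N) (r rad : R).
Hypotheses (hN : (2 <= N)%N) (r0 : 0 < r) (rrad : r < rad).
Implicit Types (x y z : 'rV[R]_N) (t : R).

Definition annulus : set 'rV[R]_N := [set x | r <= enorm (x - x0) < rad].

(** The segment from [y] to [z], with its length corrected so as to interpolate
    linearly between those of [y] and [z]. *)
Lemma annulus_link y z : annulus (x0 + y) -> annulus (x0 + z) ->
  (forall t, 0 <= t <= 1 -> (1 - t) *: y + t *: z != 0) ->
  connected_component annulus (x0 + y) (x0 + z).
Proof.
have shift w : x0 + w - x0 = w by rewrite addrAC subrr add0r.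
rewrite /annulus /= !shift => /andP[y1 y2] /andP[z1 z2] h.
pose w t := (1 - t) *: y + t *: z.
pose l t := (1 - t) * enorm y + t * enorm z.
pose gamma t := x0 + (l t / enorm (w t)) *: w t.
have cw t : {for t, continuous w}.
  apply: (@continuousD _ _ _ (fun t : R => (1 - t) *: y) (fun t : R => t *: z)).
    apply: (@continuousZ _ _ _ (fun t : R => 1 - t) (cst y)); last exact: cst_continuous.
    by apply: (@continuousB _ _ _ (cst (1 : R)) id); [exact: cst_continuous|].
  by apply: (@continuousZ _ _ _ id (cst z)); last exact: cst_continuous.
have cl t : {for t, continuous l}.
  apply: (@continuousD _ _ _ (fun t : R => (1 - t) * enorm y) (fun t : R => t * enorm z)).
    apply: (@continuousM _ _ (fun t : R => 1 - t) (cst (enorm y))); last exact: cst_continuous.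
    by apply: (@continuousB _ _ _ (cst (1 : R)) id); [exact: cst_continuous|].
  by apply: (@continuousM _ _ id (cst (enorm z))); last exact: cst_continuous.
have w0 t : 0 <= t <= 1 -> 0 < enorm (w t) by move=> /h; rewrite enorm_gt0.
have y0 : 0 < enorm y by exact: lt_le_trans y1.
have z0 : 0 < enorm z by exact: lt_le_trans z1.
have l_itv t : 0 <= t <= 1 -> r <= l t < rad.
  move=> /andP[t0 t1]; have t1' : 0 <= 1 - t by rewrite subr_ge0.
  apply/andP; split.
    apply: (@le_trans _ _ ((1 - t) * r + t * r)); first by rewrite -mulrDl subrK mul1r.
    by apply: lerD; rewrite ler_wpM2l.
  have [->|tn] := eqVneq t 0; first by rewrite /l subr0 mul1r mul0r addr0.
  apply: (@lt_le_trans _ _ ((1 - t) * rad + t * rad)); last by rewrite -mulrDl subrK mul1r.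
  apply: ler_ltD; first by rewrite ler_wpM2l// ltW.
  by rewrite ltr_pM2l// lt_neqAle eq_sym tn.
have cg : {within `[0, 1], continuous gamma}.
  apply: continuous_in_subspaceT => t; rewrite inE /= in_itv /= => t01.
  apply: (@continuousD _ _ _ (cst x0) (fun t => (l t / enorm (w t)) *: w t)); first exact: cst_continuous.
  apply: (@continuousZ _ _ _ (fun t => l t / enorm (w t)) w); last exact: cw.
  apply: (@continuousM _ _ l (fun t => (enorm (w t))^-1)); first exact: cl.
  apply: (@continuousV _ _ (fun t => enorm (w t))); first by rewrite gt_eqF// w0.
  by apply: (@continuous_comp _ _ _ w (@enorm R N)); [exact: cw|exact: continuous_enorm].
have cimg := connected_continuous_connected (@segment_connected R 0 1) cg.
have gE t : 0 <= t <= 1 -> enorm (gamma t - x0) = l t.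
  move=> t01; rewrite shift enormZ ger0_norm; last first.
    by rewrite divr_ge0 ?enorm_ge0// (le_trans (ltW r0))//; have /andP[] := l_itv t t01.
  by rewrite divfK// gt_eqF// w0.
have g0 : gamma 0 = x0 + y.
  by rewrite /gamma /l /w subr0 !mul1r !mul0r scale1r scale0r !addr0 divff ?scale1r// gt_eqF.
have g1 : gamma 1 = x0 + z.
  by rewrite /gamma /l /w subrr !mul1r !mul0r scale1r scale0r !add0r divff ?scale1r// gt_eqF.
apply: (connected_component_max _ _ cimg).
- by exists 0 => //=; rewrite in_itv /= lexx ler01.
- by move=> _ [t /= + <-]; rewrite in_itv /= => t01; rewrite /annulus /= gE// l_itv.
- by exists 1 => //=; rewrite in_itv /= lexx ler01.
Qed.

(** Antipodal points are joined through a point off their common line. *)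
Lemma connected_annulus : connected annulus.
Proof.
pose e i : 'rV[R]_N := r *: delta_mx 0 i.
have dotv_e i w : dotv (e i) w = r * w 0 i by rewrite dotvZl dotv_delta.
have eA i : annulus (x0 + e i).
  rewrite /annulus /= addrAC subrr add0r enormZ (ger0_norm (ltW r0)).
  by rewrite /enorm dotv_delta mxE !eqxx sqrtr1 mulr1 lexx.
have coord_neq0 y : annulus (x0 + y) -> exists j, y 0 j != 0.
  rewrite /annulus /= addrAC subrr add0r => /andP[ry _].
  have y0 : y != 0 by rewrite -enorm_gt0; exact: lt_le_trans ry.
  apply: contrapT => h; move: y0; apply/negP/negPn/eqP/rowP => j; rewrite mxE.
  by apply/eqP/negPn/negP => yj; apply: h; exists j.
have link_e y i j : annulus (x0 + y) -> y 0 j != 0 -> i != j ->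
    connected_component annulus (x0 + y) (x0 + e i).
  move=> Ay yj ij; apply: annulus_link => // t /andP[t0 t1]; apply/eqP => h.
  have := congr1 (fun v : 'rV[R]_N => v 0 j) h; rewrite !mxE eqxx eq_sym (negbTE ij) !mulr0 addr0.
  move/eqP; rewrite mulf_eq0 (negbTE yj) orbF subr_eq0 => /eqP t1'.
  move: h; rewrite -t1' subrr scale0r scale1r add0r => /rowP/(_ i); rewrite !mxE !eqxx mulr1.
  by move/eqP; rewrite gt_eqF.
pose i0 : 'I_N := Ordinal (ltnW hN); pose i1 : 'I_N := Ordinal hN.
have link y z : annulus (x0 + y) -> annulus (x0 + z) -> connected_component annulus (x0 + y) (x0 + z).
  move=> Ay Az; have [h|] := pselect (forall t, 0 <= t <= 1 -> (1 - t) *: y + t *: z != 0).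
    exact: annulus_link.
  move=> /existsNP[t /not_implyP[/andP[t0 t1] /negP/negPn/eqP h]].
  have [j yj] := coord_neq0 y Ay.
  have zj : z 0 j != 0.
    apply/eqP => zj0; have := congr1 (fun v : 'rV[R]_N => v 0 j) h; rewrite !mxE zj0 mulr0 addr0.
    move/eqP; rewrite mulf_eq0 (negbTE yj) orbF subr_eq0 => /eqP t1'.
    have [k zk] := coord_neq0 z Az; move: h; rewrite -t1' subrr scale0r scale1r add0r => /rowP/(_ k).
    by rewrite mxE => /eqP; rewrite (negbTE zk).
  have [i ij] : exists i : 'I_N, i != j.
    by have [<-|i0j] := eqVneq i0 j; [exists i1|exists i0].
  exact: connected_component_trans (link_e y i j Ay yj ij)
    (connected_component_sym (link_e z i j Az zj ij)).
have -> : annulus = connected_component annulus (x0 + e i0); last exact: component_connected.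
apply/seteqP; split => [y Ay|]; last exact: connected_component_sub.
have yE : x0 + (y - x0) = y by rewrite addrC subrK.
by rewrite -yE; apply: link; rewrite ?yE.
Qed.

End annulus.

Lemma lipschitz_of_grad (R : realType) (N : nat) (x0 : 'rV[R]_N) (r M : R)
    (f : 'rV[R]_N -> R) (Gf : 'rV[R]_N -> 'rV[R]_N) :
  (forall x v, enorm (x - x0) <= r -> is_derive x v f (dotv v (Gf x))) ->
  (forall x, enorm (x - x0) <= r -> `|Gf x| <= M) ->
  forall x y, enorm (x - x0) <= r -> enorm (y - x0) <= r ->
    `|f x - f y| <= N%:R * N%:R * M * `|x - y|.
Proof.
move=> df GM x y xr yr.
have inr (s : R) : 0 <= s <= 1 -> enorm (x + s *: (y - x) - x0) <= r.
  by move=> s01; exact: enorm_convex s01 xr yr.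
have [s s01 E] := @MVT_line R N f (fun s => dotv (y - x) (Gf (x + s *: (y - x)))) x (y - x) 1 ler01
  (fun s s01 => df _ (y - x) (inr s s01)).
have e1 : x + 1 *: (y - x) = y by rewrite scale1r addrC subrK.
rewrite e1 mulr1 in E; rewrite distrC E.
apply: le_trans (dotv_norm_le _ _) _.
apply: (@le_trans _ _ ((N%:R * `|x - y|) * (N%:R * M))); last first.
  by rewrite le_eqVlt; apply/orP; left; apply/eqP; ring.
rewrite ler_pM ?enorm_ge0//; first by rewrite distrC; exact: enorm_le_norm.
by apply: le_trans (enorm_le_norm _) _; rewrite ler_wpM2l// GM// inr.
Qed.

Lemma compact_norm_bounded (R : realType) (V W : normedModType R) (K : set V) (f : V -> W) :
  compact K -> {within K, continuous f} -> exists2 M : R, 0 <= M & forall x, K x -> `|f x| <= M.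
Proof.
move=> cK /withinP_eps cf; have [[x Kx]|K0] := pselect (K !=set0); last first.
  by exists 0 => // x Kx; exfalso; apply: K0; exists x.
have cn : {within K, continuous (fun x => `|f x|)}.
  apply/withinP_eps => y Ky e e0; have [d d0 hd] := cf y Ky e e0.
  by exists d => // z Kz yz; apply: le_lt_trans (ler_dist_dist _ _) (hd z Kz yz).
have [z _ zmax] := compact_EVT_max (ex_intro _ x Kx) cK cn.
by exists `|f z| => // y Ky; apply: zmax; exact/mem_set.
Qed.

Section source_term.
Variables (R : realType) (N : nat) (x0 : 'rV[R]_N) (rad delta : R).
Variables (g h u : 'rV[R]_N -> R) (Gg Gh G : 'rV[R]_N -> 'rV[R]_N) (f : R -> R).
Local Notation Om := (eball x0 rad).
Hypotheses (dg : forall x, Om x -> differentiable g x) (dh : forall x, Om x -> differentiable h x)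
  (du : forall x, Om x -> differentiable u x).
Hypotheses (Ggu : forall x, Om x -> Gg x = grad g x) (Ghu : forall x, Om x -> Gh x = grad h x)
  (Gu : forall x, Om x -> G x = grad u x).
Hypotheses (cGg : {within closure Om, continuous Gg}) (cGh : {within closure Om, continuous Gh})
  (cG : {within closure Om, continuous G}).
Hypotheses (upos : forall x, Om x -> 0 < u x).
Hypotheses (df : forall t, derivable f t 1) (cf' : continuous (derive1 f)).

Definition source x : R := g x * u x `^ (- delta) + h x * f (u x).

(* The gradient of the source, from the chain rule; it is continuous inside the
   ball, where [u] is positive. *)
Let source_grad x : 'rV[R]_N :=
  u x `^ (- delta) *: Gg x + f (u x) *: Gh x +
  (g x * (- delta * u x `^ (- delta - 1)) + h x * derive1 f (u x)) *: G x.

Let fP (t : R) : is_derive t 1 f (derive1 f t).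
Proof. by rewrite derive1E; split. Qed.

Let is_derive_source x v : Om x -> is_derive x v source (dotv v (source_grad x)).
Proof.
move=> Omx; have ux := upos Omx.
have hu := @is_derive_grad R N x0 rad u G du Gu x v Omx.
have hg := @is_derive_grad R N x0 rad g Gg dg Ggu x v Omx.
have hh := @is_derive_grad R N x0 rad h Gh dh Ghu x v Omx.
have h1 := is_deriveM hg (is_derive_comp_dir hu (is_derive1_powR (- delta) ux)).
have h2 := is_deriveM hh (is_derive_comp_dir hu (fP (u x))).
apply: (is_derive_eqW (is_deriveD h1 h2)).
by rewrite /source_grad !dotvDr !dotvZr /GRing.scale /=; ring.
Qed.

Let diff_continuous_at (w : 'rV[R]_N -> R) : (forall x, Om x -> differentiable w x) ->
  forall x, Om x -> {for x, continuous w}.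
Proof. by move=> dw x Omx; apply: differentiable_continuous; exact: dw. Qed.

Let cpow s x : Om x -> {for x, continuous (fun x => u x `^ s)}.
Proof.
by move=> Omx; apply: continuous_powR_at; [exact: upos|exact: diff_continuous_at].
Qed.

Let cfu x : Om x -> {for x, continuous (fun x => f (u x))}.
Proof.
move=> Omx; apply: (@continuous_comp _ _ _ u f); first exact: diff_continuous_at.
by apply: differentiable_continuous; apply/derivable1_diffP.
Qed.

Lemma continuous_source x : Om x -> {for x, continuous source}.
Proof.
move=> Omx; apply: (@continuousD _ _ _ (fun x => g x * u x `^ (- delta)) (fun x => h x * f (u x))).
  by apply: (@continuousM _ _ g (fun x => u x `^ (- delta))); [exact: diff_continuous_at|exact: cpow].
by apply: (@continuousM _ _ h (fun x => f (u x))); [exact: diff_continuous_at|exact: cfu].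
Qed.

Let continuous_source_grad x : Om x -> {for x, continuous source_grad}.
Proof.
move=> Omx.
apply: (@continuousD _ _ _ (fun x => u x `^ (- delta) *: Gg x + f (u x) *: Gh x)
  (fun x => (g x * (- delta * u x `^ (- delta - 1)) + h x * derive1 f (u x)) *: G x)).
  apply: (@continuousD _ _ _ (fun x => u x `^ (- delta) *: Gg x) (fun x => f (u x) *: Gh x)).
    apply: (@continuousZ _ _ _ (fun x => u x `^ (- delta)) Gg); first exact: cpow.
    exact: within_closure_continuous cGg Omx.
  apply: (@continuousZ _ _ _ (fun x => f (u x)) Gh); first exact: cfu.
  exact: within_closure_continuous cGh Omx.
apply: (@continuousZ _ _ _ (fun x => g x * (- delta * u x `^ (- delta - 1)) + h x * derive1 f (u x)) G);
  last exact: within_closure_continuous cG Omx.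
apply: (@continuousD _ _ _ (fun x => g x * (- delta * u x `^ (- delta - 1)))
  (fun x => h x * derive1 f (u x))).
  apply: (@continuousM _ _ g (fun x => - delta * u x `^ (- delta - 1))); first exact: diff_continuous_at.
  apply: (@continuousM _ _ (cst (- delta)) (fun x => u x `^ (- delta - 1))); first exact: cst_continuous.
  exact: cpow.
apply: (@continuousM _ _ h (fun x => derive1 f (u x))); first exact: diff_continuous_at.
by apply: (@continuous_comp _ _ _ u (derive1 f)); [exact: diff_continuous_at|exact: cf'].
Qed.

Lemma source_lipschitz r : r < rad -> exists2 LF : R, 0 <= LF &
  forall x y, enorm (x - x0) <= r -> enorm (y - x0) <= r ->
    `|source x - source y| <= LF * `|x - y|.
Proof.
move=> rrad; pose K := [set x : 'rV[R]_N | enorm (x - x0) <= r].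
have KOm x : K x -> Om x by exact: sublevel_sub.
have [M M0 hM] : exists2 M : R, 0 <= M & forall x, K x -> `|source_grad x| <= M.
  apply: compact_norm_bounded; first exact: compact_sublevel.
  by apply: continuous_at_within => x /KOm; exact: continuous_source_grad.
exists (N%:R * N%:R * M); first by rewrite !mulr_ge0.
by apply: (@lipschitz_of_grad R N x0 r M source source_grad) => // x v xr; apply: is_derive_source; exact: KOm.
Qed.

Hypothesis cuc : {within closure Om, continuous u}.
Hypothesis delta0 : 0 < delta.

Lemma source_ge (c : R) : 0 < c -> (forall x, Om x -> c <= g x) ->
  (forall x, Om x -> 0 <= h x * f (u x)) ->
  exists2 c1 : R, 0 < c1 & forall x, Om x -> c1 <= source x.
Proof.
move=> c0 gc hf; have [M M0 uM] := compact_norm_bounded (@compact_closure_eball R N x0 rad) cuc.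
have M1 : 0 < M + 1 by rewrite ltr_wpDl.
exists (c * (M + 1) `^ (- delta)) => [|x Omx]; first by rewrite mulr_gt0// powR_gt0.
rewrite /source -[leLHS]addr0 lerD ?hf// ler_pM ?powR_ge0 ?(ltW c0) ?gc//.
rewrite !powRN lef_pV2 ?posrE ?powR_gt0 ?upos//.
apply: ge0_ler_powR; rewrite ?nnegrE ?(ltW delta0) ?(ltW M1) ?(ltW (upos Omx))//.
have := uM x (subset_closure Omx); rewrite ger0_norm ?(ltW (upos Omx))//; lra.
Qed.

End source_term.

Theorem theorem3p8 (R : realType) (N : nat) (p q delta beta0 c rad : R)
  (x0 : 'rV[R]_N) (f : R -> R) (g h a u : 'rV[R]_N -> R)
  (hN : (2 <= N)%N) (hp : 1 < p) (hpq : p <= q)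
  (hdelta0 : 0 < delta) (hdelta1 : delta < 1) (hrad : 0 < rad)
  (Om : set 'rV[R]_N) (hOm : Om = eball x0 rad)
  (hbeta0 : 0 <= beta0) (hbeta0delta : beta0 + delta < 1)
  (hCg : cond_g Om beta0 g) (hCfh : cond_fh Om p f h) (hCa : cond_a Om a)
  (hc : 0 < c)
  (hf_diff : forall t, derivable f t 1) (hf_C1 : continuous (derive1 f))
  (hf_mono : {homo f : s t / s <= t})
  (hg_C1 : C1_closure Om g) (hg_rad : radially_decreasing x0 rad g)
  (hg_ge : forall x, closure Om x -> c <= g x)
  (hh_C1 : C1_closure Om h) (hh_rad : radially_decreasing x0 rad h)
  (hh_ge : forall x, closure Om x -> c <= h x)
  (ha_C1 : C1_closure Om a) (ha_rad : radially_increasing x0 rad a)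
  (ha_ge0 : forall x, closure Om x -> 0 <= a x)
  (hu_C1 : C1_closure Om u)
  (hu : weak_solution Om p q delta f g h a u) :
  connected (Om `\` crit_set Om u) /\
  (forall x, (Om `\` crit_set Om u) x ->
     ~ closure (connected_component (Om `\` crit_set Om u) x) `<=` Om).
Proof.
subst Om; set Om := eball x0 rad.
have [upos ub weak] := hu.
have [cuc du [G cG Gu]] := hu_C1.
have [_ dg [Gg cGg Ggu]] := hg_C1.
have [_ dh [Gh cGh Ghu]] := hh_C1.
have [ca da [Ga cGa Gau]] := ha_C1.
pose F := source delta g h u f.
have inOm x : Om x -> closure Om x := @subset_closure _ Om x.
have cF x : Om x -> {for x, continuous F} .
  by move=> Omx; exact: (continuous_source dg dh du upos hf_diff Omx).
have [c1 c10 Fc] : exists2 c1 : R, 0 < c1 & forall x, Om x -> c1 <= F x.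
  apply: (source_ge upos cuc hdelta0 hc) => // x Omx; first exact: hg_ge (inOm x Omx).
  have [hf _ _] := hCfh; exact: hf (inOm x Omx) (ltW (upos x Omx)).
have [Am Am0 aA'] := compact_norm_bounded (@compact_closure_eball R N x0 rad) ca.
have aA x : Om x -> 0 <= a x <= Am.
  move=> Omx; have a0 := ha_ge0 x (inOm x Omx).
  by rewrite a0 /= -(ger0_norm a0) aA'//; exact: inOm.
have [La La0 GaL'] := compact_norm_bounded (@compact_closure_eball R N x0 rad) cGa.
have GaL x : Om x -> `|Ga x| <= La by move=> /inOm; exact: GaL'.
have aL x y : Om x -> Om y -> `|a x - a y| <= N%:R * N%:R * La * `|x - y|.
  move=> Omx Omy; pose r := Num.max (enorm (x - x0)) (enorm (y - x0)).
  have rrad : r < rad by rewrite gt_max; apply/andP.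
  apply: (@lipschitz_of_grad R N x0 r La a Ga) => [z v zr|z zr||].
  - by apply: (is_derive_grad da Gau); exact: sublevel_sub zr.
  - by apply: GaL; exact: sublevel_sub zr.
  - by rewrite le_max lexx.
  - by rewrite le_max lexx orbT.
have [L L0 GL] : exists2 L : R, 0 < L & forall x, Om x -> enorm (G x) <= L.
  have [M M0 GM] := compact_norm_bounded (@compact_closure_eball R N x0 rad) cG.
  exists (N%:R * M + 1) => [|x Omx]; first by rewrite ltr_wpDl// mulr_ge0.
  apply: le_trans (enorm_le_norm _) _; apply: (@le_trans _ _ (N%:R * M)); last by rewrite lerDl.
  by rewrite ler_wpM2l// GM//; exact: inOm.
have [r' r'rad Gne] := noncritical_near_boundary hp hpq hrad cG du Gu ca cGa da Gau cF weak upos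
  aA GaL c10 Fc cuc ub.
pose r := Num.max r' (rad / 2).
have r0 : 0 < r by rewrite lt_max divr_gt0// orbT.
have rrad : r < rad by rewrite gt_max r'rad/= ltr_pdivrMr// mulr2n mulrDr mulr1 ltrDl.
set A := Om `\` crit_set Om u.
have AE x : A x <-> Om x /\ G x != 0.
  split=> [[Omx Zx]|[Omx Gx]].
    by split => //; apply/eqP => Gx0; apply: Zx; split; rewrite // -Gu.
  by split => // -[_]; rewrite -Gu// => /eqP; rewrite (negbTE Gx).
have anA : annulus x0 r rad `<=` A.
  move=> x /andP[rx xr]; apply/AE; split; first exact: xr.
  by apply: Gne; [exact: xr|apply: le_trans rx; rewrite le_max lexx].
have oA : open A.
  rewrite openE => x /AE[Omx Gx].
  have /continuousP_eps/(_ `|G x|) := within_closure_continuous cG Omx.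
  rewrite normr_gt0 => /(_ Gx)[d d0 hd].
  have nO : nbhs x Om by apply: open_nbhs_nbhs; split => //; exact: open_eball.
  apply: filterS2 nO (nbhsx_ballx x d d0) => y Omy; rewrite -ball_normE /= => /hd xy.
  by apply/AE; split => //; apply/eqP => Gy; move: xy; rewrite Gy subr0 ltxx.
pose r1 := (r + rad) / 2.
have rr1 : r < r1 by rewrite /r1; lra.
have r1rad : r1 < rad by rewrite /r1; lra.
have [LF LF0 FL] := source_lipschitz delta dg dh du Ggu Ghu Gu cGg cGh cG upos hf_diff hf_C1 r1rad.
have no_piece (B W C : set 'rV[R]_N) : open W -> closed C -> B = A `&` W -> B = A `&` C ->
    annulus x0 r rad `&` B = set0 -> B = set0.
  move=> oW cC BW BC Ban; have BA : B `<=` A by rewrite BW; exact: subIsetl.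
  have oB : open B by rewrite BW; exact: openI.
  have Br x : B x -> enorm (x - x0) <= r.
    move=> Bx; rewrite leNgt; apply/negP => rx.
    have [Omx _] := (AE x).1 (BA _ Bx).
    suff : (annulus x0 r rad `&` B) x by rewrite Ban.
    by split => //; rewrite /annulus /= ltW.
  apply/seteqP; split => // x1 Bx1.
  apply: (@no_interior_piece R N x0 rad p q u a F G hp hpq cG du Gu ca cF weak
    B r r1 L (N%:R * N%:R * La) Am LF rr1 r1rad _ LF0 oB Br _ _ L0 GL aA aL FL c1 x1 c10) => //.
  - by rewrite !mulr_ge0.
  - by move=> x /BA/AE[].
  - move=> x clB Omx Gx; rewrite BC; split; first by apply/AE.
    have /closure_id -> := cC; apply: closureS clB; rewrite BC; exact: subIsetr.
  - by move=> x /BA/AE[Omx _]; exact: Fc.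
have can : connected (annulus x0 r rad) by exact: connected_annulus.
(* Of the two relatively clopen parts [B] and [A `&` ~` B], one contains the
   connected annulus and the other misses it, hence is empty. *)
have cA : connected A.
  move=> B [x0' Bx0'] [W oW BW] [C cC BC].
  have [dis|[y [any By]]] : annulus x0 r rad `&` B = set0 \/ annulus x0 r rad `&` B !=set0.
    by have [->|/set0P] := eqVneq (annulus x0 r rad `&` B) set0; [left|right].
    by have := no_piece B W C oW cC BW BC dis; move=> B0; rewrite B0 in Bx0'.
  have anB : annulus x0 r rad `&` B = annulus x0 r rad.
    apply: can; first by exists y.
    - by exists W => //; rewrite BW setIA (setIidl anA).
    - by exists C => //; rewrite BC setIA (setIidl anA).
  have AB : A `&` ~` B = set0.
    apply: (no_piece (A `&` ~` B) (~` C) (~` W)).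
    - exact: closed_openC.
    - exact: open_closedC.
    - by rewrite BC setCI setIUr setICr set0U.
    - by rewrite BW setCI setIUr setICr set0U.
    - by rewrite -anB -setIA (setIC B) -setIA setICl !setI0.
  apply/seteqP; split => [x|x Ax]; first by rewrite BW => -[].
  apply: contrapT => Bx; suff : (A `&` ~` B) x by rewrite AB.
  by [].
split => // x Ax; rewrite (connected_component_id Ax cA) => clA.
(* The annulus accumulates at the boundary point [b]. *)
pose i0 : 'I_N := Ordinal (ltnW hN).
pose b := x0 + rad *: delta_mx 0 i0.
have eb : enorm (b - x0) = rad.
  rewrite /b addrAC subrr add0r enormZ (ger0_norm (ltW hrad)).
  by rewrite /enorm dotv_delta mxE !eqxx sqrtr1 mulr1.
suff /clA : closure A b by rewrite /Om /eball /= eb ltxx.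
have clb : closure Om b by apply: closure_eball_ge; rewrite // eb.
move=> U Ub; have nV : nbhs b (U `&` [set y | r < enorm (y - x0)]).
  apply: filterI => //; apply: open_nbhs_nbhs; split; last by rewrite /= eb.
  have /continuousP open_preim := @continuous_dist R N x0.
  exact: (open_preim [set t : R | r < t] (@open_gt _ _)).
have [y [Omy [Uy ry]]] := clb _ nV.
by exists y; split => //; apply: anA; rewrite /annulus /= ltW.
Qed.
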